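(* Suppose $p\in I$, $q\notin I$ and $p$ is not a root of unity. Let $\nu\in{}^\theta\mathbb{N}I$ be such that $p$ appears with multiplicity exactly two in $\nu$ (i.e. $\nu_p=2$). Let $\tilde\nu=\sum_{i\in I^+}\nu_i i$ and let $\mathbf{R}^+_{\tilde\nu}$ be the associated KLR algebra. Then $\mathfrak{W}_\nu$ and $\mathbf{R}^+_{\tilde\nu}\otimes_{\mathbf{k}[z]}\tilde A$ are Morita equivalent.
   Context: **Setting.** $\mathbf{k}$ is a field with $\operatorname{char}\mathbf{k}\neq 2$; $p,q\in\mathbf{k}^\times$ are fixed with $p\neq\pm1$, $p$ not a power of $q$ and $q$ not a power of $p$. $\mathbb{Z}\rtimes\mathbb{Z}_2$ acts on $\mathbf{k}^\times$ by $(n,\varepsilon)\cdot\lambda=p^{2n}\lambda^{\varepsilon}$, $\varepsilon\in\{\pm1\}$. $I=I_p=\{p^{2n+1}\mid n\in\mathbb{Z}\}$, with $\pm1\notin I$; $I^+=\{p^{2n+1}\mid n\ge0\}$, $I^-=\{p^{2n-1}\mid n\le0\}$, so $I=I^+\sqcup I^-$. $\Gamma_I$ is the quiver with vertex set $I$ and one arrow $p^2i\to i$ for every $i\in I$ (in particular $p\to p^{-1}$). ${}^\theta\mathbb{N}I$ is the set of formal sums $\nu=\sum_{i\in I}\nu_i i$ with finite support, $\nu_i\in\mathbb{Z}_{\ge0}$ and $\nu_i=\nu_{i^{-1}}$; $|\nu|=\sum_i\nu_i=2m$. ${}^\theta I^\nu=\{\mathbf{i}\in I^m\mid\sum_k i_k+\sum_k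 i_k^{-1}=\nu\}$ (formal sums). For $\tilde\nu=\sum_{i\in I^+}\nu_i i$ (so $\sum_{i\in I^+}\nu_i=m$), $I^{\tilde\nu}=\{\mathbf{i}\in I^m\mid\sum_ki_k=\tilde\nu\}$. **Arrow notation.** $i\to j$ (equivalently $j\leftarrow i$): there is an arrow from $i$ to $j$ and none from $j$ to $i$; $i\leftrightarrow j$: arrows in both directions; $i\nleftrightarrow j$: $i\ne j$ and no arrows between them. **KLR algebra.** $\mathbf{R}^+_{\tilde\nu}=\mathbf{R}_{\tilde\nu}$ is the $\mathbf{k}$-algebra generated by $x_1,\dots,x_m$, $\sigma_1,\dots,\sigma_{m-1}$ and $\mathbf{e}(\mathbf{i})$, $\mathbf{i}\in I^{\tilde\nu}$, with relations ($s_k$ swaps entries $k,k+1$): (1) $\mathbf{e}(\mathbf{i})\mathbf{e}(\mathbf{j})=\delta_{\mathbf{ij}}\mathbf{e}(\mathbf{i})$, $\sigma_k\mathbf{e}(\mathbf{i})=\mathbf{e}(s_k\mathbf{i})\sigma_k$, $x_l\mathbf{e}(\mathbf{i})=\mathbf{e}(\mathbf{i})x_l$, $\sum_{\mathbf{i}}\mathbf{e}(\mathbf{i})=1$. (2) The $x_l$ commute. (3) $\sigma_k^2\mathbf{e}(\mathbf{i})$ equals $\mathbf{e}(\mathbf{i})$ if $i_k\nleftrightarrow i_{k+1}$; $(x_{k+1}-x_k)\mathbf{e}(\mathbf{i})$ if $i_k\leftarrow i_{k+1}$; $(x_k-x_{k+1})\mathbf{e}(\mathbf{i})$ if $i_k\to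 i_{k+1}$; $(x_{k+1}-x_k)(x_k-x_{k+1})\mathbf{e}(\mathbf{i})$ if $i_k\leftrightarrow i_{k+1}$; $0$ if $i_k=i_{k+1}$. $\sigma_j\sigma_k=\sigma_k\sigma_j$ for $|j-k|>1$. $(\sigma_{k+1}\sigma_k\sigma_{k+1}-\sigma_k\sigma_{k+1}\sigma_k)\mathbf{e}(\mathbf{i})$ equals, when $i_k=i_{k+2}$: $\mathbf{e}(\mathbf{i})$ if $i_k\to i_{k+1}$; $-\mathbf{e}(\mathbf{i})$ if $i_k\leftarrow i_{k+1}$; $(2x_{k+1}-x_{k+2}-x_k)\mathbf{e}(\mathbf{i})$ if $i_k\leftrightarrow i_{k+1}$; and $0$ in all other cases. (4) $(\sigma_kx_l-x_{s_k(l)}\sigma_k)\mathbf{e}(\mathbf{i})$ equals $-\mathbf{e}(\mathbf{i})$ if $l=k$, $i_k=i_{k+1}$; $\mathbf{e}(\mathbf{i})$ if $l=k+1$, $i_k=i_{k+1}$; $0$ otherwise. **VV algebra.** $\mathfrak{W}_\nu$ is the $\mathbf{k}$-algebra generated by $x_1,\dots,x_m$, $\sigma_1,\dots,\sigma_{m-1}$, $\pi$, and $\mathbf{e}(\mathbf{i})$, $\mathbf{i}\in{}^\theta I^\nu$, with relations (1)–(4) (now for $\mathbf{i}\in{}^\theta I^\nu$) together with (recall $q\notin I$): (5) $\pi\mathbf{e}(i_1,\dots,i_m)=\mathbf{e}(i_1^{-1},i_2,\dots,i_m)\pi$. (6) $\pi^2\mathbf{e}(\mathbf{i})=\mathbf{e}(\mathbf{i})$.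 (7) $\pi x_1=-x_1\pi$; $\pi x_l=x_l\pi$ for $l>1$. (8) $(\sigma_1\pi)^2\mathbf{e}(\mathbf{i})=(\pi\sigma_1)^2\mathbf{e}(\mathbf{i})$; $\pi\sigma_k=\sigma_k\pi$ for $k\ne1$. **The algebra $\mathbf{R}^+_{\tilde\nu}\otimes_{\mathbf{k}[z]}\tilde A$.** $\tilde A$ is the path algebra over $\mathbf{k}$ (no relations) of the quiver with vertices $a_1,a_2$ and arrows $v_1:a_1\to a_2$, $v_2:a_2\to a_1$. It is a left $\mathbf{k}[z]$-module via $z\cdot a_1=v_2v_1a_1$, $z\cdot a_2=v_1v_2a_2$. On $\mathbf{R}^+_{\tilde\nu}$, $z$ acts as multiplication by the (central) element $\sum_{\mathbf{i}\in I^{\tilde\nu}}(x_{\varphi_{\mathbf{i},1}(p)}+x_{\varphi_{\mathbf{i},2}(p)})\mathbf{e}(\mathbf{i})$, where $\varphi_{\mathbf{i},1}(p)$ and $\varphi_{\mathbf{i},2}(p)$ are the positions of the first and second occurrence of $p$ in $\mathbf{i}$. The tensor product over $\mathbf{k}[z]$ is taken as a tensor product of $\mathbf{k}[z]$-algebras. *)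

(* Defs.v *)
From HB Require Import structures.
From mathcomp Require Import all_boot all_order perm all_algebra finmap.
From mathcomp Require Import boolp classical_sets cardinality monalg.

Set Implicit Arguments.
Unset Strict Implicit.
Unset Printing Implicit Defensive.

Import GRing.Theory.
Local Open Scope ring_scope.
Local Open Scope quotient_scope.

(* An associative unital S-algebra is a ring with a ring morphism from S to
   its centre.  MathComp's algType excludes the zero ring, which a presented
   algebra could be, so it cannot be the type of algebras here.               *)
Record alg (S : comPzRingType) := Alg {
  alg_ring :> pzRingType;
  alg_scalar : {rmorphism S -> alg_ring};
  alg_central : forall s a, alg_scalar s * a = a * alg_scalar s
}.

Arguments alg_scalar {S} A : rename.

Section RestrictScalars.
Variables (S T : comPzRingType) (f : {rmorphism S -> T}) (A : alg T).

Definition alg_restrict : alg S :=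
  @Alg S A (alg_scalar A \o f) (fun s => alg_central (f s)).

End RestrictScalars.

Section RingQuotient.
Variables (R : pzRingType) (rel : R -> R -> Prop).

Inductive rel_ideal : R -> Prop :=
| rel_ideal0 : rel_ideal 0
| rel_ideal_gen a u v b : rel u v -> rel_ideal (a * (u - v) * b)
| rel_idealD x y : rel_ideal x -> rel_ideal y -> rel_ideal (x + y).

Lemma rel_idealMl a x : rel_ideal x -> rel_ideal (a * x).
Proof.
elim=> [|b u v c uv|y z _ iy _ iz]; first by rewrite mulr0; exact: rel_ideal0.
  by rewrite 2!mulrA; exact: rel_ideal_gen.
by rewrite mulrDr; exact: rel_idealD.
Qed.

Lemma rel_idealMr a x : rel_ideal x -> rel_ideal (x * a).
Proof.
elim=> [|b u v c uv|y z _ iy _ iz]; first by rewrite mul0r; exact: rel_ideal0.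
  by rewrite -mulrA; exact: rel_ideal_gen.
by rewrite mulrDl; exact: rel_idealD.
Qed.

Lemma rel_idealN x : rel_ideal x -> rel_ideal (- x).
Proof. by rewrite -mulN1r; exact: rel_idealMl. Qed.

Lemma rel_idealBl x y : rel_ideal (x - y) -> rel_ideal (y - x).
Proof. by move/rel_idealN; rewrite opprB. Qed.

Definition congr_mod x y : bool := `[< rel_ideal (x - y) >].

Lemma congr_mod_refl : reflexive congr_mod.
Proof. by move=> x; apply/asboolP; rewrite subrr; exact: rel_ideal0. Qed.

Lemma congr_mod_sym : symmetric congr_mod.
Proof. by move=> x y; apply/asboolP/asboolP; exact: rel_idealBl. Qed.

Lemma congr_mod_trans : transitive congr_mod.
Proof.
move=> y x z /asboolP xy /asboolP yz; apply/asboolP.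
by rewrite -(subrKA y x (- z)); apply: rel_idealD.
Qed.

Canonical congr_mod_equiv :=
  EquivRel congr_mod congr_mod_refl congr_mod_sym congr_mod_trans.

Definition rquot := {eq_quot congr_mod}.
HB.instance Definition _ := Choice.on rquot.
HB.instance Definition _ := EqQuotient.on rquot.

Definition rqzero : rquot := \pi_rquot 0.
Definition rqone : rquot := \pi_rquot 1.
Definition rqadd (x y : rquot) : rquot := \pi_rquot (repr x + repr y).
Definition rqopp (x : rquot) : rquot := \pi_rquot (- repr x).
Definition rqmul (x y : rquot) : rquot := \pi_rquot (repr x * repr y).

Lemma pi_rqP x y : rel_ideal (x - y) <-> \pi_rquot x = \pi_rquot y.
Proof.
split=> [xy|xy]; first by apply/eqmodP/asboolP.
by apply/asboolP; move/eqmodP: xy.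
Qed.

Lemma repr_rq x : rel_ideal (repr (\pi_rquot x) - x).
Proof. by apply/pi_rqP; rewrite reprK. Qed.

Lemma pi_rqD x y : rqadd (\pi_rquot x) (\pi_rquot y) = \pi_rquot (x + y).
Proof.
apply/pi_rqP; rewrite opprD addrACA.
by apply: rel_idealD; exact: repr_rq.
Qed.

Lemma pi_rqN x : rqopp (\pi_rquot x) = \pi_rquot (- x).
Proof. by apply/pi_rqP; rewrite -opprD; apply: rel_idealN; exact: repr_rq. Qed.

Lemma pi_rqM x y : rqmul (\pi_rquot x) (\pi_rquot y) = \pi_rquot (x * y).
Proof.
apply/pi_rqP; set x' := repr _; set y' := repr _.
have -> : x' * y' - x * y = (x' - x) * y' + x * (y' - y).
  by rewrite mulrBl mulrBr addrA subrK.
apply: rel_idealD; first by apply: rel_idealMr; exact: repr_rq.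
by apply: rel_idealMl; exact: repr_rq.
Qed.

Lemma rqaddA : associative rqadd.
Proof. by move=> x y z; rewrite -[x]reprK -[y]reprK -[z]reprK
  (pi_rqD (repr y) (repr z)) (pi_rqD (repr x) (repr y)) !pi_rqD addrA. Qed.
Lemma rqaddC : commutative rqadd.
Proof. by move=> x y; rewrite -[x]reprK -[y]reprK !pi_rqD addrC. Qed.
Lemma rqadd0 : left_id rqzero rqadd.
Proof. by move=> x; rewrite -[x]reprK pi_rqD add0r. Qed.
Lemma rqaddN : left_inverse rqzero rqopp rqadd.
Proof. by move=> x; rewrite -[x]reprK pi_rqN pi_rqD addNr. Qed.

HB.instance Definition _ :=
  GRing.isZmodule.Build rquot rqaddA rqaddC rqadd0 rqaddN.

Let addE x y : (\pi_rquot x + \pi_rquot y) = \pi_rquot (x + y).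
Proof. exact: pi_rqD. Qed.

Lemma rqmulA : associative rqmul.
Proof. by move=> x y z; rewrite -[x]reprK -[y]reprK -[z]reprK
  (pi_rqM (repr y) (repr z)) (pi_rqM (repr x) (repr y)) !pi_rqM mulrA. Qed.
Lemma rqmul1 : left_id rqone rqmul.
Proof. by move=> x; rewrite -[x]reprK pi_rqM mul1r. Qed.
Lemma rqmulr1 : right_id rqone rqmul.
Proof. by move=> x; rewrite -[x]reprK pi_rqM mulr1. Qed.
Lemma rqmulDl : left_distributive rqmul +%R.
Proof. by move=> x y z; rewrite -[x]reprK -[y]reprK -[z]reprK
  (addE (repr x) (repr y)) !pi_rqM addE mulrDl. Qed.
Lemma rqmulDr : right_distributive rqmul +%R.
Proof. by move=> x y z; rewrite -[x]reprK -[y]reprK -[z]reprK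
  (addE (repr y) (repr z)) !pi_rqM addE mulrDr. Qed.

HB.instance Definition _ :=
  GRing.Zmodule_isPzRing.Build rquot rqmulA rqmul1 rqmulr1 rqmulDl rqmulDr.

Definition rqpi (x : R) : rquot := \pi_rquot x.

Fact rqpi_is_zmod_morphism : zmod_morphism rqpi.
Proof. by move=> x y; rewrite /rqpi -pi_rqD -pi_rqN. Qed.
Fact rqpi_is_monoid_morphism : monoid_morphism rqpi.
Proof. by split=> [|x y] //; rewrite /rqpi -pi_rqM. Qed.

HB.instance Definition _ :=
  GRing.isZmodMorphism.Build R rquot rqpi rqpi_is_zmod_morphism.
HB.instance Definition _ :=
  GRing.isMonoidMorphism.Build R rquot rqpi rqpi_is_monoid_morphism.

End RingQuotient.

Notation free_alg k G := {malg k[{fmonom G}]}.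

Section Presented.
Variables (k : fieldType) (G : choiceType).

Definition fgen (g : G) : free_alg k G := << fmu g >>.

Lemma free_scalarC (c : k) (u : free_alg k G) : c%:MP * u = u * c%:MP.
Proof.
rewrite !malgM_def fgmulUg fgmulgU.
by apply: eq_bigr => m _; rewrite mulrC mul1m mulm1.
Qed.

Lemma free_alg_commute (S : pzRingType) (f : {rmorphism free_alg k G -> S}) z :
  (forall c : k, z * f c%:MP = f c%:MP * z) ->
  (forall g, z * f (fgen g) = f (fgen g) * z) ->
  forall u, z * f u = f u * z.
Proof.
move=> zc zg u; rewrite [u]monalgE raddf_sum mulr_sumr mulr_suml /=.
apply: eq_bigr => m _.
have -> : << u@_m *g m >> = (u@_m)%:MP * << m >> :> free_alg k G.
  by rewrite malgM_def fgmulUU mulr1 mul1m.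
rewrite rmorphM mulrA zc -!mulrA; congr (_ * _).
case: m => s; elim: s => [|g s IHs].
  by rewrite -fmoneE; exact: (zc 1).
have -> : << FMonom (g :: s) >> = fgen g * << FMonom s >> :> free_alg k G.
  by rewrite malgM_def fgmulUU mulr1 /mmul /= fmuE fmmulE.
by rewrite rmorphM mulrA zg -!mulrA IHs.
Qed.

Variable rel : free_alg k G -> free_alg k G -> Prop.

Definition presented_scalar : {rmorphism k -> rquot rel} :=
  rqpi rel \o @malgC {fmonom G} k.

Lemma rqpi_surj (a : rquot rel) : exists u, a = rqpi rel u.
Proof. by exists (repr a); rewrite /rqpi reprK. Qed.

Fact presented_scalar_central c a :
  presented_scalar c * a = a * presented_scalar c.
Proof.
by have [u ->] := rqpi_surj a; rewrite -!(rmorphM (rqpi rel)) free_scalarC.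
Qed.

Definition presented : alg k := Alg presented_scalar_central.

Definition pgen (g : G) : presented := rqpi rel (fgen g).

Lemma presented_rel u v : rel u v -> rqpi rel u = rqpi rel v.
Proof.
move=> uv; apply/pi_rqP; rewrite -[u - v]mul1r -[1 * _]mulr1.
exact: rel_ideal_gen.
Qed.

Lemma presented_central (z : presented) :
  (forall g, z * pgen g = pgen g * z) -> forall a, z * a = a * z.
Proof.
move=> zg a; have [u ->] := rqpi_surj a.
apply: (free_alg_commute _ zg) => c.
exact/esym/(presented_scalar_central c).
Qed.

End Presented.

Record quiver := Quiver {
  vert : finType;
  arr : choiceType;
  src : arr -> vert;
  tgt : arr -> vert
}.

Section PathAlgebra.
Variables (Q : quiver) (k : fieldType).

Fixpoint is_walk (v : vert Q) (s : seq (arr Q)) : bool :=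
  if s is a :: s' then (src a == v) && is_walk (tgt a) s' else true.

(* A path is its starting vertex together with its arrows in the order in
   which they are travelled. *)
Record qpath := QPath {
  qwalk : vert Q * seq (arr Q);
  _ : is_walk qwalk.1 qwalk.2
}.
HB.instance Definition _ := [isSub for qwalk].
HB.instance Definition _ := [Choice of qpath by <:].

Definition qsrc (a : qpath) : vert Q := (val a).1.
Definition qarrows (a : qpath) : seq (arr Q) := (val a).2.
Definition qtgt (a : qpath) : vert Q := last (qsrc a) (map (@tgt Q) (qarrows a)).
Definition qtriv (v : vert Q) : qpath := @QPath (v, [::]) isT.

(* Paths compose like functions: the second argument is travelled first. *)
Definition qcomp (a b : qpath) : option qpath :=
  if qtgt b == qsrc a then insub (qsrc b, qarrows b ++ qarrows a) else None.

Lemma is_walk_cat v s t :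
  is_walk v (s ++ t) = is_walk v s && is_walk (last v (map (@tgt Q) s)) t.
Proof. by elim: s v => [|a s IHs] v //=; rewrite IHs andbA. Qed.

Lemma qcompP a b : qtgt b = qsrc a ->
  exists2 c, qcomp a b = Some c & val c = (qsrc b, qarrows b ++ qarrows a).
Proof.
move=> ba; rewrite /qcomp ba eqxx; case: insubP => [c _ <-|]; first by exists c.
rewrite /= is_walk_cat -[last _ _]/(qtgt b) ba.
by rewrite (valP a) (valP b).
Qed.

Lemma qcompN a b : qtgt b <> qsrc a -> qcomp a b = None.
Proof. by move/eqP/negbTE; rewrite /qcomp => ->. Qed.

Lemma qtgtE a : qtgt a = last (qsrc a) (map (@tgt Q) (qarrows a)).
Proof. by []. Qed.

Lemma qcompA a b c :
  obind (qcomp a) (qcomp b c) = obind (fun d => qcomp d c) (qcomp a b).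
Proof.
have [cb|cb] := eqVneq (qtgt c) (qsrc b); last first.
  rewrite (qcompN (elimN eqP cb)) /=.
  have [ba|ba] := eqVneq (qtgt b) (qsrc a); last by rewrite (qcompN (elimN eqP ba)).
  have [d -> vd] := qcompP ba; rewrite /= qcompN // /qsrc vd /=.
  exact/eqP.
have [d cbE vd] := qcompP cb; rewrite cbE /=.
have td : qtgt d = qtgt b.
  by rewrite qtgtE /qsrc /qarrows vd /= map_cat last_cat -qtgtE cb.
have [ba|ba] := eqVneq (qtgt b) (qsrc a); last first.
  by rewrite (qcompN (elimN eqP ba)) qcompN // td; exact/eqP.
have [f -> vf] := qcompP ba; rewrite /=.
have da : qtgt d = qsrc a by rewrite td.
have cf : qtgt c = qsrc f by rewrite cb [RHS]/qsrc vf.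
have [g -> vg] := qcompP da; have [h -> vh] := qcompP cf.
congr Some; apply: val_inj; rewrite vg vh.
by rewrite /qsrc /qarrows vd vf /= catA.
Qed.

Lemma qcomp_trivl v a : qcomp (qtriv v) a = if qtgt a == v then Some a else None.
Proof.
have [av|av] := eqVneq (qtgt a) v; last by rewrite qcompN //; exact/eqP.
have [c -> vc] := @qcompP (qtriv v) a av; congr Some; apply: val_inj.
by rewrite vc cats0 /qsrc /qarrows; case: (val a).
Qed.

Lemma qcomp_trivr v a : qcomp a (qtriv v) = if qsrc a == v then Some a else None.
Proof.
have [av|av] := eqVneq (qsrc a) v; last first.
  by rewrite qcompN // => va; case/eqP: av; rewrite -va.
have [c -> vc] := @qcompP a (qtriv v) (esym av); congr Some; apply: val_inj.
by rewrite vc -av; case: a {av c vc} => -[].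
Qed.

Local Notation M := {malg k[qpath]}.

Definition pamulU (c : k) (a b : qpath) : M :=
  if qcomp a b is Some d then << c *g d >> else 0.

Definition pamul (f g : M) : M :=
  \sum_(a <- msupp f) \sum_(b <- msupp g) pamulU (f@_a * g@_b) a b.

Definition pascalar (c : k) : M := \sum_(v : vert Q) << c *g qtriv v >>.

Lemma pamulU0 a b : pamulU 0 a b = 0.
Proof. by rewrite /pamulU; case: qcomp => // d; rewrite monalgU0. Qed.

Lemma pamulUD c d a b : pamulU (c + d) a b = pamulU c a b + pamulU d a b.
Proof. by rewrite /pamulU; case: qcomp => [e|]; rewrite ?monalgUD ?addr0. Qed.

Lemma pamulw (d1 d2 : {fset qpath}) (f g : M) :
  (msupp f `<=` d1)%fset -> (msupp g `<=` d2)%fset ->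
  pamul f g = \sum_(a <- d1) \sum_(b <- d2) pamulU (f@_a * g@_b) a b.
Proof.
move=> le_d1 le_d2; rewrite /pamul (big_fset_incl _ le_d1) /=.
  apply/eq_bigr=> a _; apply/big_fset_incl => // b _ /mcoeff_outdom ->.
  by rewrite mulr0 pamulU0.
move=> a _ /mcoeff_outdom fa.
by rewrite big1 => // b _; rewrite fa mul0r pamulU0.
Qed.

Lemma pamulDl : left_distributive pamul +%R.
Proof.
move=> f f' g; pose d := (msupp f `|` msupp f')%fset.
rewrite (@pamulw d (msupp g)) ?msuppD_le // (@pamulw d (msupp g) f) ?fsubsetUl //.
rewrite (@pamulw d (msupp g) f') ?fsubsetUr // -big_split /=.
apply: eq_bigr => a _; rewrite -big_split /=; apply: eq_bigr => b _.
by rewrite mcoeffD mulrDl pamulUD.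
Qed.

Lemma pamulDr : right_distributive pamul +%R.
Proof.
move=> f g g'; pose d := (msupp g `|` msupp g')%fset.
rewrite (@pamulw (msupp f) d) ?msuppD_le // (@pamulw (msupp f) d f g) ?fsubsetUl //.
rewrite (@pamulw (msupp f) d f g') ?fsubsetUr // -big_split /=.
apply: eq_bigr => a _; rewrite -big_split /=; apply: eq_bigr => b _.
by rewrite mcoeffD mulrDr pamulUD.
Qed.

Lemma pamul0l f : pamul 0 f = 0.
Proof. by apply: (addrI (pamul 0 f)); rewrite -pamulDl !addr0. Qed.

Lemma pamul0r f : pamul f 0 = 0.
Proof. by apply: (addrI (pamul f 0)); rewrite -pamulDr !addr0. Qed.

Lemma pamul_suml I (r : seq I) (F : I -> M) g :
  pamul (\sum_(i <- r) F i) g = \sum_(i <- r) pamul (F i) g.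
Proof.
exact: (big_morph (pamul^~ g) (fun _ _ => pamulDl _ _ _) (pamul0l g)).
Qed.

Lemma pamul_sumr I (r : seq I) (F : I -> M) g :
  pamul g (\sum_(i <- r) F i) = \sum_(i <- r) pamul g (F i).
Proof.
exact: (big_morph (pamul g) (fun _ _ => pamulDr _ _ _) (pamul0r g)).
Qed.

Lemma pamulUU c d a b : pamul << c *g a >> << d *g b >> = pamulU (c * d) a b.
Proof. by rewrite (pamulw msuppU_le msuppU_le) !big_seq_fset1 !mcoeffUU. Qed.

Lemma pamulA : associative pamul.
Proof.
move=> f g h; rewrite [f]monalgE [g]monalgE [h]monalgE.
rewrite !pamul_suml; apply: eq_bigr => a _.
rewrite !(@pamul_sumr _ _ _ << f@_a *g a >>) [RHS]pamul_suml; apply: eq_bigr => b _.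
rewrite !pamul_sumr; apply: eq_bigr => c _.
rewrite !pamulUU /pamulU; have := qcompA a b c.
case: (qcomp b c) (qcomp a b) => [d|] [e|] /=; rewrite ?pamulUU ?pamul0l ?pamul0r.
- by rewrite /pamulU mulrA => ->.
- by rewrite /pamulU => ->.
- by rewrite /pamulU => <-.
- by [].
Qed.

Lemma pascalarl c g : pamul (pascalar c) g = c *: g.
Proof.
rewrite [g]monalgE /pascalar pamul_sumr scaler_sumr; apply: eq_bigr => a _.
rewrite pamul_suml (bigD1 (qtgt a)) //= big1 => [|v va].
  rewrite addr0 pamulUU /pamulU qcomp_trivl eqxx.
  by apply/malgP => b; rewrite mcoeffZ !mcoeffU mulrnAr.
by rewrite pamulUU /pamulU qcomp_trivl eq_sym (negbTE va).
Qed.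

Lemma pascalarr c g : pamul g (pascalar c) = c *: g.
Proof.
rewrite [g]monalgE /pascalar pamul_suml scaler_sumr; apply: eq_bigr => a _.
rewrite pamul_sumr (bigD1 (qsrc a)) //= big1 => [|v va].
  rewrite addr0 pamulUU /pamulU qcomp_trivr eqxx.
  by apply/malgP => b; rewrite mcoeffZ !mcoeffU mulrnAr mulrC.
by rewrite pamulUU /pamulU qcomp_trivr eq_sym (negbTE va).
Qed.

Definition path_ring := M.
HB.instance Definition _ := GRing.Zmodule.on path_ring.

Lemma pamul1l : left_id (pascalar 1) pamul.
Proof. by move=> g; rewrite pascalarl scale1r. Qed.
Lemma pamul1r : right_id (pascalar 1) pamul.
Proof. by move=> g; rewrite pascalarr scale1r. Qed.

HB.instance Definition _ := GRing.Zmodule_isPzRing.Build path_ring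
  pamulA pamul1l pamul1r pamulDl pamulDr.

Definition path_scalar (c : k) : path_ring := pascalar c.

Fact path_scalar_is_zmod_morphism : zmod_morphism path_scalar.
Proof.
move=> c d; rewrite /path_scalar /pascalar -sumrB.
by apply: eq_bigr => v _; rewrite monalgUB.
Qed.
Fact path_scalar_is_monoid_morphism : monoid_morphism path_scalar.
Proof.
split=> // c d; rewrite -[RHS]/(pamul (pascalar c) (pascalar d)) pascalarl.
rewrite /path_scalar /pascalar scaler_sumr; apply: eq_bigr => v _.
by apply/malgP => b; rewrite mcoeffZ !mcoeffU mulrnAr.
Qed.

HB.instance Definition _ := GRing.isZmodMorphism.Build k path_ring
  path_scalar path_scalar_is_zmod_morphism.
HB.instance Definition _ := GRing.isMonoidMorphism.Build k path_ring
  path_scalar path_scalar_is_monoid_morphism.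

Fact path_scalar_central c (a : path_ring) :
  path_scalar c * a = a * path_scalar c.
Proof.
rewrite -[LHS]/(pamul (pascalar c) a) -[RHS]/(pamul a (pascalar c)).
by rewrite pascalarl pascalarr.
Qed.

Definition path_alg : alg k := Alg path_scalar_central.

Definition path_elt (a : qpath) : path_alg := (<< a >> : M).

Lemma path_elt_commute (z : path_alg) :
  (forall a, z * path_elt a = path_elt a * z) -> forall u, z * u = u * z.
Proof.
move=> za u; rewrite -[LHS]/(pamul z u) -[RHS]/(pamul u z).
rewrite [u]monalgE pamul_suml pamul_sumr; apply: eq_bigr => a _.
have -> : << u@_a *g a >> = pamul (pascalar u@_a) << a >>.
  rewrite pascalarl; apply/malgP => b; rewrite mcoeffZ !mcoeffU.
  by rewrite mulrnAr mulr1.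
rewrite -pamulA -[pamul << a >> z]/(path_elt a * z) -za.
rewrite [LHS]pamulA [in RHS]/path_elt -[z * _]/(pamul z << a >>) pamulA.
by congr pamul; rewrite pascalarl pascalarr.
Qed.

Lemma path_eltM a b :
  path_elt a * path_elt b = if qcomp a b is Some c then path_elt c else 0.
Proof. by rewrite -[LHS]/(pamul << a >> << b >>) pamulUU mulr1. Qed.

End PathAlgebra.

Section PolyAction.
Variables (k : fieldType) (A : alg k) (z : A).
Hypothesis zC : forall a, z * a = a * z.

Definition ev_at (f : {poly k}) : A := \sum_(i < size f) alg_scalar A f`_i * z ^+ i.

Lemma ev_atw n (f : {poly k}) : (size f <= n)%N ->
  ev_at f = \sum_(i < n) alg_scalar A f`_i * z ^+ i.
Proof.
move=> le_fn; rewrite /ev_at (big_ord_widen n (fun i => alg_scalar A f`_i * z ^+ i)) //.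
rewrite big_mkcond; apply: eq_bigr => i _; case: ltnP => // fi.
by rewrite nth_default // rmorph0 mul0r.
Qed.

Fact ev_at_is_zmod_morphism : zmod_morphism ev_at.
Proof.
move=> f g; pose n := maxn (size f) (size g).
have le_fn : (size f <= n)%N := leq_maxl _ _.
have le_gn : (size g <= n)%N := leq_maxr _ _.
have le_n : (size (f - g)%R <= n)%N.
  by rewrite (leq_trans (size_polyD f (- g))) // size_polyN.
rewrite (ev_atw le_n) (ev_atw le_fn) (ev_atw le_gn) -sumrB.
by apply: eq_bigr => i _; rewrite coefB rmorphB mulrBl.
Qed.

Lemma ev_atC c : ev_at c%:P = alg_scalar A c.
Proof.
by rewrite (@ev_atw 1) ?size_polyC_leq1 // big_ord1 coefC mulr1.
Qed.

Lemma ev_atMX f : ev_at (f * 'X) = ev_at f * z.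
Proof.
rewrite (@ev_atw (size f).+1); last first.
  by rewrite (leq_trans (size_polyMleq _ _)) // size_polyX addn2.
rewrite big_ord_recl coefMX rmorph0 mul0r add0r /ev_at mulr_suml.
by apply: eq_bigr => i _; rewrite coefMX /= exprSr mulrA.
Qed.

Let ev_atD f g : ev_at (f + g) = ev_at f + ev_at g.
Proof.
have evB := ev_at_is_zmod_morphism; have ev0 : ev_at 0 = 0.
  by rewrite -(subrr 0) evB subrr.
by rewrite -[g in LHS]opprK evB -[- g]add0r evB ev0 sub0r opprK.
Qed.

Lemma ev_atCM c f : ev_at (c%:P * f) = alg_scalar A c * ev_at f.
Proof.
rewrite (@ev_atw (size f)); last first.
  by rewrite mul_polyC (leq_trans (size_scale_leq _ _)).
rewrite /ev_at mulr_sumr; apply: eq_bigr => i _.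
by rewrite coefCM rmorphM mulrA.
Qed.

Fact ev_at_is_monoid_morphism : monoid_morphism ev_at.
Proof.
split=> [|f g]; first by rewrite ev_atC rmorph1.
elim/poly_ind: f => [|f c IHf].
  by rewrite mul0r -polyC0 ev_atC rmorph0 mul0r.
rewrite mulrDl !ev_atD ev_atCM mulrDl ev_atC; congr (_ + _).
by rewrite -mulrA ['X * g]mulrC mulrA !ev_atMX IHf -!mulrA zC.
Qed.

Definition ev_at_rmorphism : {rmorphism {poly k} -> A} :=
  HB.pack_for {rmorphism {poly k} -> A} ev_at
    (GRing.isZmodMorphism.Build {poly k} A ev_at ev_at_is_zmod_morphism)
    (GRing.isMonoidMorphism.Build {poly k} A ev_at ev_at_is_monoid_morphism).

Fact ev_at_central f a : ev_at_rmorphism f * a = a * ev_at_rmorphism f.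
Proof.
rewrite /= /ev_at mulr_suml mulr_sumr; apply: eq_bigr => i _.
have zi : z ^+ i * a = a * z ^+ i.
  elim: (i : nat) => [|j IHj]; first by rewrite mul1r mulr1.
  by rewrite exprS -mulrA IHj mulrA zC mulrA.
by rewrite -mulrA zi mulrA alg_central mulrA.
Qed.

Definition poly_alg : alg {poly k} := Alg ev_at_central.

End PolyAction.

Section Tensor.
Variables (S : comPzRingType) (A B : alg S).

(* The sequence [:: (a1, b1); ...; (an, bn)] stands for the formal sum
   a1 (x) b1 + ... + an (x) bn. *)
Local Notation word := (seq (A * B)).

Inductive teq : word -> word -> Prop :=
| teq_refl u : teq u u
| teq_sym u v : teq u v -> teq v u
| teq_trans u v w : teq u v -> teq v w -> teq u w
| teq_cat u u' v v' : teq u u' -> teq v v' -> teq (u ++ v) (u' ++ v')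
| teq_catC u v : teq (u ++ v) (v ++ u)
| teq_0l b : teq [:: (0, b)] [::]
| teq_Dl a a' b : teq [:: (a + a', b)] [:: (a, b); (a', b)]
| teq_Dr a b b' : teq [:: (a, b + b')] [:: (a, b); (a, b')]
| teq_bal s a b : teq [:: (alg_scalar A s * a, b)] [:: (a, alg_scalar B s * b)].

Definition wopp (u : word) : word := [seq (- x.1, x.2) | x <- u].
Definition wmul (u v : word) : word := [seq (x.1 * y.1, x.2 * y.2) | x <- u, y <- v].

Definition tcongr u v : bool := `[< teq u v >].

Lemma tcongr_refl : reflexive tcongr.
Proof. by move=> u; apply/asboolP; exact: teq_refl. Qed.
Lemma tcongr_sym : symmetric tcongr.
Proof. by move=> u v; apply/asboolP/asboolP; exact: teq_sym. Qed.
Lemma tcongr_trans : transitive tcongr.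
Proof.
move=> v u w /asboolP uv /asboolP vw; apply/asboolP.
exact: teq_trans uv vw.
Qed.

Canonical tcongr_equiv := EquivRel tcongr tcongr_refl tcongr_sym tcongr_trans.

(* A quotient of the free commutative monoid on A x B suffices for A (x)_S B:
   -(a (x) b) is (-a) (x) b. *)
Definition tensor := {eq_quot tcongr}.
HB.instance Definition _ := Choice.on tensor.
HB.instance Definition _ := EqQuotient.on tensor.

Lemma pi_tP u v : teq u v <-> \pi_tensor u = \pi_tensor v.
Proof.
split=> [uv|uv]; first by apply/eqmodP/asboolP.
by apply/asboolP; move/eqmodP: uv.
Qed.

Lemma repr_t u : teq (repr (\pi_tensor u)) u.
Proof. by apply/pi_tP; rewrite reprK. Qed.

Lemma teq_0r a : teq [:: (a, 0)] [::].
Proof.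
have := teq_bal 0 a 0; rewrite !rmorph0 !mul0r => h.
by apply: teq_trans (teq_sym h) _; exact: teq_0l.
Qed.

Lemma teq_cons x u v : teq u v -> teq (x :: u) (x :: v).
Proof. by move=> uv; apply: (@teq_cat [:: x] [:: x]) => //; exact: teq_refl. Qed.

Lemma teq_catl u v v' : teq v v' -> teq (u ++ v) (u ++ v').
Proof. by move=> vv'; apply: teq_cat => //; exact: teq_refl. Qed.

Lemma teq_catr u u' v : teq u u' -> teq (u ++ v) (u' ++ v).
Proof. by move=> uu'; apply: teq_cat => //; exact: teq_refl. Qed.

Lemma teq_catACA u v w t : teq ((u ++ v) ++ (w ++ t)) ((u ++ w) ++ (v ++ t)).
Proof.
rewrite -!catA; apply: teq_catl; rewrite !catA; apply: teq_catr.
exact: teq_catC.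
Qed.

Lemma wmul_cat u u' v : wmul (u ++ u') v = wmul u v ++ wmul u' v.
Proof. by rewrite /wmul map_cat flatten_cat. Qed.

Lemma wmul_cons x u v :
  wmul (x :: u) v = [seq (x.1 * y.1, x.2 * y.2) | y <- v] ++ wmul u v.
Proof. by []. Qed.

Lemma wmul1 x v : wmul [:: x] v = [seq (x.1 * y.1, x.2 * y.2) | y <- v].
Proof. by rewrite wmul_cons cats0. Qed.

Lemma wmul0 v : wmul [::] v = [::].
Proof. by []. Qed.

Lemma wmulr0 u : wmul u [::] = [::].
Proof. by elim: u. Qed.

Lemma teq_mulDr u v v' : teq (wmul u (v ++ v')) (wmul u v ++ wmul u v').
Proof.
elim: u => [|x u IHu]; first exact: teq_refl.
rewrite !wmul_cons map_cat; apply: teq_trans (teq_catACA _ _ _ _).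
exact: teq_catl.
Qed.

Lemma teq_mull u v w : teq v w -> teq (wmul u v) (wmul u w).
Proof.
move=> vw; elim: u => [|x u IHu]; first exact: teq_refl.
rewrite !wmul_cons; apply: teq_cat => // {u IHu}.
elim: vw => {v w} /=.
- by move=> u; exact: teq_refl.
- by move=> u v _; exact: teq_sym.
- by move=> u v w _ uv _; exact: teq_trans.
- by move=> u u' v v' _ uu' _ vv'; rewrite !map_cat; exact: teq_cat.
- by move=> u v; rewrite !map_cat; exact: teq_catC.
- by move=> b; rewrite mulr0; exact: teq_0l.
- by move=> a a' b; rewrite mulrDr; exact: teq_Dl.
- by move=> a b b'; rewrite mulrDr; exact: teq_Dr.
- move=> s a b; rewrite (mulrA x.1) -alg_central -(mulrA _ x.1).
  rewrite (mulrA x.2) -alg_central -(mulrA _ x.2).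
  exact: teq_bal.
Qed.

Lemma teq_mulr u v w : teq u v -> teq (wmul u w) (wmul v w).
Proof.
elim=> {u v}.
- by move=> u; exact: teq_refl.
- by move=> u v _; exact: teq_sym.
- by move=> u v t _ uv _; exact: teq_trans.
- by move=> u u' v v' _ uu' _ vv'; rewrite !wmul_cat; exact: teq_cat.
- by move=> u v; rewrite !wmul_cat; exact: teq_catC.
- move=> b; rewrite wmul1; elim: w => [|y w IHw] /=; first exact: teq_refl.
  rewrite mul0r; apply: (@teq_cat [:: _] [::]) => //; exact: teq_0l.
- move=> a a' b; rewrite !wmul_cons !wmul0 !cats0.
  elim: w => [|y w IHw] /=; first exact: teq_refl.
  rewrite mulrDl; apply: teq_trans (teq_cat (teq_Dl _ _ _) IHw) _.
  exact: (teq_catACA [:: _] [:: _]).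
- move=> a b b'; rewrite !wmul_cons !wmul0 !cats0.
  elim: w => [|y w IHw] /=; first exact: teq_refl.
  rewrite mulrDl; apply: teq_trans (teq_cat (teq_Dr _ _ _) IHw) _.
  exact: (teq_catACA [:: _] [:: _]).
- move=> s a b; rewrite !wmul1; elim: w => [|y w IHw] /=; first exact: teq_refl.
  rewrite -!mulrA; apply: (@teq_cat [:: _] [:: _]) => //; exact: teq_bal.
Qed.

Lemma teq_opp u v : teq u v -> teq (wopp u) (wopp v).
Proof.
have woppE w : wopp w = wmul [:: (-1, 1)] w.
  by rewrite wmul1; apply: eq_map => x; rewrite mulN1r mul1r.
by move=> uv; rewrite !woppE; exact: teq_mull.
Qed.

Lemma teq_addN u : teq (wopp u ++ u) [::].
Proof.
elim: u => [|[a b] u IHu] /=; first exact: teq_refl.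
apply: teq_trans (teq_catACA [:: _] (wopp u) [:: _] u) _.
apply: (@teq_cat [:: _; _] [::]) => //.
apply: teq_trans (teq_sym (teq_Dl _ _ _)) _.
by rewrite addNr; exact: teq_0l.
Qed.

Definition tzero : tensor := \pi_tensor [::].
Definition tone : tensor := \pi_tensor [:: (1, 1)].
Definition tadd (x y : tensor) : tensor := \pi_tensor (repr x ++ repr y).
Definition topp (x : tensor) : tensor := \pi_tensor (wopp (repr x)).
Definition tmul (x y : tensor) : tensor := \pi_tensor (wmul (repr x) (repr y)).

Lemma pi_tD u v : tadd (\pi_tensor u) (\pi_tensor v) = \pi_tensor (u ++ v).
Proof. by apply/pi_tP/teq_cat; exact: repr_t. Qed.
Lemma pi_tN u : topp (\pi_tensor u) = \pi_tensor (wopp u).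
Proof. by apply/pi_tP/teq_opp; exact: repr_t. Qed.
Lemma pi_tM u v : tmul (\pi_tensor u) (\pi_tensor v) = \pi_tensor (wmul u v).
Proof.
apply/pi_tP; apply: teq_trans (teq_mull _ (repr_t v)) _.
exact/teq_mulr/repr_t.
Qed.

Lemma taddA : associative tadd.
Proof.
move=> x y z; rewrite -[x]reprK -[y]reprK -[z]reprK.
by rewrite (pi_tD (repr y) (repr z)) (pi_tD (repr x) (repr y)) !pi_tD catA.
Qed.
Lemma taddC : commutative tadd.
Proof.
move=> x y; rewrite -[x]reprK -[y]reprK !pi_tD.
exact/pi_tP/teq_catC.
Qed.
Lemma tadd0 : left_id tzero tadd.
Proof. by move=> x; rewrite -[x]reprK pi_tD. Qed.
Lemma taddN : left_inverse tzero topp tadd.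
Proof.
move=> x; rewrite -[x]reprK pi_tN pi_tD.
exact/pi_tP/teq_addN.
Qed.

HB.instance Definition _ := GRing.isZmodule.Build tensor taddA taddC tadd0 taddN.

Let addE u v : \pi_tensor u + \pi_tensor v = \pi_tensor (u ++ v).
Proof. exact: pi_tD. Qed.

Lemma wmulA u v w : wmul u (wmul v w) = wmul (wmul u v) w.
Proof.
elim: u => //= x u IHu; rewrite !wmul_cons wmul_cat IHu; congr (_ ++ _).
elim: v {IHu} => //= y v IHv; rewrite !wmul_cons map_cat IHv; congr (_ ++ _).
by rewrite -map_comp; apply: eq_map => t /=; rewrite !mulrA.
Qed.

Lemma tmulA : associative tmul.
Proof.
move=> x y z; rewrite -[x]reprK -[y]reprK -[z]reprK.
by rewrite (pi_tM (repr y) (repr z)) (pi_tM (repr x) (repr y)) !pi_tM wmulA.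
Qed.
Lemma tmul1 : left_id tone tmul.
Proof.
move=> x; rewrite -[x]reprK pi_tM wmul1; congr (\pi_tensor _).
by rewrite -[RHS]map_id; apply: eq_map => -[a b]; rewrite !mul1r.
Qed.
Lemma tmulr1 : right_id tone tmul.
Proof.
move=> x; rewrite -[x]reprK pi_tM; congr (\pi_tensor _).
by elim: (repr x) => //= -[a b] u IHu; rewrite wmul_cons IHu /= !mulr1.
Qed.
Lemma tmulDl : left_distributive tmul +%R.
Proof.
move=> x y z; rewrite -[x]reprK -[y]reprK -[z]reprK.
by rewrite (addE (repr x) (repr y)) !pi_tM addE wmul_cat.
Qed.
Lemma tmulDr : right_distributive tmul +%R.
Proof.
move=> x y z; rewrite -[x]reprK -[y]reprK -[z]reprK.
rewrite (addE (repr y) (repr z)) !pi_tM addE.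
exact/pi_tP/teq_mulDr.
Qed.

HB.instance Definition _ :=
  GRing.Zmodule_isPzRing.Build tensor tmulA tmul1 tmulr1 tmulDl tmulDr.

Definition tens (a : A) (b : B) : tensor := \pi_tensor [:: (a, b)].

Lemma tensM a b a' b' : tens a b * tens a' b' = tens (a * a') (b * b').
Proof. exact: pi_tM. Qed.
Lemma tensDl a a' b : tens (a + a') b = tens a b + tens a' b.
Proof. by rewrite [RHS]pi_tD; exact/pi_tP/teq_Dl. Qed.
Lemma tensDr a b b' : tens a (b + b') = tens a b + tens a b'.
Proof. by rewrite [RHS]pi_tD; exact/pi_tP/teq_Dr. Qed.
Lemma tens_bal s a b : tens (alg_scalar A s * a) b = tens a (alg_scalar B s * b).
Proof. exact/pi_tP/teq_bal. Qed.

Lemma tensE (x : tensor) : exists u : word, x = \sum_(t <- u) tens t.1 t.2.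
Proof.
exists (repr x); rewrite -[LHS]reprK; elim: (repr x) => [|[a b] u IHu].
  by rewrite big_nil.
by rewrite big_cons -IHu /tens addE.
Qed.

Definition tens_scalar (s : S) : tensor := tens (alg_scalar A s) 1.

Fact tens_scalar_is_zmod_morphism : zmod_morphism tens_scalar.
Proof.
move=> s t; apply: (addIr (tens_scalar t)).
by rewrite subrK /tens_scalar -tensDl -rmorphD subrK.
Qed.
Fact tens_scalar_is_monoid_morphism : monoid_morphism tens_scalar.
Proof.
by split=> [|s t]; rewrite /tens_scalar ?rmorph1 // tensM mulr1 rmorphM.
Qed.

HB.instance Definition _ := GRing.isZmodMorphism.Build S tensor
  tens_scalar tens_scalar_is_zmod_morphism.
HB.instance Definition _ := GRing.isMonoidMorphism.Build S tensor
  tens_scalar tens_scalar_is_monoid_morphism.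

Fact tens_scalar_central s x : tens_scalar s * x = x * tens_scalar s.
Proof.
have [u ->] := tensE x; rewrite mulr_suml mulr_sumr; apply: eq_bigr => t _.
by rewrite !tensM mul1r mulr1 alg_central.
Qed.

Definition tensor_alg : alg S := Alg tens_scalar_central.

End Tensor.

Section Morita.
Variable k : fieldType.

(* Functors between the categories of left modules; fmap_linear is
   k-linearity on Hom sets, in pointwise form because {linear U -> V} has no
   module structure over a noncommutative ring. *)
Record mod_functor (A B : alg k) := ModFunctor {
  fobj :> lmodType A -> lmodType B;
  fmap : forall U V : lmodType A, {linear U -> V} -> {linear fobj U -> fobj V};
  fmap_id : forall U : lmodType A, fmap (idfun : {linear U -> U}) =1 id;
  fmap_comp : forall (U V W : lmodType A)
      (g : {linear V -> W}) (f : {linear U -> V}),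
    fmap (g \o f : {linear U -> W}) =1 fmap g \o fmap f;
  fmap_linear : forall (U V : lmodType A) (c : k) (f g h : {linear U -> V}),
    (forall u, h u = alg_scalar A c *: f u + g u) ->
    forall y, fmap h y = alg_scalar B c *: fmap f y + fmap g y
}.

Arguments fmap {A B} F {U V} f : rename.

(* eta is a natural isomorphism from the identity functor to G \o F. *)
Definition left_quasi_inverse (A B : alg k)
    (F : mod_functor A B) (G : mod_functor B A) : Prop :=
  exists eta : forall U : lmodType A, {linear U -> G (F U)},
    (forall U, bijective (eta U)) /\
    (forall (U V : lmodType A) (f : {linear U -> V}),
       eta V \o f =1 fmap G (fmap F f) \o eta U).

Definition morita_equivalent (A B : alg k) : Prop :=
  exists (F : mod_functor A B) (G : mod_functor B A),
    left_quasi_inverse F G /\ left_quasi_inverse G F.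

End Morita.

Section CyclicQuiver.
Variable k : fieldType.

(* The vertices a1, a2 are false, true; the arrow v1 : a1 -> a2 is false and
   the arrow v2 : a2 -> a1 is true. *)
Definition cyc2 : quiver := @Quiver bool bool id negb.

Definition cyc2_arrow (b : bool) : qpath cyc2 :=
  @QPath cyc2 (b, [:: b]) (introT andP (conj (eqxx b) isT)).

Definition Atilde : alg k := path_alg cyc2 k.

Definition At_v1 : Atilde := path_elt k (cyc2_arrow false).
Definition At_v2 : Atilde := path_elt k (cyc2_arrow true).

(* z . a1 = v2 v1 a1 and z . a2 = v1 v2 a2: left multiplication by this sum. *)
Definition At_z : Atilde := At_v2 * At_v1 + At_v1 * At_v2.

Lemma is_walk_cyc2 (v : bool) s :
  @is_walk cyc2 v s -> s = traject negb v (size s).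
Proof. by elim: s v => [|a s IHs] v //= /andP[/eqP-> /IHs <-]. Qed.

Lemma qpath_cyc2_inj (a b : qpath cyc2) :
  qsrc a = qsrc b -> size (qarrows a) = size (qarrows b) -> a = b.
Proof.
case: a b => [[u s] /= us] [[v t] /= vt]; rewrite /qsrc /qarrows /= => uv st.
apply: val_inj => /=; rewrite (is_walk_cyc2 us) (is_walk_cyc2 vt) st.
by congr (_, _); rewrite // uv.
Qed.

Fact cyc2_loop_subproof (b : bool) : @is_walk cyc2 b [:: b; ~~ b].
Proof. by case: b. Qed.
Definition cyc2_loop (b : bool) : qpath cyc2 :=
  @QPath cyc2 (b, [:: b; ~~ b]) (cyc2_loop_subproof b).

Lemma At_zE : At_z = path_elt k (cyc2_loop false) + path_elt k (cyc2_loop true).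
Proof.
have loopE b : path_elt k (cyc2_arrow (~~ b)) * path_elt k (cyc2_arrow b) =
               path_elt k (cyc2_loop b).
  have [c + vc] : exists2 c, qcomp (cyc2_arrow (~~ b)) (cyc2_arrow b) = Some c
      & val c = (b, [:: b; ~~ b]) by exact: qcompP.
  rewrite path_eltM => ->; congr (path_elt k _); exact: val_inj.
by congr (_ + _); [exact: (loopE false) | exact: (loopE true)].
Qed.

Fact cyc2_extend_subproof (a : qpath cyc2) :
  @is_walk cyc2 (qsrc a) (qarrows a ++ [:: qtgt a; ~~ qtgt a]).
Proof. by rewrite is_walk_cat (valP a) cyc2_loop_subproof. Qed.
Definition cyc2_extend (a : qpath cyc2) : qpath cyc2 :=
  @QPath cyc2 (qsrc a, _) (cyc2_extend_subproof a).

Lemma cyc2_loopl b a : path_elt k (cyc2_loop b) * path_elt k a =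
  if b == qtgt a then path_elt k (cyc2_extend a) else 0.
Proof.
rewrite path_eltM; have [ba|/eqP ba] := eqVneq b (qtgt a); last first.
  by rewrite qcompN //; exact/nesym.
have [c -> vc] := @qcompP _ (cyc2_loop b) a (esym ba).
by congr (path_elt k _); apply: val_inj; rewrite vc ba.
Qed.

Lemma cyc2_loopr b a : path_elt k a * path_elt k (cyc2_loop b) =
  if b == qsrc a then path_elt k (cyc2_extend a) else 0.
Proof.
have tb : qtgt (cyc2_loop b) = b by case: b.
rewrite path_eltM; have [ba|/eqP ba] := eqVneq b (qsrc a); last first.
  by rewrite qcompN ?tb.
have [c -> vc] := @qcompP _ a (cyc2_loop b) (etrans tb ba).
congr (path_elt k _); apply: qpath_cyc2_inj.
  by rewrite /qsrc vc -[RHS]ba.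
by rewrite /qarrows vc /= size_cat addn2.
Qed.

Let sum_loopl (R : pzRingType) (l : bool -> R) u w c :
  (forall b, l b * u = if b == c then w else 0) -> (l false + l true) * u = w.
Proof. by move=> lu; rewrite mulrDl !lu; case: c {lu} => /=; rewrite ?addr0 ?add0r. Qed.

Let sum_loopr (R : pzRingType) (l : bool -> R) u w c :
  (forall b, u * l b = if b == c then w else 0) -> u * (l false + l true) = w.
Proof. by move=> lu; rewrite mulrDr !lu; case: c {lu} => /=; rewrite ?addr0 ?add0r. Qed.

Lemma At_z_central a : At_z * a = a * At_z.
Proof.
rewrite At_zE; move: a; apply: path_elt_commute => a.
exact: etrans (sum_loopl (cyc2_loopl^~ a)) (esym (sum_loopr (cyc2_loopr^~ a))).
Qed.

Definition Atilde_z : alg {poly k} := poly_alg At_z_central.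

End CyclicQuiver.

Section Words.
Variables (k : fieldType) (p : k).

Definition Iset : {pred k} := fun i => `[< exists n : int, i = p ^ (2 * n + 1) >].
Definition Iplus : {pred k} := fun i => `[< exists n : nat, i = p ^+ (2 * n + 1) >].

(* i -> j in the quiver on I, whose arrows are p^2 j -> j. *)
Definition arrow (i j : k) : bool := i == p ^+ 2 * j.

Local Notation dimvec := {fsfun k -> nat with 0%N}.

Definition in_theta_NI (nu : dimvec) : Prop :=
  (forall i, nu i != 0%N -> i \in Iset) /\ (forall i, i \in Iset -> nu i = nu i^-1).

Definition dv_size (nu : dimvec) : nat := (\sum_(i <- finsupp nu) nu i)%N.

Definition dv_plus (nu : dimvec) : dimvec :=
  [fsfun i in finsupp nu => if i \in Iplus then nu i else 0%N].

(* A formal sum is its coefficient function; that of i_1 + ... + i_m is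
   j |-> count_mem j i. *)
Definition words_set m (nu : dimvec) : set (m.-tuple k) :=
  [set i | {subset i <= Iset} /\ forall j, count_mem j i = nu j].
Definition theta_words_set m (nu : dimvec) : set (m.-tuple k) :=
  [set i | {subset i <= Iset} /\
     forall j, (count_mem j i + count_mem j [seq x^-1 | x <- i])%N = nu j].

Definition words m (nu : dimvec) : {fset m.-tuple k} := fset_set (@words_set m nu).
Definition theta_words m (nu : dimvec) : {fset m.-tuple k} :=
  fset_set (@theta_words_set m nu).

Lemma finite_tuples m (V : {fset k}) (A : set (m.-tuple k)) :
  (forall i, A i -> {subset i <= V}) -> finite_set A.
Proof.
move=> AV; apply: (@sub_finite_set _ _
  [set map_tuple val t | t in [set: m.-tuple V]]); last first.
  exact/finite_image/finite_finset.
move=> i /AV iV /=; exists [tuple (Sub (tnth i n) (iV _ (mem_tnth n i)) : V) | n < m] => //.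
by apply: eq_from_tnth => n; rewrite tnth_map tnth_mktuple.
Qed.

Lemma mem_words m (nu : dimvec) (i : m.-tuple k) : reflect
  ({subset i <= Iset} /\ forall j, count_mem j i = nu j) (i \in words m nu).
Proof.
rewrite in_fset_set ?inE; first exact: asboolP.
apply: (@finite_tuples m (finsupp nu)) => {}i [_ inu] j ji.
by rewrite mem_finsupp -inu -lt0n -has_count has_pred1.
Qed.

Lemma mem_theta_words m (nu : dimvec) (i : m.-tuple k) : reflect
  ({subset i <= Iset} /\
     forall j, (count_mem j i + count_mem j [seq x^-1 | x <- i])%N = nu j)
  (i \in theta_words m nu).
Proof.
rewrite in_fset_set ?inE; first exact: asboolP.
apply: (@finite_tuples m (finsupp nu)) => {}i [_ inu] j ji.
by rewrite mem_finsupp -inu -lt0n addn_gt0 -has_count has_pred1 ji.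
Qed.

End Words.

(* For k : 'I_m.-1, the positions k and k + 1 in a word of length m. *)
Definition lpos m (a : 'I_m.-1) : 'I_m :=
  Ordinal (leq_trans (ltn_ord a) (leq_pred m)).
Fact rpos_subproof m (a : 'I_m.-1) : (a.+1 < m)%N.
Proof. by rewrite -ltn_predRL. Qed.
Definition rpos m (a : 'I_m.-1) : 'I_m := Ordinal (rpos_subproof a).

Definition swap_pos m (a : 'I_m.-1) : {perm 'I_m} := tperm (lpos a) (rpos a).
Definition swap_word (k : fieldType) m (a : 'I_m.-1) (i : m.-tuple k) : m.-tuple k :=
  [tuple tnth i (swap_pos a l) | l < m].
Definition invert_head (k : fieldType) m (i : m.-tuple k) : m.-tuple k :=
  [tuple if l == 0 :> nat then (tnth i l)^-1 else tnth i l | l < m].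

Section KLRRelations.
Variables (k : fieldType) (p : k) (m : nat) (J : {fset m.-tuple k}).
Variables (R : pzRingType).
Variables (x : 'I_m -> R) (s : 'I_m.-1 -> R) (e : J -> R).

Definition klr_square (a : 'I_m.-1) (i : J) : R :=
  let il := tnth (val i) (lpos a) in
  let ir := tnth (val i) (rpos a) in
  if il == ir then 0
  else match arrow p il ir, arrow p ir il with
       | true, true => (x (rpos a) - x (lpos a)) * (x (lpos a) - x (rpos a)) * e i
       | true, false => (x (lpos a) - x (rpos a)) * e i
       | false, true => (x (rpos a) - x (lpos a)) * e i
       | false, false => e i
       end.

(* Here b = a + 1, so that the three positions involved are lpos a,
   rpos a = lpos b and rpos b. *)
Definition klr_braid (a b : 'I_m.-1) (i : J) : R :=
  let i1 := tnth (val i) (lpos a) in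
  let i2 := tnth (val i) (rpos a) in
  let i3 := tnth (val i) (rpos b) in
  if i1 == i3
  then match arrow p i1 i2, arrow p i2 i1 with
       | true, true => (x (rpos a) *+ 2 - x (rpos b) - x (lpos a)) * e i
       | true, false => e i
       | false, true => - e i
       | false, false => 0
       end
  else 0.

Definition klr_cross (a : 'I_m.-1) (l : 'I_m) (i : J) : R :=
  if tnth (val i) (lpos a) == tnth (val i) (rpos a)
  then if l == lpos a then - e i else if l == rpos a then e i else 0
  else 0.

(* Index a stands for sigma_(a+1), and positions are counted from 0. *)
Inductive klr_rel : R -> R -> Prop :=
| klr_ee i j : klr_rel (e i * e j) (if i == j then e i else 0)
| klr_se a (i j : J) : val j = swap_word a (val i) -> klr_rel (s a * e i) (e j * s a)
| klr_xe l i : klr_rel (x l * e i) (e i * x l)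
| klr_e1 : klr_rel (\sum_(i : J) e i) 1
| klr_xx l l' : klr_rel (x l * x l') (x l' * x l)
| klr_ss a i : klr_rel (s a ^+ 2 * e i) (klr_square a i)
| klr_far (a b : 'I_m.-1) : (a.+1 < b)%N || (b.+1 < a)%N ->
    klr_rel (s a * s b) (s b * s a)
| klr_sss (a b : 'I_m.-1) i : b = a.+1 :> nat ->
    klr_rel ((s b * s a * s b - s a * s b * s a) * e i) (klr_braid a b i)
| klr_sx a l i :
    klr_rel ((s a * x l - x (swap_pos a l) * s a) * e i) (klr_cross a l i).

End KLRRelations.

Lemma klr_rel_lift (k : fieldType) (p : k) (m : nat) (J : {fset m.-tuple k})
    (R0 R : pzRingType) (f : {rmorphism R0 -> R})
    (x0 : 'I_m -> R0) (s0 : 'I_m.-1 -> R0) (e0 : J -> R0) u v :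
  klr_rel p (fun l => f (x0 l)) (fun a => f (s0 a)) (fun i => f (e0 i)) u v ->
  exists u0 v0, [/\ klr_rel p x0 s0 e0 u0 v0, u = f u0 & v = f v0].
Proof.
case.
- move=> i j; do 2!eexists; split; first exact: (klr_ee _ _ _ _ i j).
    by rewrite rmorphM.
  by case: eqP => _; rewrite ?rmorph0.
- move=> a i j ji; do 2!eexists; split; first exact: (klr_se _ _ _ _ ji).
    by rewrite rmorphM.
  by rewrite rmorphM.
- move=> l i; do 2!eexists; split; first exact: (klr_xe _ _ _ _ l i).
    by rewrite rmorphM.
  by rewrite rmorphM.
- do 2!eexists; split; first exact: klr_e1.
    by rewrite rmorph_sum.
  by rewrite rmorph1.
- move=> l l'; do 2!eexists; split; first exact: (klr_xx _ _ _ _ l l').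
    by rewrite rmorphM.
  by rewrite rmorphM.
- move=> a i; do 2!eexists; split; first exact: (klr_ss _ _ _ _ a i).
    by rewrite rmorphM rmorphXn.
  rewrite /klr_square; case: ifP; rewrite ?rmorph0 // => _.
  by case: arrow; case: arrow; rewrite //= !(rmorphM, rmorphB).
- move=> a b ab; do 2!eexists; split; first exact: (klr_far _ _ _ _ ab).
    by rewrite rmorphM.
  by rewrite rmorphM.
- move=> a b i ab; do 2!eexists; split; first exact: (klr_sss _ _ _ _ i ab).
    by rewrite rmorphM rmorphB !rmorphM.
  rewrite /klr_braid; case: ifP; rewrite ?rmorph0 // => _.
  by case: arrow; case: arrow;
    rewrite /= ?(rmorph0, rmorphN, rmorphM, rmorphB, rmorphMn).
- move=> a l i; do 2!eexists; split; first exact: (klr_sx _ _ _ _ a l i).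
    by rewrite rmorphM rmorphB !rmorphM.
  rewrite /klr_cross; case: ifP; rewrite ?rmorph0 // => _.
  case: ifP => _; first by rewrite rmorphN.
  by case: ifP; rewrite ?rmorph0.
Qed.

Section KLRCentral.
Variables (k : fieldType) (p : k) (m : nat) (J : {fset m.-tuple k}).
Variables (R : pzRingType).
Variables (x : 'I_m -> R) (s : 'I_m.-1 -> R) (e : J -> R).

Hypothesis rels : forall u v, klr_rel p x s e u v -> u = v.
Hypothesis J_swap : forall (a : 'I_m.-1) (i : J), swap_word a (val i) \in J.

Let xp (i : J) : R := \sum_(l < m | tnth (val i) l == p) x l.
Let z : R := \sum_(i : J) xp i * e i.

Let xp_e i j : xp i * e j = e j * xp i.
Proof.
rewrite /xp mulr_suml mulr_sumr; apply: eq_bigr => l _.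
exact/rels/klr_xe.
Qed.

Let xp_x i l : xp i * x l = x l * xp i.
Proof.
rewrite /xp mulr_suml mulr_sumr; apply: eq_bigr => n _.
exact/rels/klr_xx.
Qed.

Let ze j : z * e j = xp j * e j.
Proof.
rewrite /z mulr_suml (bigD1 j) //= big1 => [|i /negbTE ij].
  by rewrite -mulrA (rels (klr_ee _ _ _ _ j j)) eqxx addr0.
by rewrite -mulrA (rels (klr_ee _ _ _ _ i j)) ij mulr0.
Qed.

Let ez j : e j * z = xp j * e j.
Proof.
rewrite /z mulr_sumr (bigD1 j) //= big1 => [|i /negbTE ij].
  by rewrite mulrA -xp_e -mulrA (rels (klr_ee _ _ _ _ j j)) eqxx addr0.
by rewrite mulrA -xp_e -mulrA (rels (klr_ee _ _ _ _ j i)) eq_sym ij mulr0.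
Qed.

Let cross_sum a (j : J) :
  \sum_(l < m | tnth (val j) l == p) klr_cross e a l j = 0.
Proof.
rewrite /klr_cross; case: eqP => [jj|_]; last by rewrite big1.
have lr : rpos a != lpos a.
  by apply/eqP => /(congr1 (@nat_of_ord m)) /= /eqP; rewrite gtn_eqF.
have [jp|jp] := eqVneq (tnth (val j) (lpos a)) p.
  rewrite (bigD1 (lpos a)) ?jp // (bigD1 (rpos a)) /=; last by rewrite -jj jp eqxx lr.
  rewrite eqxx (negbTE lr) eqxx big1 ?addr0 ?addNr // => l.
  by case/andP => /andP[_ /negbTE->] /negbTE->.
apply: big1 => l /eqP lp; case: eqP => [ll|_]; first by rewrite -lp ll eqxx in jp.
by case: eqP => // ll; rewrite -lp ll jj eqxx in jp.
Qed.

Lemma klr_central_x l : z * x l = x l * z.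
Proof.
rewrite /z mulr_suml mulr_sumr; apply: eq_bigr => i _.
by rewrite -mulrA -(rels (klr_xe _ _ _ _ l i)) !mulrA xp_x.
Qed.

Lemma klr_central_e j : z * e j = e j * z.
Proof. by rewrite ze ez. Qed.

Lemma klr_central_s a : z * s a = s a * z.
Proof.
rewrite -[LHS]mulr1 -[RHS]mulr1 -(rels (klr_e1 _ _ _ _)) [LHS]mulr_sumr [RHS]mulr_sumr.
apply: eq_bigr => j _; pose j' : J := [` J_swap a j]%fset.
have se : s a * e j = e j' * s a by apply/rels/klr_se.
rewrite -mulrA se mulrA ze -(mulrA (s a)) ze -mulrA -se !mulrA -/(xp j).
apply/eqP; rewrite eq_sym -subr_eq0 -mulrBl; apply/eqP.
have -> : xp j' = \sum_(l < m | tnth (val j) l == p) x (swap_pos a l).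
  rewrite /xp (reindex_inj (@perm_inj _ (swap_pos a))) /=.
  by apply: eq_bigl => l; rewrite tnth_mktuple /swap_pos tpermK.
rewrite /xp mulr_sumr mulr_suml -sumrB mulr_suml -[RHS](cross_sum a j).
by apply: eq_bigr => l _; apply/rels/klr_sx.
Qed.

End KLRCentral.

Inductive klr_gen m (J : Type) :=
  KLR_x of 'I_m | KLR_s of 'I_m.-1 | KLR_e of J.
Arguments KLR_x {m J}.
Arguments KLR_s {m J}.
Arguments KLR_e {m J}.
HB.instance Definition _ m J := gen_eqMixin (klr_gen m J).
HB.instance Definition _ m J := gen_choiceMixin (klr_gen m J).

Section KLR.
Variables (k : fieldType) (p : k) (m : nat) (nu : {fsfun k -> nat with 0%N}).

Local Notation J := (words p m nu).
Local Notation gen := (klr_gen m J).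
Local Notation g := (@fgen k (klr_gen m J)).

Definition KLR_rel : free_alg k gen -> free_alg k gen -> Prop :=
  klr_rel p (fun l => g (KLR_x l)) (fun a => g (KLR_s a)) (fun i => g (KLR_e i)).

Definition KLR : alg k := presented KLR_rel.

Definition klr_x (l : 'I_m) : KLR := pgen KLR_rel (KLR_x l).
Definition klr_s (a : 'I_m.-1) : KLR := pgen KLR_rel (KLR_s a).
Definition klr_e (i : J) : KLR := pgen KLR_rel (KLR_e i).

(* The position of the n-th occurrence of p in i, counting from n = 0. *)
Definition p_position (i : m.-tuple k) (n : nat) : option 'I_m :=
  onth [seq l <- enum 'I_m | tnth i l == p] n.

Definition klr_x_at (o : option 'I_m) : KLR := if o is Some l then klr_x l else 0.

Definition klr_z : KLR :=
  \sum_(i : J) (klr_x_at (p_position (val i) 0) + klr_x_at (p_position (val i) 1))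
    * klr_e i.

Lemma KLR_relP u v : klr_rel p klr_x klr_s klr_e u v -> u = v.
Proof.
case/(@klr_rel_lift _ _ _ _ _ _ (rqpi KLR_rel)
  (fun l => g (KLR_x l)) (fun a => g (KLR_s a)) (fun i => g (KLR_e i))).
by move=> u0 [v0 [uv0 -> ->]]; exact: presented_rel.
Qed.

Lemma words_swap (a : 'I_m.-1) (i : J) : swap_word a (val i) \in J.
Proof.
have /mem_words [iI inu] := valP i.
have swap_i : perm_eq (swap_word a (val i)) (val i).
  by apply/tuple_permP; exists (swap_pos a).
apply/mem_words; split=> [j|j]; first by rewrite (perm_mem swap_i); exact: iI.
by rewrite -inu; move/seq.permP: swap_i; exact.
Qed.

Hypothesis nu_p : nu p = 2%N.

Lemma klr_zE :
  klr_z = \sum_(i : J) (\sum_(l < m | tnth (val i) l == p) klr_x l) * klr_e i.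
Proof.
apply: eq_bigr => i _; congr (_ * _).
have /mem_words [_ /(_ p)] := valP i; rewrite nu_p => i2.
rewrite -[RHS]big_filter (_ : filter _ _ = [seq l <- enum 'I_m | tnth (val i) l == p]);
  last by rewrite enumT.
rewrite /p_position.
have : size [seq l <- enum 'I_m | tnth (val i) l == p] = 2%N.
  by rewrite size_filter -i2 -[in RHS](map_tnth_enum (val i)) [RHS]count_map.
by case: filter => [|a [|b [|]]] //= _; rewrite big_cons big_seq1.
Qed.

Lemma klr_z_central a : klr_z * a = a * klr_z.
Proof.
rewrite klr_zE; apply: presented_central => -[l|b|j].
- exact: (klr_central_x KLR_relP l).
- exact: (klr_central_s KLR_relP words_swap b).
- exact: (klr_central_e KLR_relP j).
Qed.

Definition KLR_z : alg {poly k} := poly_alg klr_z_central.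

End KLR.

Section KLRPlus.
Variables (k : fieldType) (p : k) (m : nat) (nu : {fsfun k -> nat with 0%N}).

Lemma dv_plus_p : dv_plus p nu p = nu p.
Proof.
rewrite /dv_plus fsfunE; case: finsuppP => // _.
by rewrite ifT //; apply/asboolP; exists 0%N; rewrite expr1.
Qed.

Definition KLR_plus_z (nu_p : nu p = 2%N) : alg {poly k} :=
  @KLR_z k p m (dv_plus p nu) (etrans dv_plus_p nu_p).

End KLRPlus.

Section VVRelations.
Variables (k : fieldType) (p : k) (m : nat) (J : {fset m.-tuple k}).
Variables (R : pzRingType).
Variables (x : 'I_m -> R) (s : 'I_m.-1 -> R) (e : J -> R) (pi : R).

Inductive vv_rel : R -> R -> Prop :=
| vv_klr u v : klr_rel p x s e u v -> vv_rel u v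
| vv_pe (i j : J) : val j = invert_head (val i) -> vv_rel (pi * e i) (e j * pi)
| vv_ppe i : vv_rel (pi ^+ 2 * e i) (e i)
| vv_px0 (l : 'I_m) : l = 0%N :> nat -> vv_rel (pi * x l) (- x l * pi)
| vv_px (l : 'I_m) : (0 < l)%N -> vv_rel (pi * x l) (x l * pi)
| vv_sp (a : 'I_m.-1) i : a = 0%N :> nat ->
    vv_rel ((s a * pi) ^+ 2 * e i) ((pi * s a) ^+ 2 * e i)
| vv_ps (a : 'I_m.-1) : (0 < a)%N -> vv_rel (pi * s a) (s a * pi).

End VVRelations.

Inductive vv_gen m (J : Type) := VV_klr of klr_gen m J | VV_pi.
Arguments VV_klr {m J}.
Arguments VV_pi {m J}.
HB.instance Definition _ m J := gen_eqMixin (vv_gen m J).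
HB.instance Definition _ m J := gen_choiceMixin (vv_gen m J).

Section VV.
Variables (k : fieldType) (p : k) (m : nat) (nu : {fsfun k -> nat with 0%N}).

Local Notation J := (theta_words p m nu).
Local Notation gen := (vv_gen m J).
Local Notation g := (@fgen k (vv_gen m J)).

Definition VV_rel : free_alg k gen -> free_alg k gen -> Prop :=
  vv_rel p (fun l => g (VV_klr (KLR_x l))) (fun a => g (VV_klr (KLR_s a)))
    (fun i => g (VV_klr (KLR_e i))) (g VV_pi).

Definition VV : alg k := presented VV_rel.

End VV.

(* Main.v *)
From HB Require Import structures.
Require Import Defs.
From mathcomp Require Import all_boot all_order perm all_algebra finmap.
From mathcomp Require Import boolp classical_sets cardinality monalg.
From mathcomp Require Import zify.

Set Implicit Arguments.
Unset Strict Implicit.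
Unset Printing Implicit Defensive.

Import GRing.Theory.
Local Open Scope ring_scope.

(** Write W for the algebra VV of nu and R for the KLR algebra of the positive
    half of nu. A letter of a word of W is positive or negative,
    according to whether it or its inverse lies in I^+. The words with positive
    letters only are the words of R; let c_true be the sum of their idempotents
    in W, and c_false the sum of the idempotents of the words with negative
    letters only. Call these two sets of words the ends. R maps to both corners
    c_b W c_b (end_hom): to c_true W c_true by sending generators to generators,
    to c_false W c_false by reversing and inverting the words.

    The product pi sigma_1 ... sigma_n moves the letter at position n to the front
    and inverts it (turn). Turning the letters of the wrong sign, from left to
    right, takes every word to a word of the end of the other sign (straight).
    Crossings of letters of opposite sign have no error terms: opposite signs are
    joined by the arrow p -> p^-1 only, and as nu_p = 2 a word has exactly two
    letters among p and p^-1, so a braid relation on letters of mixed signs has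
    no correction. Straightening therefore carries every generator of W to an
    element of R, and c_b' W c_b is the image of R for b = b', and the image of R
    times D for b <> b', where D turns all letters (between_all). Applying D
    twice multiplies by the sum of the x at the two letters p, that is by z
    (turn_turn). These are the rules by which R (x)_k[z] A~ multiplies, when the
    vertices of the quiver are sent to c_false, c_true and both arrows to D, so
    R (x)_k[z] A~ maps onto e W e for e = c_true + c_false (end_map).

    The idempotent e is full: turning a letter is invertible unless a special
    letter crosses the other one, so each e(w) factors through the end whose sign
    is that of the second special letter of w (word_factor). A full corner is
    Morita equivalent to the whole algebra (full_corner_morita).

    The map from R (x)_k[z] A~ is injective because W acts on the functions from
    sign sequences to R. A word of W is the same as a sequence of signs
    and a word of R, and the generators of W act by matrices over R
    indexed by the sign sequences (M_vv_like). Two special letters of opposite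
    sign cross with weight 1 if they stand in one of the two orders, and with the
    sum of the x at them if they stand in the other; either choice of the order
    with weight 1 is consistent. With a suitable choice D takes one
    constant sign sequence to the other with weight 1 (Psi_turn), while R acts on
    the columns of the constant sequences by left multiplication (Psi_phi). *)

(** * Morita equivalence from a full corner *)

(** An isomorphism of B with the corner e A e, where e is the image of 1, such
    that the two-sided ideal of e is A; corner_l and corner_r write 1 as an
    element of A e A. *)
Record full_corner (k : fieldType) (A B : alg k) := FullCorner {
  corner_map :> B -> A;
  corner_mapD : forall x y, corner_map (x + y) = corner_map x + corner_map y;
  corner_mapM : forall x y, corner_map (x * y) = corner_map x * corner_map y;
  corner_mapZ : forall c,
    corner_map (alg_scalar B c) = alg_scalar A c * corner_map 1;
  corner_map0 : forall x, corner_map x = 0 -> x = 0;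
  corner_onto : forall a, exists x, corner_map x = corner_map 1 * a * corner_map 1;
  corner_ix : finType;
  corner_l : corner_ix -> A;
  corner_r : corner_ix -> A;
  corner_full : \sum_i corner_l i * corner_map 1 * corner_r i = 1
}.

Section CornerMorita.
Variables (k : fieldType) (A B : alg k) (Phi : full_corner A B).

Local Notation T := (corner_ix Phi).
Local Notation e := (Phi 1).
Local Notation l := (@corner_l _ _ _ Phi).
Local Notation r := (@corner_r _ _ _ Phi).

Let idem : e * e = e. Proof. by rewrite -corner_mapM mulr1. Qed.

Let Phi_zero : Phi 0 = 0.
Proof. by apply: (addrI (Phi 0)); rewrite -corner_mapD !addr0. Qed.

Let Phi_opp x : Phi (- x) = - Phi x.
Proof. by apply: (addrI (Phi x)); rewrite -corner_mapD !subrr Phi_zero. Qed.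

Let Phi_inj x y : Phi x = Phi y -> x = y.
Proof.
move=> xy; apply/eqP; rewrite -subr_eq0; apply/eqP/(@corner_map0 _ _ _ Phi).
by rewrite corner_mapD Phi_opp xy subrr.
Qed.

Let Phi_sum (I : finType) (F : I -> B) : Phi (\sum_i F i) = \sum_i Phi (F i).
Proof. exact: (big_morph _ (@corner_mapD _ _ _ Phi) Phi_zero). Qed.

Let Phi_el x : e * Phi x = Phi x. Proof. by rewrite -corner_mapM mul1r. Qed.
Let Phi_er x : Phi x * e = Phi x. Proof. by rewrite -corner_mapM mulr1. Qed.

(** The inverse of B -> e A e, precomposed with the projection a |-> e a e. *)
Definition corner_inv (a : A) : B := xget 0 [set x : B | Phi x = e * a * e].

Lemma corner_invK a : Phi (corner_inv a) = e * a * e.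
Proof. by rewrite /corner_inv; case: xgetP => // h; case: (corner_onto Phi a) => x /h. Qed.

Section ToCorner.
Variable U : lmodType A.

(** The B-module e U. *)
Record corner_mod := CornerMod { corner_val : U; _ : e *: corner_val == corner_val }.
HB.instance Definition _ := [isSub for corner_val].
HB.instance Definition _ := [Choice of corner_mod by <:].

Lemma corner_valP (u : corner_mod) : e *: val u = val u.
Proof. exact/eqP/(valP u). Qed.

Fact corner_mod_add_subproof (u v : corner_mod) :
  e *: (val u + val v) == val u + val v.
Proof. by rewrite scalerDr !corner_valP. Qed.
Fact corner_mod_opp_subproof (u : corner_mod) : e *: (- val u) == - val u.
Proof. by rewrite scalerN corner_valP. Qed.
Fact corner_mod_zero_subproof : e *: 0 == 0 :> U.
Proof. by rewrite scaler0. Qed.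
Fact corner_mod_scale_subproof (b : B) (u : corner_mod) :
  e *: (Phi b *: val u) == Phi b *: val u.
Proof. by rewrite scalerA Phi_el. Qed.

Definition corner_mod_add u v := CornerMod (corner_mod_add_subproof u v).
Definition corner_mod_opp u := CornerMod (corner_mod_opp_subproof u).
Definition corner_mod_zero := CornerMod corner_mod_zero_subproof.
Definition corner_mod_scale b u := CornerMod (corner_mod_scale_subproof b u).

Fact corner_mod_addA : associative corner_mod_add.
Proof. by move=> u v w; apply: val_inj; rewrite /= addrA. Qed.
Fact corner_mod_addC : commutative corner_mod_add.
Proof. by move=> u v; apply: val_inj; rewrite /= addrC. Qed.
Fact corner_mod_add0 : left_id corner_mod_zero corner_mod_add.
Proof. by move=> u; apply: val_inj; rewrite /= add0r. Qed.
Fact corner_mod_addN : left_inverse corner_mod_zero corner_mod_opp corner_mod_add.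
Proof. by move=> u; apply: val_inj; rewrite /= addNr. Qed.

HB.instance Definition _ := GRing.isZmodule.Build corner_mod
  corner_mod_addA corner_mod_addC corner_mod_add0 corner_mod_addN.

Fact corner_mod_scaleA b c u :
  corner_mod_scale b (corner_mod_scale c u) = corner_mod_scale (b * c) u.
Proof. by apply: val_inj; rewrite /= scalerA corner_mapM. Qed.
Fact corner_mod_scale1 : left_id 1 corner_mod_scale.
Proof. by move=> u; apply: val_inj; rewrite /= corner_valP. Qed.
Fact corner_mod_scaleDr : right_distributive corner_mod_scale +%R.
Proof. by move=> b u v; apply: val_inj; rewrite /= scalerDr. Qed.
Fact corner_mod_scaleDl u : {morph corner_mod_scale^~ u : b c / b + c}.
Proof. by move=> b c; apply: val_inj; rewrite /= corner_mapD scalerDl. Qed.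

HB.instance Definition _ := GRing.Zmodule_isLmodule.Build B corner_mod
  corner_mod_scaleA corner_mod_scale1 corner_mod_scaleDr corner_mod_scaleDl.

End ToCorner.

Section ToCornerMap.
Variables (U V : lmodType A) (f : {linear U -> V}).

Fact corner_fun_subproof (u : corner_mod U) : e *: f (val u) == f (val u).
Proof. by rewrite -linearZ /= corner_valP. Qed.
Definition corner_fun (u : corner_mod U) : corner_mod V :=
  CornerMod (corner_fun_subproof u).

Fact corner_fun_linear : linear corner_fun.
Proof. by move=> b u v; apply: val_inj; rewrite /= linearP. Qed.
HB.instance Definition _ := GRing.isLinear.Build B _ _ _ corner_fun corner_fun_linear.

End ToCornerMap.

Fact corner_fun_scalar (U V : lmodType A) (c : k) (f g h : {linear U -> V}) :
  (forall u, h u = alg_scalar A c *: f u + g u) ->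
  forall y, corner_fun h y = alg_scalar B c *: corner_fun f y + corner_fun g y.
Proof.
move=> hE y; apply: val_inj.
by rewrite /= hE corner_mapZ -scalerA -[e *: _]linearZ /= corner_valP.
Qed.

Definition corner_functor : mod_functor A B.
Proof.
refine (@ModFunctor k A B (fun U => corner_mod U) (fun U V f => corner_fun f) _ _
  corner_fun_scalar).
  by move=> U u; apply: val_inj.
by move=> U V W g f u; apply: val_inj.
Defined.

(** The matrix of left multiplication by a on A e, which is a summand of a free
    B-module because 1 lies in A e A. *)
Definition corner_mx (a : A) (i j : T) : B := corner_inv (r i * a * l j).

Lemma corner_mxM a b i j :
  corner_mx (a * b) i j = \sum_n corner_mx a i n * corner_mx b n j.
Proof.
apply: Phi_inj; rewrite Phi_sum corner_invK.
under eq_bigr => n _ do rewrite corner_mapM !corner_invK.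
have -> : a * b = \sum_n a * (l n * e * r n) * b.
  by rewrite -mulr_suml -mulr_sumr corner_full mulr1.
rewrite mulr_sumr mulr_suml mulr_sumr mulr_suml.
by apply: eq_bigr => n _; rewrite !mulrA -(mulrA _ e e) idem.
Qed.

Lemma corner_mxD a b i j : corner_mx (a + b) i j = corner_mx a i j + corner_mx b i j.
Proof. by apply: Phi_inj; rewrite corner_mapD !corner_invK !(mulrDl, mulrDr). Qed.

Section FromCorner.
Variable V : lmodType B.

Definition corner_act (a : A) (v : {ffun T -> V}) : {ffun T -> V} :=
  [ffun i => \sum_j corner_mx a i j *: v j].

Lemma corner_actM a b v : corner_act a (corner_act b v) = corner_act (a * b) v.
Proof.
apply/ffunP => i; rewrite !ffunE.
under eq_bigr => j _ do rewrite ffunE scaler_sumr.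
rewrite exchange_big /=; apply: eq_bigr => j _.
by rewrite corner_mxM scaler_suml; apply: eq_bigr => n _; rewrite scalerA.
Qed.

Lemma corner_actDl a b v : corner_act (a + b) v = corner_act a v + corner_act b v.
Proof.
apply/ffunP => i; rewrite !ffunE -big_split /=; apply: eq_bigr => j _.
by rewrite corner_mxD scalerDl.
Qed.

Lemma corner_actDr a u v : corner_act a (u + v) = corner_act a u + corner_act a v.
Proof.
apply/ffunP => i; rewrite !ffunE -big_split /=; apply: eq_bigr => j _.
by rewrite ffunE scalerDr.
Qed.

(** The A-module A e (x)_B V: the matrix of 1 is idempotent, and its image in the
    sum of copies of V models the tensor product. *)
Record induced_mod := InducedMod {
  induced_val : {ffun T -> V}; _ : corner_act 1 induced_val == induced_val }.
HB.instance Definition _ := [isSub for induced_val].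
HB.instance Definition _ := [Choice of induced_mod by <:].

Lemma induced_valP (u : induced_mod) : corner_act 1 (val u) = val u.
Proof. exact/eqP/(valP u). Qed.

Lemma corner_act0 a : corner_act a 0 = 0.
Proof. by apply: (addrI (corner_act a 0)); rewrite -corner_actDr !addr0. Qed.

Lemma corner_actN a v : corner_act a (- v) = - corner_act a v.
Proof. by apply: (addrI (corner_act a v)); rewrite -corner_actDr !subrr corner_act0. Qed.

Fact induced_add_subproof (u v : induced_mod) :
  corner_act 1 (val u + val v) == val u + val v.
Proof. by rewrite corner_actDr !induced_valP. Qed.
Fact induced_opp_subproof (u : induced_mod) : corner_act 1 (- val u) == - val u.
Proof. by rewrite corner_actN induced_valP. Qed.
Fact induced_zero_subproof : corner_act 1 0 == 0.
Proof. by rewrite corner_act0. Qed.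
Fact induced_scale_subproof a (u : induced_mod) :
  corner_act 1 (corner_act a (val u)) == corner_act a (val u).
Proof. by rewrite corner_actM mul1r. Qed.

Definition induced_add u v := InducedMod (induced_add_subproof u v).
Definition induced_opp u := InducedMod (induced_opp_subproof u).
Definition induced_zero := InducedMod induced_zero_subproof.
Definition induced_scale a u := InducedMod (induced_scale_subproof a u).

Fact induced_addA : associative induced_add.
Proof. by move=> u v w; apply: val_inj; rewrite /= addrA. Qed.
Fact induced_addC : commutative induced_add.
Proof. by move=> u v; apply: val_inj; rewrite /= addrC. Qed.
Fact induced_add0 : left_id induced_zero induced_add.
Proof. by move=> u; apply: val_inj; rewrite /= add0r. Qed.
Fact induced_addN : left_inverse induced_zero induced_opp induced_add.
Proof. by move=> u; apply: val_inj; rewrite /= addNr. Qed.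

HB.instance Definition _ := GRing.isZmodule.Build induced_mod
  induced_addA induced_addC induced_add0 induced_addN.

Fact induced_scaleA a b u : induced_scale a (induced_scale b u) = induced_scale (a * b) u.
Proof. by apply: val_inj; rewrite /= corner_actM. Qed.
Fact induced_scale1 : left_id 1 induced_scale.
Proof. by move=> u; apply: val_inj; rewrite /= induced_valP. Qed.
Fact induced_scaleDr : right_distributive induced_scale +%R.
Proof. by move=> a u v; apply: val_inj; rewrite /= corner_actDr. Qed.
Fact induced_scaleDl u : {morph induced_scale^~ u : a b / a + b}.
Proof. by move=> a b; apply: val_inj; rewrite /= corner_actDl. Qed.

HB.instance Definition _ := GRing.Zmodule_isLmodule.Build A induced_mod
  induced_scaleA induced_scale1 induced_scaleDr induced_scaleDl.

End FromCorner.

Section FromCornerMap.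
Variables (U V : lmodType B) (f : {linear U -> V}).

Definition ffun_comp (u : {ffun T -> U}) : {ffun T -> V} := [ffun i => f (u i)].

Lemma corner_act_comp a u : corner_act a (ffun_comp u) = ffun_comp (corner_act a u).
Proof.
apply/ffunP => i; rewrite !ffunE linear_sum; apply: eq_bigr => j _.
by rewrite ffunE linearZ.
Qed.

Fact induced_fun_subproof (u : induced_mod U) :
  corner_act 1 (ffun_comp (val u)) == ffun_comp (val u).
Proof. by rewrite corner_act_comp induced_valP. Qed.
Definition induced_fun (u : induced_mod U) : induced_mod V :=
  InducedMod (induced_fun_subproof u).

Fact induced_fun_linear : linear induced_fun.
Proof.
move=> a u v; apply: val_inj; rewrite /= corner_act_comp; apply/ffunP => i.
by rewrite !ffunE linearD.
Qed.
HB.instance Definition _ := GRing.isLinear.Build A _ _ _ induced_fun induced_fun_linear.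

End FromCornerMap.

Let scalar_act (V : lmodType B) c (v : {ffun T -> V}) i :
  corner_act (alg_scalar A c) v i = alg_scalar B c *: corner_act 1 v i.
Proof.
rewrite !ffunE scaler_sumr; apply: eq_bigr => j _; rewrite scalerA; congr (_ *: _).
apply: Phi_inj; rewrite corner_mapM corner_mapZ !corner_invK mulr1.
by rewrite -(alg_central c (r i)) !mulrA -(alg_central c e) -!mulrA (mulrA e e) idem.
Qed.

Fact induced_fun_scalar (U V : lmodType B) (c : k) (f g h : {linear U -> V}) :
  (forall u, h u = alg_scalar B c *: f u + g u) ->
  forall y, induced_fun h y = alg_scalar A c *: induced_fun f y + induced_fun g y.
Proof.
move=> hE y; apply: val_inj; apply/ffunP => i /=.
rewrite ffunE [in RHS]/GRing.add /= ffunE scalar_act.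
by rewrite corner_act_comp induced_valP !ffunE hE.
Qed.

Definition induced_functor : mod_functor B A.
Proof.
refine (@ModFunctor k B A (fun V => induced_mod V) (fun U V f => induced_fun f) _ _
  induced_fun_scalar).
  by move=> U u; apply: val_inj; apply/ffunP => i; rewrite /= ffunE.
by move=> U V W g f u; apply: val_inj; apply/ffunP => i; rewrite /= !ffunE.
Defined.

Section UnitA.
Variable U : lmodType A.

Fact unitA_subproof1 (u : U) i : e *: ((e * r i) *: u) == (e * r i) *: u.
Proof. by rewrite scalerA mulrA idem. Qed.
(** In coordinates the isomorphism of U with A e (x)_B e U is u |-> (e r_i u)_i,
    inverse to (u_i) |-> sum of the l_i u_i. *)
Definition unitA_val (u : U) : {ffun T -> corner_mod U} :=
  [ffun i => CornerMod (unitA_subproof1 u i)].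

Lemma unitA_act a u : corner_act a (unitA_val u) = unitA_val (a *: u).
Proof.
apply/ffunP => i; rewrite !ffunE; apply: val_inj.
rewrite (big_morph val (id1 := 0) (op1 := +%R)) //=.
under eq_bigr => j _ do rewrite ffunE /= corner_invK scalerA -!mulrA (mulrA e e) idem !mulrA.
rewrite -scaler_suml scalerA; congr (_ *: _).
rewrite -[RHS]mulr1 -(corner_full Phi) mulr_sumr.
by apply: eq_bigr => j _; rewrite !mulrA.
Qed.

Fact unitA_subproof2 u : corner_act 1 (unitA_val u) == unitA_val u.
Proof. by rewrite unitA_act scale1r. Qed.
Definition unitA (u : U) : induced_functor (corner_functor U) :=
  InducedMod (unitA_subproof2 u).

Fact unitA_linear : linear unitA.
Proof.
move=> a u v; apply: val_inj; rewrite /= unitA_act; apply/ffunP => i.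
by rewrite !ffunE; apply: val_inj; rewrite /= scalerDr.
Qed.
HB.instance Definition _ := GRing.isLinear.Build A _ _ _ unitA unitA_linear.

Lemma unitA_bij : bijective unitA.
Proof.
exists (fun w : induced_mod (corner_mod U) => \sum_i l i *: val (val w i)).
  move=> u /=; under eq_bigr => i _ do rewrite ffunE /= scalerA mulrA.
  by rewrite -scaler_suml corner_full scale1r.
move=> w; apply: val_inj; rewrite /= -[RHS]induced_valP; apply/ffunP => i.
rewrite !ffunE; apply: val_inj; rewrite /= (big_morph val (id1 := 0) (op1 := +%R)) //=.
rewrite scaler_sumr; apply: eq_bigr => j _; rewrite corner_invK scalerA mulr1.
by rewrite -[val (val w j) in LHS]corner_valP scalerA !mulrA.
Qed.

End UnitA.

Section UnitB.
Variable V : lmodType B.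

Definition unitB_val (v : V) : {ffun T -> V} := [ffun i => corner_inv (r i) *: v].

Let sum_inv : \sum_i corner_inv (l i) * corner_inv (r i) = 1.
Proof.
apply: Phi_inj; rewrite Phi_sum.
have -> : e = e * (\sum_i l i * e * r i) * e by rewrite corner_full mulr1 idem.
rewrite mulr_sumr mulr_suml; apply: eq_bigr => i _.
by rewrite corner_mapM !corner_invK !mulrA -(mulrA _ e e) idem.
Qed.

Let mxPhi b i j : corner_mx (Phi b) i j = corner_inv (r i) * b * corner_inv (l j).
Proof.
apply: Phi_inj; rewrite !corner_mapM !corner_invK.
by rewrite !mulrA -(mulrA _ e (Phi b)) Phi_el -(mulrA _ (Phi b) e) Phi_er.
Qed.

Lemma unitB_act b v : corner_act (Phi b) (unitB_val v) = unitB_val (b *: v).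
Proof.
apply/ffunP => i; rewrite !ffunE.
under eq_bigr => j _ do rewrite ffunE mxPhi scalerA -mulrA.
by rewrite -scaler_suml -mulr_sumr sum_inv mulr1 scalerA.
Qed.

Fact unitB_subproof1 v : corner_act 1 (unitB_val v) == unitB_val v.
Proof. by rewrite -{1}[v]scale1r -unitB_act corner_actM mul1r unitB_act scale1r. Qed.
Definition unitB_in v : induced_mod V := InducedMod (unitB_subproof1 v).
Fact unitB_subproof2 v : e *: unitB_in v == unitB_in v.
Proof. by apply/eqP/val_inj; rewrite /= unitB_act scale1r. Qed.
Definition unitB (v : V) : corner_functor (induced_functor V) :=
  CornerMod (unitB_subproof2 v).

Fact unitB_linear : linear unitB.
Proof.
move=> b u v; apply: val_inj; apply: val_inj; rewrite /= unitB_act; apply/ffunP => i.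
by rewrite !ffunE scalerDr.
Qed.
HB.instance Definition _ := GRing.isLinear.Build B _ _ _ unitB unitB_linear.

Lemma unitB_bij : bijective unitB.
Proof.
exists (fun w : corner_mod (induced_mod V) => \sum_i corner_inv (l i) *: val (val w) i).
  move=> v /=; under eq_bigr => i _ do rewrite ffunE scalerA.
  by rewrite -scaler_suml sum_inv scale1r.
move=> w; apply: val_inj; apply: val_inj; rewrite /=.
rewrite -[in RHS]corner_valP /=; apply/ffunP => i; rewrite !ffunE scaler_sumr.
by apply: eq_bigr => j _; rewrite mxPhi mulr1 scalerA.
Qed.

End UnitB.

(** The functors U |-> e U and V |-> A e (x)_B V are quasi-inverse to each other. *)
Theorem full_corner_morita : morita_equivalent A B.
Proof.
exists corner_functor, induced_functor; split.
  exists (fun U : lmodType A => (@unitA U : {linear U -> induced_functor (corner_functor U)})); split=> [U|U V f u]; first exact: unitA_bij.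
  apply: val_inj; apply/ffunP => i; rewrite /= !ffunE.
  by apply: val_inj; rewrite /= linearZ.
exists (fun V : lmodType B => (@unitB V : {linear V -> corner_functor (induced_functor V)})); split=> [V|U V f u]; first exact: unitB_bij.
apply: val_inj; apply: val_inj; apply/ffunP => i; rewrite /= !ffunE.
by rewrite linearZ.
Qed.

End CornerMorita.

(** * Maps out of free, presented and tensor product algebras *)

Section LinearExtension.
Variables (k : fieldType) (K : choiceType) (A : alg k) (h : K -> A).

Definition lin_ext (u : {malg k[K]}) : A :=
  \sum_(m <- msupp u) alg_scalar A u@_m * h m.

Lemma lin_extw (d : {fset K}) u : (msupp u `<=` d)%fset ->
  lin_ext u = \sum_(m <- d) alg_scalar A u@_m * h m.
Proof.
move=> le; rewrite /lin_ext (big_fset_incl _ le) //= => m _ /mcoeff_outdom ->.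
by rewrite rmorph0 mul0r.
Qed.

Lemma lin_extU c m : lin_ext << c *g m >> = alg_scalar A c * h m.
Proof. by rewrite (lin_extw msuppU_le) big_seq_fset1 mcoeffUU. Qed.

Fact lin_ext_is_zmod_morphism : zmod_morphism lin_ext.
Proof.
move=> u v; pose d := (msupp u `|` msupp v)%fset.
rewrite !(@lin_extw d) ?fsubsetUl ?fsubsetUr //; last first.
  by rewrite (fsubset_trans (msuppB_le _ _)).
rewrite -sumrB; apply: eq_bigr => m _.
by rewrite mcoeffB rmorphB mulrBl.
Qed.
HB.instance Definition _ :=
  GRing.isZmodMorphism.Build {malg k[K]} A lin_ext lin_ext_is_zmod_morphism.

End LinearExtension.

Section FreeLift.
Variables (k : fieldType) (G : choiceType) (A : alg k) (h : G -> A).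

Definition monom_prod (m : {fmonom G}) : A := \prod_(g <- (m : seq G)) h g.

Definition free_lift : free_alg k G -> A := lin_ext monom_prod.
HB.instance Definition _ := GRing.Additive.on free_lift.

Fact free_lift_is_monoid_morphism : monoid_morphism free_lift.
Proof.
split=> [|u v].
  by rewrite /free_lift lin_extU rmorph1 mul1r /monom_prod fm1 big_nil.
rewrite [u]monalgE [v]monalgE mulr_suml !raddf_sum mulr_suml /=.
apply: eq_bigr => m _; rewrite mulr_sumr !raddf_sum mulr_sumr /=.
apply: eq_bigr => n _; rewrite malgM_def fgmulUU /free_lift !lin_extU rmorphM.
rewrite /monom_prod /mmul /= fmmulE big_cat /= -!mulrA; congr (_ * _).
by rewrite !mulrA alg_central.
Qed.
HB.instance Definition _ := GRing.isMonoidMorphism.Build (free_alg k G) A free_lift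
  free_lift_is_monoid_morphism.

Lemma free_lift_gen g : free_lift (fgen k g) = h g.
Proof. by rewrite /free_lift lin_extU rmorph1 mul1r /monom_prod fmuE big_seq1. Qed.

Lemma free_liftC c : free_lift c%:MP = alg_scalar A c.
Proof. by rewrite /free_lift lin_extU /monom_prod fm1 big_nil mulr1. Qed.

End FreeLift.

Lemma free_alg_ind (k : fieldType) (G : choiceType) (P : free_alg k G -> Prop) :
  (forall c, P c%:MP) -> (forall g, P (fgen k g)) ->
  (forall u v, P u -> P v -> P (u + v)) -> (forall u v, P u -> P v -> P (u * v)) ->
  forall u, P u.
Proof.
move=> Pc Pg PD PM u; rewrite [u]monalgE; apply: big_ind => //.
  by rewrite -(rmorph0 (@malgC {fmonom G} k)); exact: Pc.
move=> m _.
have -> : << u@_m *g m >> = (u@_m)%:MP * << m >> :> free_alg k G.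
  by rewrite malgM_def fgmulUU mulr1 mul1m.
apply: (PM _ _ (Pc _)); case: m => s; elim: s => [|g s IHs].
  by rewrite -fmoneE; exact: (Pc 1).
have -> : << FMonom (g :: s) >> = fgen k g * << FMonom s >> :> free_alg k G.
  by rewrite malgM_def fgmulUU mulr1 /mmul /= fmuE fmmulE.
exact: PM.
Qed.

Section PresentedLift.
Variables (k : fieldType) (G : choiceType).
Variable rel : free_alg k G -> free_alg k G -> Prop.

Lemma presented_ind (P : presented rel -> Prop) :
  (forall c, P (alg_scalar (presented rel) c)) -> (forall g, P (pgen rel g)) ->
  (forall u v, P u -> P v -> P (u + v)) -> (forall u v, P u -> P v -> P (u * v)) ->
  forall u, P u.
Proof.
move=> Pc Pg PD PM u; have [{}u ->] := rqpi_surj u.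
elim/free_alg_ind: u => [c|g|u v Pu Pv|u v Pu Pv]; [exact: Pc | exact: Pg | |].
  by rewrite rmorphD; exact: PD.
by rewrite rmorphM; exact: PM.
Qed.

Variables (A : alg k) (h : G -> A).
Hypothesis hrel : forall u v, rel u v -> free_lift h u = free_lift h v.

Definition presented_lift (a : presented rel) : A := free_lift h (repr (a : rquot rel)).

Lemma presented_lift_pi u : presented_lift (rqpi rel u) = free_lift h u.
Proof.
apply/eqP; rewrite -subr_eq0 -rmorphB; apply/eqP.
elim: (repr_rq rel u) => [|a v w b vw|v w _ Ev _ Ew]; first by rewrite rmorph0.
  by rewrite !rmorphM rmorphB /= (hrel vw) subrr mulr0 mul0r.
by rewrite rmorphD Ev Ew addr0.
Qed.

Lemma presented_liftD a b : presented_lift (a + b) = presented_lift a + presented_lift b.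
Proof.
have [[u ->] [v ->]] := (rqpi_surj a, rqpi_surj b).
by rewrite -rmorphD !presented_lift_pi rmorphD.
Qed.

Lemma presented_liftM a b : presented_lift (a * b) = presented_lift a * presented_lift b.
Proof.
have [[u ->] [v ->]] := (rqpi_surj a, rqpi_surj b).
by rewrite -rmorphM !presented_lift_pi rmorphM.
Qed.

Lemma presented_lift_gen g : presented_lift (pgen rel g) = h g.
Proof. by rewrite presented_lift_pi free_lift_gen. Qed.

Lemma presented_lift_scalar c :
  presented_lift (alg_scalar (presented rel) c) = alg_scalar A c.
Proof. by rewrite presented_lift_pi free_liftC. Qed.

End PresentedLift.

(** * Corner rings *)

Section CornerRing.
Variables (k : fieldType) (A : alg k).

Record idem_elt := IdemElt { idem_val : A; idemP : idem_val * idem_val = idem_val }.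

Variable ci : idem_elt.
Local Notation c := (idem_val ci).

Record corner_ring := CornerRing {
  in_corner : A; _ : (c * in_corner == in_corner) && (in_corner * c == in_corner) }.
HB.instance Definition _ := [isSub for in_corner].
HB.instance Definition _ := [Choice of corner_ring by <:].

Lemma cornerl (a : corner_ring) : c * val a = val a.
Proof. by case/andP: (valP a) => /eqP. Qed.
Lemma cornerr (a : corner_ring) : val a * c = val a.
Proof. by case/andP: (valP a) => _ /eqP. Qed.

Fact corner_ring_add_subproof (a b : corner_ring) :
  (c * (val a + val b) == val a + val b) && ((val a + val b) * c == val a + val b).
Proof. by rewrite mulrDr mulrDl !cornerl !cornerr eqxx. Qed.
Fact corner_ring_opp_subproof (a : corner_ring) :
  (c * (- val a) == - val a) && (- val a * c == - val a).
Proof. by rewrite mulrN mulNr !cornerl !cornerr eqxx. Qed.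
Fact corner_ring_zero_subproof : (c * 0 == 0) && (0 * c == 0).
Proof. by rewrite mulr0 mul0r eqxx. Qed.
Fact corner_ring_one_subproof : (c * c == c) && (c * c == c).
Proof. by rewrite !idemP eqxx. Qed.
Fact corner_ring_mul_subproof (a b : corner_ring) :
  (c * (val a * val b) == val a * val b) && (val a * val b * c == val a * val b).
Proof. by rewrite mulrA cornerl -mulrA cornerr eqxx. Qed.

Definition corner_ring_add a b := CornerRing (corner_ring_add_subproof a b).
Definition corner_ring_opp a := CornerRing (corner_ring_opp_subproof a).
Definition corner_ring_zero := CornerRing corner_ring_zero_subproof.
Definition corner_ring_one := CornerRing corner_ring_one_subproof.
Definition corner_ring_mul a b := CornerRing (corner_ring_mul_subproof a b).

Fact corner_ring_addA : associative corner_ring_add.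
Proof. by move=> a b d; apply: val_inj; rewrite /= addrA. Qed.
Fact corner_ring_addC : commutative corner_ring_add.
Proof. by move=> a b; apply: val_inj; rewrite /= addrC. Qed.
Fact corner_ring_add0 : left_id corner_ring_zero corner_ring_add.
Proof. by move=> a; apply: val_inj; rewrite /= add0r. Qed.
Fact corner_ring_addN : left_inverse corner_ring_zero corner_ring_opp corner_ring_add.
Proof. by move=> a; apply: val_inj; rewrite /= addNr. Qed.

HB.instance Definition _ := GRing.isZmodule.Build corner_ring
  corner_ring_addA corner_ring_addC corner_ring_add0 corner_ring_addN.

Fact corner_ring_mulA : associative corner_ring_mul.
Proof. by move=> a b d; apply: val_inj; rewrite /= mulrA. Qed.
Fact corner_ring_mul1 : left_id corner_ring_one corner_ring_mul.
Proof. by move=> a; apply: val_inj; rewrite /= cornerl. Qed.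
Fact corner_ring_mulr1 : right_id corner_ring_one corner_ring_mul.
Proof. by move=> a; apply: val_inj; rewrite /= cornerr. Qed.
Fact corner_ring_mulDl : left_distributive corner_ring_mul +%R.
Proof. by move=> a b d; apply: val_inj; rewrite /= mulrDl. Qed.
Fact corner_ring_mulDr : right_distributive corner_ring_mul +%R.
Proof. by move=> a b d; apply: val_inj; rewrite /= mulrDr. Qed.

HB.instance Definition _ := GRing.Zmodule_isPzRing.Build corner_ring
  corner_ring_mulA corner_ring_mul1 corner_ring_mulr1 corner_ring_mulDl corner_ring_mulDr.

Fact corner_scalar_subproof (x : k) :
  (c * (alg_scalar A x * c) == alg_scalar A x * c) &&
  (alg_scalar A x * c * c == alg_scalar A x * c).
Proof. by rewrite mulrA -alg_central -!mulrA !idemP eqxx. Qed.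
Definition corner_scalar (x : k) : corner_ring := CornerRing (corner_scalar_subproof x).

Fact corner_scalar_is_zmod_morphism : zmod_morphism corner_scalar.
Proof. by move=> x y; apply: val_inj; rewrite /= rmorphB mulrBl. Qed.
Fact corner_scalar_is_monoid_morphism : monoid_morphism corner_scalar.
Proof.
split=> [|x y]; apply: val_inj; rewrite /= ?rmorph1 ?mul1r //.
by rewrite rmorphM -!mulrA (mulrA c) -alg_central -!mulrA idemP.
Qed.
HB.instance Definition _ := GRing.isZmodMorphism.Build k corner_ring corner_scalar
  corner_scalar_is_zmod_morphism.
HB.instance Definition _ := GRing.isMonoidMorphism.Build k corner_ring corner_scalar
  corner_scalar_is_monoid_morphism.

Fact corner_scalar_central x a : corner_scalar x * a = a * corner_scalar x.
Proof.
apply: val_inj; rewrite /= -mulrA cornerl.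
by rewrite (mulrA (val a)) -alg_central -mulrA cornerr.
Qed.

Definition corner_alg : alg k := Alg corner_scalar_central.

End CornerRing.

Section TensorLift.
Variables (S : comPzRingType) (A B : alg S) (M : zmodType) (h : A -> B -> M).
Hypothesis hDl : forall a a' b, h (a + a') b = h a b + h a' b.
Hypothesis hDr : forall a b b', h a (b + b') = h a b + h a b'.
Hypothesis hbal : forall s a b, h (alg_scalar A s * a) b = h a (alg_scalar B s * b).

(** The universal property of the tensor product, for maps into abelian groups. *)
Definition tens_lift (t : tensor A B) : M := \sum_(x <- repr t) h x.1 x.2.

Let lift_teq u v : teq u v -> \sum_(x <- u) h x.1 x.2 = \sum_(x <- v) h x.1 x.2.
Proof.
elim=> {u v} //=.
- by move=> u v w _ -> _ ->.
- by move=> u u' v v' _ Eu _ Ev; rewrite !big_cat /= Eu Ev.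
- by move=> u v; rewrite !big_cat /= addrC.
- by move=> b; rewrite big_seq1 big_nil; apply: (addrI (h 0 b)); rewrite -hDl !addr0.
- by move=> a a' b; rewrite big_seq1 big_cons big_seq1 hDl.
- by move=> a b b'; rewrite big_seq1 big_cons big_seq1 hDr.
- by move=> s a b; rewrite !big_seq1 hbal.
Qed.

Lemma tens_lift_tens a b : tens_lift (tens a b) = h a b.
Proof. by rewrite /tens_lift (lift_teq (repr_t _)) big_seq1. Qed.

Lemma tens_liftD t u : tens_lift (t + u) = tens_lift t + tens_lift u.
Proof. by rewrite /tens_lift (lift_teq (repr_t _)) big_cat. Qed.

End TensorLift.

(** * Relations transported along ring morphisms *)

Section RelationMap.
Variables (k : fieldType) (p : k) (m : nat) (J : {fset m.-tuple k}).
Variables (R0 R : pzRingType) (f : {rmorphism R0 -> R}).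
Variables (x0 : 'I_m -> R0) (s0 : 'I_m.-1 -> R0) (e0 : J -> R0) (pi0 : R0).
Variables (x : 'I_m -> R) (s : 'I_m.-1 -> R) (e : J -> R) (pi : R).
Hypotheses (fx : forall l, f (x0 l) = x l) (fs : forall a, f (s0 a) = s a).
Hypotheses (fe : forall i, f (e0 i) = e i) (fpi : f pi0 = pi).

Let fE := (rmorph0, rmorph1, rmorphM, rmorphB, rmorphD, rmorphN, rmorphMn, rmorphXn,
  fx, fs, fe, fpi).

Lemma klr_rel_map u v : klr_rel p x0 s0 e0 u v -> klr_rel p x s e (f u) (f v).
Proof.
case.
- move=> i j; rewrite !fE (fun_if f) !fE; exact: klr_ee.
- by move=> a i j ji; rewrite !fE; exact: klr_se.
- by move=> l i; rewrite !fE; exact: klr_xe.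
- rewrite rmorph_sum rmorph1 (eq_bigr e) => [|i _]; [exact: klr_e1 | by rewrite fE].
- by move=> l l'; rewrite !fE; exact: klr_xx.
- move=> a i; have -> : f (klr_square p x0 e0 a i) = klr_square p x e a i.
    by rewrite /klr_square; case: ifP => _; [rewrite fE|case: arrow; case: arrow; rewrite !fE].
  by rewrite !fE; exact: klr_ss.
- by move=> a b ab; rewrite !fE; exact: klr_far.
- move=> a b i ab; have -> : f (klr_braid p x0 e0 a b i) = klr_braid p x e a b i.
    by rewrite /klr_braid; case: ifP => _; [case: arrow; case: arrow|]; rewrite !fE.
  by rewrite !fE; exact: klr_sss.
- move=> a l i; have -> : f (klr_cross e0 a l i) = klr_cross e a l i.
    by rewrite /klr_cross; do ?case: ifP => _; rewrite !fE.
  by rewrite !fE; exact: klr_sx.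
Qed.

Lemma vv_rel_map u v : vv_rel p x0 s0 e0 pi0 u v -> vv_rel p x s e pi (f u) (f v).
Proof.
case.
- by move=> ? ? /klr_rel_map; exact: vv_klr.
- by move=> i j ij; rewrite !fE; exact: vv_pe.
- by move=> i; rewrite !fE; exact: vv_ppe.
- by move=> l l0; rewrite !fE; exact: vv_px0.
- by move=> l l0; rewrite !fE; exact: vv_px.
- by move=> a i a0; rewrite !fE; exact: vv_sp.
- by move=> a a0; rewrite !fE; exact: vv_ps.
Qed.

End RelationMap.

(** * KLR relations indexed by natural numbers *)

Definition swapn (a l : nat) : nat :=
  if l == a then a.+1 else if l == a.+1 then a else l.

Lemma swapnK a : involutive (swapn a).
Proof. by move=> l; rewrite /swapn; do ?case: eqP; lia. Qed.

Lemma swapn_lt m a l : (a.+1 < m)%N -> (swapn a l < m)%N = (l < m)%N.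
Proof. by rewrite /swapn; do ?case: eqP; lia. Qed.

Definition swapf (T : Type) a (w : nat -> T) : nat -> T := fun l => w (swapn a l).

Definition tupf (T : Type) m (w : nat -> T) : m.-tuple T := [tuple w l | l < m].

Lemma tupf_nth (T : Type) m x0 (i : m.-tuple T) : tupf m (nth x0 i) = i.
Proof. by apply: eq_from_tnth => l; rewrite tnth_mktuple (tnth_nth x0). Qed.

Lemma nth_tupf (T : Type) m x0 (w : nat -> T) l : (l < m)%N ->
  nth x0 (tupf m w) l = w l.
Proof. by move=> lm; rewrite -[l]/(val (Ordinal lm)) -tnth_nth tnth_mktuple. Qed.

Lemma eq_tupf (T : Type) m (w w' : nat -> T) :
  (forall l, (l < m)%N -> w l = w' l) -> tupf m w = tupf m w'.
Proof. by move=> ww; apply: eq_from_tnth => l; rewrite !tnth_mktuple ww. Qed.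

Lemma swap_pos_swapn m (a : 'I_m.-1) (l : 'I_m) : swap_pos a l = swapn a l :> nat.
Proof.
rewrite /swap_pos /swapn permE /= -!val_eqE /=.
by case: eqP => // _; case: eqP.
Qed.

Lemma tupf_swap (k : fieldType) m (a : 'I_m.-1) (w : nat -> k) :
  tupf m (swapf (nat_of_ord a) w) = swap_word a (tupf m w).
Proof.
by apply: eq_from_tnth => l; rewrite !tnth_mktuple /swapf swap_pos_swapn.
Qed.

Section KLRLike.
Variables (k : fieldType) (p : k) (m : nat) (S : pzRingType).

Definition sqr_coef (x : nat -> S) a (w : nat -> k) : S :=
  if w a == w a.+1 then 0
  else if arrow p (w a) (w a.+1) then x a - x a.+1
  else if arrow p (w a.+1) (w a) then x a.+1 - x a else 1.

Definition braid_coef a (w : nat -> k) : S :=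
  if w a == w a.+2
  then (arrow p (w a) (w a.+1))%:R - (arrow p (w a.+1) (w a))%:R else 0.

Definition cross_coef a (l : nat) (w : nat -> k) : S :=
  if w a == w a.+1 then (l == a.+1)%:R - (l == a)%:R else 0.

(** The KLR relations for families indexed by natural numbers and by functions from
    nat, of which only the first m values matter. No sums of idempotents are
    involved, so that the families can live in a corner of a larger ring. The
    coefficients have a simple form because an arrow i -> j excludes j -> i. *)
Record klr_like (x s : nat -> S) (E : (nat -> k) -> S) : Prop := KLRLike {
  kl_EE : forall w, E w * E w = E w;
  kl_E0 : forall w w' l, (l < m)%N -> w l != w' l -> E w * E w' = 0;
  kl_Eext : forall w w', (forall l, (l < m)%N -> w l = w' l) -> E w = E w';
  kl_sE : forall a w, (a.+1 < m)%N -> s a * E w = E (swapf a w) * s a;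
  kl_xE : forall l w, (l < m)%N -> x l * E w = E w * x l;
  kl_xx : forall l l', (l < m)%N -> (l' < m)%N -> x l * x l' = x l' * x l;
  kl_ss : forall a w, (a.+1 < m)%N -> s a * (s a * E w) = sqr_coef x a w * E w;
  kl_far : forall a b, (a.+1 < b)%N -> (b.+1 < m)%N -> s a * s b = s b * s a;
  kl_br : forall a w, (a.+2 < m)%N ->
    s a.+1 * (s a * (s a.+1 * E w)) =
    s a * (s a.+1 * (s a * E w)) + braid_coef a w * E w;
  kl_sx : forall a l w, (a.+1 < m)%N -> (l < m)%N ->
    s a * (x l * E w) = x (swapn a l) * (s a * E w) + cross_coef a l w * E w
}.

End KLRLike.

Section FromKLRRel.
Variables (k : fieldType) (p : k) (m : nat) (J : {fset m.-tuple k}).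
Variables (S : pzRingType) (x0 : 'I_m -> S) (s0 : 'I_m.-1 -> S) (e0 : J -> S).
Hypothesis rels : forall u v, klr_rel p x0 s0 e0 u v -> u = v.
Hypothesis J_swap : forall (a : 'I_m.-1) (i : m.-tuple k), i \in J -> swap_word a i \in J.
Hypothesis J_arrow : forall (i : m.-tuple k) y z, i \in J -> y \in i -> z \in i ->
  arrow p y z -> ~~ arrow p z y.

Definition nat_x l : S := oapp x0 0 (insub l).
Definition nat_s a : S := oapp s0 0 (insub a).
Definition nat_e (w : nat -> k) : S := oapp e0 0 (insub (tupf m w)).

Lemma nat_xE (l : 'I_m) : nat_x l = x0 l.
Proof. by rewrite /nat_x valK. Qed.
Lemma nat_sE (a : 'I_m.-1) : nat_s a = s0 a.
Proof. by rewrite /nat_s valK. Qed.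
Lemma nat_eE (i : J) w : tupf m w = val i -> nat_e w = e0 i.
Proof. by rewrite /nat_e => ->; rewrite valK. Qed.
Lemma nat_e_out w : tupf m w \notin J -> nat_e w = 0.
Proof. by rewrite /nat_e; case: insubP => // u ->. Qed.

Variant nat_e_spec w : S -> Type :=
| NatEIn (i : J) of tupf m w = val i : nat_e_spec w (e0 i)
| NatEOut of tupf m w \notin J : nat_e_spec w 0.

Lemma nat_eP w : nat_e_spec w (nat_e w).
Proof.
case: (boolP (tupf m w \in J)) => wJ; last by rewrite nat_e_out //; constructor.
by rewrite (@nat_eE [` wJ]%fset) //; constructor.
Qed.

Let ltpred a : (a.+1 < m)%N -> (a < m.-1)%N. Proof. by lia. Qed.

Lemma nat_klr_like : klr_like p m nat_x nat_s nat_e.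
Proof.
have tl (w : nat -> k) l (lm : (l < m)%N) : w l = tnth (tupf m w) (Ordinal lm).
  by rewrite tnth_mktuple.
split.
- move=> w; case: nat_eP => [i _|_]; last by rewrite mulr0.
  by rewrite (rels (klr_ee _ _ _ _ i i)) eqxx.
- move=> w w' l lm ww; case: nat_eP => [i wi|_]; last by rewrite mul0r.
  case: nat_eP => [j wj|_]; last by rewrite mulr0.
  rewrite (rels (klr_ee _ _ _ _ i j)) ifN //; apply: contra ww => /eqP ij.
  by rewrite !(tl _ _ lm) wi wj ij.
- by move=> w w' ww; rewrite /nat_e (eq_tupf ww).
- move=> a w /ltpred am; rewrite -[a]/(val (Ordinal am)) nat_sE.
  case: (nat_eP w) => [i wi|wN].
    case: nat_eP => [j wj|].
      by apply/rels/klr_se; rewrite -wj tupf_swap wi.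
    by rewrite tupf_swap wi J_swap //; exact: valP.
  rewrite mulr0; case: nat_eP => [j wj|]; last by rewrite mul0r.
  case/negP: wN; have := J_swap (Ordinal am) (valP j); rewrite -wj -tupf_swap.
  by rewrite (@eq_tupf _ _ _ w) // => l _; rewrite /swapf swapnK.
- move=> l w lm; rewrite -[l]/(val (Ordinal lm)) nat_xE.
  by case: nat_eP => [i wi|_]; [apply/rels/klr_xe | rewrite mulr0 mul0r].
- move=> l l' lm lm'; rewrite -[l]/(val (Ordinal lm)) -[l']/(val (Ordinal lm')).
  by rewrite !nat_xE; apply/rels/klr_xx.
- move=> a w am; rewrite -[in s in s * _]/(val (Ordinal (ltpred am))).
  rewrite -[a]/(val (Ordinal (ltpred am))) nat_sE; set o := Ordinal _.
  case: nat_eP => [i wi|_]; last by rewrite !mulr0.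
  rewrite mulrA -expr2 (rels (klr_ss _ _ _ _ o i)) /klr_square -wi !tnth_mktuple /=.
  rewrite /sqr_coef -!nat_xE /=; case: eqP => // _; first by rewrite mul0r.
  have h y z := @J_arrow _ y z (valP i); rewrite -wi in h.
  case: ifP => [ar|_]; last by case: ifP; rewrite ?mul1r.
  have ma : (a < m)%N by lia.
  by rewrite (negbTE (h _ _ _ _ ar)) // ?(tl _ _ am) ?(tl _ _ ma) mem_tnth.
- move=> a b ab bm; have am : (a.+1 < m)%N by lia.
  rewrite -[a]/(val (Ordinal (ltpred am))) -[b]/(val (Ordinal (ltpred bm))) !nat_sE.
  by apply/rels/klr_far; rewrite /= ab.
- move=> a w am; have bm : (a.+1 < m)%N by lia.
  have am' : (a.+1 < m.-1)%N by lia.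
  pose o := Ordinal (ltpred bm); pose o' := Ordinal am'.
  rewrite -[a]/(val o) -[(val o).+1]/(val o') !nat_sE.
  case: nat_eP => [i wi|_]; last by rewrite !mulr0 addr0.
  apply/eqP; rewrite addrC -subr_eq !mulrA -mulrBl; apply/eqP.
  rewrite (rels (@klr_sss _ _ _ _ _ x0 s0 e0 o o' i erefl)) /klr_braid -wi !tnth_mktuple /=.
  rewrite /braid_coef; case: eqP => // _; last by rewrite mul0r.
  have h y z := @J_arrow _ y z (valP i); rewrite -wi in h.
  have ma : (a < m)%N by lia.
  case: ifP => [ar|_]; first rewrite (negbTE (h _ _ _ _ ar)) ?subr0 ?mul1r // ?(tl _ _ bm) ?(tl _ _ ma) ?mem_tnth //.
  by case: ifP; rewrite sub0r ?mulN1r // oppr0 mul0r.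
- move=> a l w am lm.
  pose o := Ordinal (ltpred am); pose l' := Ordinal lm.
  rewrite -[a]/(val o) -[l]/(val l') -swap_pos_swapn nat_sE !nat_xE.
  case: nat_eP => [i wi|_]; last by rewrite !mulr0 addr0.
  apply/eqP; rewrite addrC -subr_eq !mulrA -mulrBl; apply/eqP.
  rewrite (rels (klr_sx _ _ _ _ o l' i)) /klr_cross -wi !tnth_mktuple /=.
  rewrite /cross_coef; case: eqP => // _; last by rewrite mul0r.
  rewrite -!val_eqE /=; case: (eqVneq l a) => [->|la].
    by rewrite ltn_eqF // sub0r mulN1r.
  by case: eqP; rewrite subr0 ?mul1r ?mul0r.
Qed.

End FromKLRRel.

Section ToKLRRel.
Variables (k : fieldType) (p : k) (m : nat) (J : {fset m.-tuple k}).
Variables (S : pzRingType) (x s : nat -> S) (E : (nat -> k) -> S).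
Hypothesis like : klr_like p m x s E.
Hypothesis E1 : \sum_(i : J) E (nth 1 (val i)) = 1.
Hypothesis J_arrow : forall (i : m.-tuple k) y z, i \in J -> y \in i -> z \in i ->
  arrow p y z -> ~~ arrow p z y.

Lemma klr_like_rel u v :
  klr_rel p (fun l : 'I_m => x l) (fun a : 'I_m.-1 => s a)
    (fun i : J => E (nth 1 (val i))) u v -> u = v.
Proof.
have rp (a : 'I_m.-1) : (a.+1 < m)%N by case: a => a /=; lia.
have tn (i : J) (l : 'I_m) : tnth (val i) l = nth 1 (val i) l by exact: tnth_nth.
have ar (i : J) (a : 'I_m.-1) : arrow p (nth 1 (val i) a) (nth 1 (val i) a.+1) ->
    arrow p (nth 1 (val i) a.+1) (nth 1 (val i) a) = false.
  move=> h; apply/negbTE; apply: (J_arrow (valP i) _ _ h);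
    by rewrite mem_nth ?size_tuple //; have := rp a; lia.
case.
- move=> i j; case: eqP => [->|/eqP ij]; first exact: kl_EE like _.
  have [l ijl] : exists l : 'I_m, tnth (val i) l != tnth (val j) l.
    apply/existsP; rewrite -negb_forall; apply: contra ij => /forallP ij.
    by apply/eqP/val_inj/eq_from_tnth => l; apply/eqP.
  by apply: (kl_E0 like) (ltn_ord l) _; rewrite -!tn.
- move=> a i j ij; rewrite (kl_sE like) //; congr (_ * _); apply: (kl_Eext like) => l lm.
  by rewrite -[l]/(val (Ordinal lm)) -tnth_nth ij tnth_mktuple tn swap_pos_swapn.
- by move=> l i; exact: kl_xE like _ _ (ltn_ord l).
- exact: E1.
- by move=> l l'; exact: kl_xx like _ _ (ltn_ord l) (ltn_ord l').
- move=> a i; rewrite expr2 -mulrA (kl_ss like) // /klr_square /sqr_coef !tn /=.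
  case: ifP => _; first by rewrite mul0r.
  case: ifP => [/ar ->//|_]; first by case: ifP; rewrite ?mul1r.
- move=> a b /orP[ab|ab]; first exact: (kl_far like ab).
  by rewrite (kl_far like ab).
- move=> a b i ab; have bm : (a.+2 < m)%N by rewrite -ab; exact: rp.
  rewrite mulrBl -!mulrA ab (kl_br like) // addrAC subrr add0r.
  rewrite /klr_braid /braid_coef !tn /= ab.
  case: ifP => _; last by rewrite mul0r.
  case: ifP => [/ar ->|_]; first by rewrite subr0 mul1r.
  by case: ifP => _; rewrite sub0r ?mulN1r // oppr0 mul0r.
- move=> a l i; rewrite mulrBl -!mulrA (kl_sx like) // swap_pos_swapn addrAC subrr add0r.
  rewrite /klr_cross /cross_coef !tn -!val_eqE /=; case: ifP => _; last by rewrite mul0r.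
  case: (eqVneq (l : nat) a) => [->|la]; first by rewrite ltn_eqF // sub0r mulN1r.
  by case: eqP => _; rewrite subr0 ?mul1r ?mul0r.
Qed.

End ToKLRRel.

(** * Morphisms out of a KLR algebra *)

(** Inversion reverses the arrows of the quiver on I; with the reversal of words
    this makes the KLR relations symmetric. *)
Lemma arrowV (k : fieldType) (p y z : k) : p != 0 -> arrow p y^-1 z^-1 = arrow p z y.
Proof.
move=> p0; rewrite /arrow; have p2 : p ^+ 2 != 0 by rewrite expf_neq0.
have [->|y0] := eqVneq y 0.
  by rewrite invr0 mulr0 [0 == _]eq_sym mulf_eq0 (negbTE p2) invr_eq0.
have [->|z0] := eqVneq z 0.
  by rewrite invr0 mulr0 invr_eq0 [0 == _]eq_sym mulf_eq0 (negbTE p2).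
rewrite -(inj_eq (mulIf y0)) mulVf // -(inj_eq (mulfI z0)) mulr1.
by rewrite [X in _ == X]mulrA [z * _]mulrCA divff // mulr1.
Qed.

Definition revinv (k : fieldType) m (w : nat -> k) : nat -> k := fun l => (w (m.-1 - l)%N)^-1.

Section Flip.
Variables (k : fieldType) (p : k) (m : nat) (S : pzRingType).
Variables (x s : nat -> S) (E : (nat -> k) -> S).
Hypotheses (p0 : p != 0) (like : klr_like p m x s E).

Definition flip_x l : S := - x (m.-1 - l)%N.
Definition flip_s a : S := s (m - a.+2)%N.
Definition flip_e w : S := E (revinv m w).

(** Reversing and inverting words is an automorphism of the KLR relations: the
    reversal exchanges the two positions of a crossing and the inversion
    reverses the arrow between them; the sign in flip_x restores the
    right-hand sides. *)
Lemma flip_klr_like : klr_like p m flip_x flip_s flip_e.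
Proof.
have rl l : (l < m)%N -> (m.-1 - l < m)%N by lia.
split.
- by move=> w; exact: kl_EE like _.
- move=> w w' l lm ww; apply: (kl_E0 like (rl _ lm)).
  by rewrite /revinv subKn ?(inj_eq invr_inj) //; lia.
- by move=> w w' ww; apply: (kl_Eext like) => l lm; rewrite /revinv ww //; exact: rl.
- move=> a w am; rewrite /flip_s (kl_sE like); last by lia.
  congr (_ * _); apply: (kl_Eext like) => l lm; rewrite /revinv /swapf; congr (w _)^-1.
  by rewrite /swapn; do ?case: eqP; lia.
- by move=> l w lm; rewrite /flip_x mulNr (kl_xE like) ?rl // mulrN.
- by move=> l l' lm lm'; rewrite /flip_x !mulrN !mulNr (kl_xx like) ?rl.
- move=> a w am; rewrite /flip_s (kl_ss like); last by lia.
  congr (_ * _); rewrite /sqr_coef /revinv /flip_x.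
  have -> : (m.-1 - (m - a.+2) = a.+1)%N by lia.
  have -> : (m.-1 - (m - a.+2).+1 = a)%N by lia.
  have -> : (m.-1 - a.+1 = m - a.+2)%N by lia.
  have -> : (m.-1 - a = (m - a.+2).+1)%N by lia.
  rewrite (inj_eq invr_inj) eq_sym !arrowV //; case: eqP => // _.
  by rewrite !opprK !(addrC (- _)).
- by move=> a b ab bm; symmetry; apply: (kl_far like); lia.
- move=> a w am; rewrite /flip_s /flip_e.
  have -> : (m - a.+2 = (m - a.+3).+1)%N by lia.
  rewrite (kl_br like); last by lia.
  rewrite -[LHS]addr0 -addrA; congr (_ + _); rewrite -mulrDl /braid_coef /revinv.
  have -> : (m.-1 - (m - a.+3) = a.+2)%N by lia.
  have -> : (m.-1 - (m - a.+3).+1 = a.+1)%N by lia.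
  have -> : (m.-1 - (m - a.+3).+2 = a)%N by lia.
  rewrite (inj_eq invr_inj) eq_sym !arrowV //; case: eqP => [->|_].
    by rewrite -[X in _ + X]opprB subrr mul0r.
  by rewrite addr0 mul0r.
- move=> a l w am lm; rewrite /flip_s /flip_x /flip_e !(mulNr, mulrN).
  rewrite (kl_sx like) ?rl //; last by lia.
  have -> : swapn (m - a.+2) (m.-1 - l) = (m.-1 - swapn a l)%N.
    by rewrite /swapn; do ?case: eqP; lia.
  rewrite opprD; congr (_ + _); rewrite -mulNr; congr (_ * _).
  rewrite /cross_coef /revinv.
  have -> : (m.-1 - (m - a.+2) = a.+1)%N by lia.
  have -> : (m.-1 - (m - a.+2).+1 = a)%N by lia.
  rewrite (inj_eq invr_inj) eq_sym; case: ifP => _; last by rewrite oppr0.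
  have -> : ((m.-1 - l)%N == (m - a.+2).+1) = (l == a) by apply/eqP/eqP; lia.
  have -> : ((m.-1 - l)%N == (m - a.+2)%N) = (l == a.+1) by apply/eqP/eqP; lia.
  by rewrite opprB.
Qed.

End Flip.

(** Multiplicativity on products whose left factor is a generator suffices to keep
    the KLR relations. The map a |-> c a c has it when the generators commute with
    the idempotent c. *)
Section PartialMorphism.
Variables (k : fieldType) (p : k) (m : nat) (S S' : pzRingType).
Variables (x s : nat -> S) (E : (nat -> k) -> S) (f : {additive S -> S'}).
Hypothesis like : klr_like p m x s E.
Hypotheses (fx : forall l b, (l < m)%N -> f (x l * b) = f (x l) * f b).
Hypotheses (fs : forall a b, (a.+1 < m)%N -> f (s a * b) = f (s a) * f b).
Hypotheses (fE : forall w b, f (E w * b) = f (E w) * f b).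

Lemma partial_klr_like :
  klr_like p m (fun l => f (x l)) (fun a => f (s a)) (fun w => f (E w)).
Proof.
split.
- by move=> w; rewrite -fE (kl_EE like).
- by move=> w w' l lm ww; rewrite -fE (kl_E0 like lm ww) raddf0.
- by move=> w w' ww; rewrite (kl_Eext like ww).
- by move=> a w am; rewrite -fs // -fE (kl_sE like).
- by move=> l w lm; rewrite -fx // -fE (kl_xE like).
- by move=> l l' lm lm'; rewrite -!fx // (kl_xx like).
- move=> a w am; rewrite -!fs // (kl_ss like) // /sqr_coef.
  have ma : (a < m)%N by lia.
  case: ifP => _; first by rewrite !mul0r raddf0.
  by do ?case: ifP => _; rewrite ?mul1r // !mulrBl raddfB !fx.
- move=> a b ab bm; rewrite -!fs ?(kl_far like ab) //; lia.
- move=> a w am; have bm : (a.+1 < m)%N by lia.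
  rewrite -!fs // (kl_br like) // raddfD; congr (_ + _); rewrite /braid_coef.
  case: ifP => _; last by rewrite !mul0r raddf0.
  by case: arrow; case: arrow;
    rewrite ?(subrr, subr0, sub0r, mul0r, mul1r, mulN1r, raddf0, raddfN).
- move=> a l w am lm; have lm' : (swapn a l < m)%N by rewrite swapn_lt.
  rewrite -!fx // -!fs // -!fx // (kl_sx like) // raddfD; congr (_ + _).
  rewrite /cross_coef; case: ifP => _; last by rewrite !mul0r raddf0.
  by case: eqP => _; case: eqP => _;
    rewrite ?(subrr, subr0, sub0r, mul0r, mul1r, mulN1r, raddf0, raddfN).
Qed.

End PartialMorphism.

Section Restrict.
Variables (k : fieldType) (p : k) (m : nat) (nu : {fsfun k -> nat with 0%N}).
Local Notation J := (words p m nu).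
Variables (A : alg k) (x s : nat -> A) (E : (nat -> k) -> A).
Hypothesis like : klr_like p m x s E.
Hypotheses (p0 : p != 0) (p4 : p ^+ 4 != 1).

Lemma Iset_neq0 y : y \in Iset p -> y != 0.
Proof. by move/asboolP => [n ->]; rewrite expfz_neq0. Qed.

Lemma arrow_asym y z : y \in Iset p -> arrow p y z -> ~~ arrow p z y.
Proof.
move=> /Iset_neq0 y0 /eqP yz; apply: contra p4 => /eqP zy.
by rewrite -(inj_eq (mulIf y0)) mul1r {2}yz zy mulrA -exprD.
Qed.

Lemma words_arrow (i : m.-tuple k) y z : i \in J -> y \in i -> z \in i ->
  arrow p y z -> ~~ arrow p z y.
Proof. by case/mem_words => iI _ /iI yI _; exact: arrow_asym. Qed.

Definition words_sum : A := \sum_(i : J) E (nth 1 (val i)).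

Lemma words_sum_E w : words_sum * E w = if tupf m w \in J then E w else 0.
Proof.
have tup_neq (i : J) : tupf m w != val i ->
    exists2 l, (l < m)%N & nth 1 (val i) l != w l.
  move=> wi; have [l il] : exists l : 'I_m, nth 1 (val i) l != w l.
    apply/existsP; rewrite -negb_forall; apply: contra wi => /forallP iw.
    by apply/eqP/eq_from_tnth => l; rewrite tnth_mktuple (tnth_nth 1) (eqP (iw l)).
  by exists l.
rewrite /words_sum mulr_suml; case: ifP => [wJ|wJ].
  rewrite (bigD1 [` wJ]%fset) //= big1 ?addr0 => [|i iw].
    rewrite -[RHS](kl_EE like); congr (_ * _); apply: (kl_Eext like) => l lm.
    exact: nth_tupf.
  have [|l lm il] := tup_neq i; last exact: (@kl_E0 _ _ _ _ _ _ _ like (nth 1 (val i)) w l lm il).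
  by apply: contra iw => /eqP wi; apply/eqP/val_inj.
apply: big1 => i _; have [|l lm il] := tup_neq i; last exact: (@kl_E0 _ _ _ _ _ _ _ like (nth 1 (val i)) w l lm il).
by apply: contraFN wJ => /eqP->; exact: valP.
Qed.

Lemma E_words_sum w : E w * words_sum = words_sum * E w.
Proof.
rewrite /words_sum mulr_sumr mulr_suml; apply: eq_bigr => i _.
have [/existsP[l il]|] := boolP [exists l : 'I_m, nth 1 (val i) l != w l].
  rewrite (@kl_E0 _ _ _ _ _ _ _ like (nth 1 (val i)) w l) //.
    by rewrite (@kl_E0 _ _ _ _ _ _ _ like w (nth 1 (val i)) l) // eq_sym.
rewrite negb_exists => /forallP iw; rewrite (@kl_Eext _ _ _ _ _ _ _ like w (nth 1 (val i))) //.
by move=> l lm; have := iw (Ordinal lm); rewrite negbK => /eqP.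
Qed.

Lemma x_words_sum l : (l < m)%N -> x l * words_sum = words_sum * x l.
Proof.
by move=> lm; rewrite /words_sum mulr_sumr mulr_suml; apply: eq_bigr => i _; rewrite (kl_xE like).
Qed.

Lemma s_words_sum a : (a.+1 < m)%N -> s a * words_sum = words_sum * s a.
Proof.
move=> am; have am' : (a < m.-1)%N by lia.
pose h (i : J) : J := [` words_swap (Ordinal am') i]%fset.
have hK : involutive h.
  move=> i; apply: val_inj; apply: eq_from_tnth => l.
  by rewrite !tnth_mktuple /swap_pos tpermK.
rewrite /words_sum mulr_sumr mulr_suml [RHS](reindex_inj (inv_inj hK)).
apply: eq_bigr => i _; rewrite (kl_sE like) //; congr (_ * _).
apply: (kl_Eext like) => l lm; rewrite -[l]/(val (Ordinal lm)) -[in RHS]tnth_nth.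
by rewrite tnth_mktuple (tnth_nth 1) swap_pos_swapn.
Qed.

Fact words_sum_idem : words_sum * words_sum = words_sum.
Proof.
rewrite {2 3}/words_sum mulr_sumr; apply: eq_bigr => i _.
by rewrite words_sum_E tupf_nth (valP i).
Qed.

Definition words_idem : idem_elt A := IdemElt words_sum_idem.
Local Notation c := words_sum.

Fact cut_subproof a : (idem_val words_idem * (c * a * c) == c * a * c) &&
  (c * a * c * idem_val words_idem == c * a * c).
Proof. by rewrite /= !mulrA words_sum_idem -!mulrA words_sum_idem eqxx. Qed.
Definition cut (a : A) : corner_ring words_idem := CornerRing (cut_subproof a).

Fact cut_is_zmod_morphism : zmod_morphism cut.
Proof. by move=> a b; apply: val_inj; rewrite /= mulrBr mulrBl. Qed.
HB.instance Definition _ := GRing.isZmodMorphism.Build A _ cut cut_is_zmod_morphism.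

Lemma cutM a b : a * c = c * a -> cut (a * b) = cut a * cut b.
Proof.
move=> ac; apply: val_inj => /=.
have caE : c * a * c = c * a by rewrite -mulrA ac mulrA words_sum_idem.
by rewrite caE !mulrA caE.
Qed.

Let cut_like : klr_like p m (fun l => cut (x l)) (fun a => cut (s a)) (fun w => cut (E w)).
Proof.
apply: partial_klr_like => // [l b lm|a b am|w b]; apply: cutM.
- exact: x_words_sum.
- exact: s_words_sum.
- exact: E_words_sum.
Qed.

Let cut_e (i : J) : val (cut (E (nth 1 (val i)))) = E (nth 1 (val i)).
Proof.
by rewrite /= words_sum_E tupf_nth (valP i) E_words_sum words_sum_E tupf_nth (valP i).
Qed.

Let cut_e1 : \sum_(i : J) cut (E (nth 1 (val i))) = 1.
Proof.
apply: val_inj; rewrite (big_morph val (id1 := 0) (op1 := +%R)) //=.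
by apply: eq_bigr => i _; exact: cut_e.
Qed.

Definition klr_hom_gen (g : klr_gen m J) : corner_alg words_idem :=
  match g with
  | KLR_x l => cut (x l) | KLR_s a => cut (s a) | KLR_e i => cut (E (nth 1 (val i)))
  end.

Let klr_hom_rel u v : KLR_rel u v -> free_lift klr_hom_gen u = free_lift klr_hom_gen v.
Proof.
move=> /(klr_rel_map (f := free_lift klr_hom_gen) (fun l => free_lift_gen _ _)
  (fun a => free_lift_gen _ _) (fun i => free_lift_gen _ _)).
exact: (klr_like_rel cut_like cut_e1 words_arrow).
Qed.

(** A family with the KLR relations in A, in which the idempotents of words m nu
    need not sum to 1, yields a morphism to the corner of their sum c, and thus a
    morphism to A that maps 1 to c. *)
Definition klr_hom (r : KLR p m nu) : A := val (presented_lift klr_hom_gen r).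

Lemma klr_homD r t : klr_hom (r + t) = klr_hom r + klr_hom t.
Proof. by rewrite /klr_hom presented_liftD. Qed.
Lemma klr_homM r t : klr_hom (r * t) = klr_hom r * klr_hom t.
Proof. by rewrite /klr_hom presented_liftM. Qed.
Lemma klr_hom_scalar a : klr_hom (alg_scalar (KLR p m nu) a) = alg_scalar A a * c.
Proof. by rewrite /klr_hom presented_lift_scalar. Qed.
Lemma klr_hom1 : klr_hom 1 = c.
Proof. by rewrite -(rmorph1 (alg_scalar (KLR p m nu))) klr_hom_scalar rmorph1 mul1r. Qed.
Lemma klr_hom_x l : klr_hom (klr_x p nu l) = x l * c.
Proof.
by rewrite /klr_hom presented_lift_gen //= -x_words_sum // -mulrA words_sum_idem.
Qed.
Lemma klr_hom_s (a : 'I_m.-1) : klr_hom (klr_s p nu a) = s a * c.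
Proof.
rewrite /klr_hom presented_lift_gen //= -s_words_sum; last by case: a => a /=; lia.
by rewrite -mulrA words_sum_idem.
Qed.
Lemma klr_hom_e (i : J) : klr_hom (klr_e i) = E (nth 1 (val i)).
Proof. by rewrite /klr_hom presented_lift_gen // cut_e. Qed.

End Restrict.

(** * Straightening words *)

Definition invhead (k : fieldType) (w : nat -> k) : nat -> k :=
  fun l => if l == 0%N then (w 0%N)^-1 else w l.

Section Weights.
Variables (k : fieldType) (p : k) (m : nat) (S : pzRingType).
Variables (x s : nat -> S) (E : (nat -> k) -> S).

(** Relations that hold only after multiplication by an idempotent can be applied
    to an element of the weight space e(w) S. *)
Definition wt w u := E w * u = u.

Lemma wtE w u : wt w u = (E w * u = u). Proof. by []. Qed.

Hypothesis kl : klr_like p m x s E.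

Lemma wt_E w : wt w (E w). Proof. exact: kl_EE kl _. Qed.
Lemma wt_EM w u : wt w (E w * u). Proof. by rewrite /wt mulrA (kl_EE kl). Qed.
Lemma wt_ext w w' u : (forall l, (l < m)%N -> w l = w' l) -> wt w u -> wt w' u.
Proof. by move=> ww; rewrite /wt (kl_Eext kl ww). Qed.
Lemma wt_s a w u : (a.+1 < m)%N -> wt w u -> wt (swapf a w) (s a * u).
Proof. by move=> am wu; rewrite /wt mulrA -(kl_sE kl) // -mulrA wu. Qed.
Lemma wt_x l w u : (l < m)%N -> wt w u -> wt w (x l * u).
Proof. by move=> lm wu; rewrite /wt mulrA -(kl_xE kl) // -mulrA wu. Qed.

Lemma s_far a b u : (a.+1 < b)%N -> (b.+1 < m)%N -> s a * (s b * u) = s b * (s a * u).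
Proof. by move=> ab bm; rewrite !mulrA (kl_far kl). Qed.

Lemma sqr_at w a u : wt w u -> (a.+1 < m)%N ->
  s a * (s a * u) = sqr_coef p x a w * u.
Proof.
by move=> wu am; have := congr1 ( *%R^~ u) (kl_ss kl w am); rewrite -!mulrA wu.
Qed.

Lemma braid_at w a u : wt w u -> (a.+2 < m)%N ->
  s a.+1 * (s a * (s a.+1 * u)) = s a * (s a.+1 * (s a * u)) + braid_coef p S a w * u.
Proof.
move=> wu am; have := congr1 ( *%R^~ u) (kl_br kl w am).
by rewrite mulrDl -!mulrA wu.
Qed.

Lemma cross_at w a l u : wt w u -> (a.+1 < m)%N -> (l < m)%N ->
  s a * (x l * u) = x (swapn a l) * (s a * u) + cross_coef S a l w * u.
Proof.
move=> wu am lm; have := congr1 ( *%R^~ u) (kl_sx kl w am lm).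
by rewrite mulrDl -!mulrA wu.
Qed.

Lemma cross_far w a l u : wt w u -> (a.+1 < m)%N -> (l < m)%N -> l != a -> l != a.+1 ->
  s a * (x l * u) = x l * (s a * u).
Proof.
move=> wu am lm la la1; rewrite (cross_at wu) // /cross_coef /swapn.
rewrite (negbTE la) (negbTE la1) subrr; case: ifP => _; by rewrite mul0r addr0.
Qed.

End Weights.

Section VVLike.
Variables (k : fieldType) (p : k) (m : nat) (S : pzRingType).

Record vv_like (x s : nat -> S) (E : (nat -> k) -> S) (pi : S) : Prop := VVLike {
  vl_klr : klr_like p m x s E;
  vl_pE : forall w, pi * E w = E (invhead w) * pi;
  vl_pp : pi * pi = 1;
  vl_px0 : (0 < m)%N -> pi * x 0%N = - x 0%N * pi;
  vl_px : forall l, (0 < l)%N -> (l < m)%N -> pi * x l = x l * pi;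
  vl_sp : (1 < m)%N ->
    s 0%N * (pi * (s 0%N * pi)) = pi * (s 0%N * (pi * s 0%N));
  vl_ps : forall a, (0 < a)%N -> (a.+1 < m)%N -> pi * s a = s a * pi
}.

End VVLike.

(** Words are split into positive and negative letters by pos, and special is meant
    for p and p^-1. The hypotheses say that opposite signs are joined by an arrow
    only from a positive to a negative special letter, and that no good word has
    three special letters. *)
Section Straighten.
Variables (k : fieldType) (p : k) (m : nat) (S : pzRingType).
Variables (x s : nat -> S) (E : (nat -> k) -> S) (pi : S).
Hypothesis like : vv_like p m x s E pi.

Variables (good : (nat -> k) -> Prop) (pos special : pred k).
Hypothesis good_swap : forall a w, (a.+1 < m)%N -> good w -> good (swapf a w).
Hypothesis good_invhead : forall w, good w -> good (invhead w).
Hypothesis posV : forall w l, good w -> (l < m)%N -> pos (w l)^-1 = ~~ pos (w l).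
Hypothesis arrow_mixed : forall w l l', good w -> (l < m)%N -> (l' < m)%N ->
  pos (w l) != pos (w l') ->
  arrow p (w l) (w l') = [&& pos (w l), special (w l) & special (w l')].
Hypothesis spec3 : forall w l1 l2 l3, good w -> (l1 < l2)%N -> (l2 < l3)%N -> (l3 < m)%N ->
  special (w l1) -> special (w l2) -> special (w l3) -> False.
Hypothesis specV : forall y, special y^-1 = special y.

Let kl := vl_klr like.

Local Notation wt := (wt E).
Let wt_s := @wt_s _ _ _ _ _ _ _ kl.
Let wt_x := @wt_x _ _ _ _ _ _ _ kl.
Let s_far := @s_far _ _ _ _ _ _ _ kl.
Let cross_at := @cross_at _ _ _ _ _ _ _ kl.
Let cross_far := @cross_far _ _ _ _ _ _ _ kl.

Lemma wt_pi w u : wt w u -> wt (invhead w) (pi * u).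
Proof. by move=> wu; rewrite /wt mulrA -(vl_pE like) -mulrA wu. Qed.
Lemma pipi u : pi * (pi * u) = u.
Proof. by rewrite mulrA (vl_pp like) mul1r. Qed.
Lemma pi_s a u : (0 < a)%N -> (a.+1 < m)%N -> pi * (s a * u) = s a * (pi * u).
Proof. by move=> a0 am; rewrite !mulrA (vl_ps like). Qed.
Lemma pi_x l u : (0 < l)%N -> (l < m)%N -> pi * (x l * u) = x l * (pi * u).
Proof. by move=> l0 lm; rewrite !mulrA (vl_px like). Qed.
Lemma pi_x0 u : (0 < m)%N -> pi * (x 0%N * u) = - x 0%N * (pi * u).
Proof. by move=> m0; rewrite !mulrA (vl_px0 like). Qed.
Lemma sqr_mixed w a u : good w -> wt w u -> (a.+1 < m)%N -> pos (w a) != pos (w a.+1) ->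
  s a * (s a * u) =
  (if special (w a) && special (w a.+1)
   then if pos (w a) then x a - x a.+1 else x a.+1 - x a else 1) * u.
Proof.
move=> gw wu am pa; rewrite (sqr_at kl wu) // /sqr_coef; have am' : (a < m)%N by lia.
rewrite ifN; last by apply: contra pa => /eqP->.
rewrite !arrow_mixed // 1?eq_sym //.
move: pa; case: (pos (w a)); case: (pos (w a.+1)) => //= _.
by rewrite andbC.
Qed.

(** The correction of a braid relation is present for i_a = i_(a+2) joined to
    i_(a+1) by an arrow; for mixed signs all three letters would be special. *)
Lemma braid_coef_mixed (S' : pzRingType) w a : good w -> (a.+2 < m)%N ->
  ~~ ((pos (w a) == pos (w a.+1)) && (pos (w a) == pos (w a.+2))) ->
  braid_coef p S' a w = 0.
Proof.
move=> gw am mix; rewrite /braid_coef; case: eqP => // w2.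
rewrite -w2 eqxx andbT in mix.
have am' : (a < m)%N by lia.
have am1 : (a.+1 < m)%N by lia.
have sp : special (w a) && special (w a.+1) = false.
  apply/negP => /andP[s0 s1].
  by apply: (@spec3 w a a.+1 a.+2) => //; rewrite -w2.
by rewrite !arrow_mixed // 1?eq_sym // sp (andbC (special _)) sp !andbF subrr.
Qed.

Lemma braid_mixed w a u : good w -> wt w u -> (a.+2 < m)%N ->
  ~~ ((pos (w a) == pos (w a.+1)) && (pos (w a) == pos (w a.+2))) ->
  s a.+1 * (s a * (s a.+1 * u)) = s a * (s a.+1 * (s a * u)).
Proof.
by move=> gw wu am mix; rewrite (braid_at kl wu) // braid_coef_mixed // mul0r addr0.
Qed.

Lemma cross_mixed w a l u : wt w u -> (a.+1 < m)%N -> (l < m)%N ->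
  pos (w a) != pos (w a.+1) -> s a * (x l * u) = x (swapn a l) * (s a * u).
Proof.
move=> wu am lm pa; rewrite (cross_at wu) // /cross_coef ifN ?mul0r ?addr0 //.
by apply: contra pa => /eqP->.
Qed.

(** ** Moving one letter to the front and inverting it *)

Fixpoint to_front n : S := if n is n'.+1 then to_front n' * s n' else 1.
Fixpoint from_front n : S := if n is n'.+1 then s n' * from_front n' else 1.
Definition turn n : S := pi * to_front n.
Definition unturn n : S := from_front n * pi.

Definition rotw n (w : nat -> k) : nat -> k :=
  fun l => if l == 0%N then w n else if (l <= n)%N then w l.-1 else w l.
Definition turnw n (w : nat -> k) : nat -> k := invhead (rotw n w).

Lemma rotw0 w : rotw 0 w = w.
Proof. by apply/funext => l; rewrite /rotw leqn0; case: eqP => [->|]. Qed.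

Lemma rotw_swap n w : rotw n (swapf n w) = rotw n.+1 w.
Proof.
apply/funext => l; rewrite /rotw /swapf /swapn; do ?case: eqP; do ?case: ifP => //=; try lia.
all: move=> *; congr w; lia.
Qed.

Lemma to_front_S n u : to_front n.+1 * u = to_front n * (s n * u).
Proof. by rewrite /= mulrA. Qed.
Lemma from_front_S n u : from_front n.+1 * u = s n * (from_front n * u).
Proof. by rewrite /= mulrA. Qed.
Lemma turnE n u : turn n * u = pi * (to_front n * u).
Proof. by rewrite /turn mulrA. Qed.
Lemma turn_S n u : turn n.+1 * u = turn n * (s n * u).
Proof. by rewrite !turnE to_front_S. Qed.

Lemma wt_to_front n w u : (n < m)%N -> wt w u -> wt (rotw n w) (to_front n * u).
Proof.
elim: n w u => [|n IHn] w u nm wu; first by rewrite rotw0 mul1r.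
rewrite to_front_S -rotw_swap; apply: IHn; first by lia.
exact: wt_s.
Qed.

Lemma wt_turn n w u : (n < m)%N -> wt w u -> wt (turnw n w) (turn n * u).
Proof. by move=> nm wu; rewrite turnE; apply/wt_pi/wt_to_front. Qed.

Lemma good_rotw n w : (n < m)%N -> good w -> good (rotw n w).
Proof.
elim: n w => [|n IHn] w nm gw; first by rewrite rotw0.
by rewrite -rotw_swap; apply: IHn; [lia | exact: good_swap].
Qed.

Lemma good_turnw n w : (n < m)%N -> good w -> good (turnw n w).
Proof. by move=> nm gw; apply/good_invhead/good_rotw. Qed.

Lemma to_front_far n a u : (n < a)%N -> (a.+1 < m)%N ->
  to_front n * (s a * u) = s a * (to_front n * u).
Proof.
elim: n u => [|n IHn] u na am; first by rewrite !mul1r.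
by rewrite !to_front_S s_far // IHn // ltnW.
Qed.

Lemma turn_far n a u : (n < a)%N -> (a.+1 < m)%N -> turn n * (s a * u) = s a * (turn n * u).
Proof. by move=> na am; rewrite !turnE to_front_far // pi_s //; lia. Qed.

Definition opposed w n := forall l, (l < n)%N -> pos (w l) != pos (w n).

Lemma opposed_swap w n : opposed w n.+1 -> opposed (swapf n w) n.
Proof.
move=> ow l ln; rewrite /swapf /swapn eqxx !ifN ?ow //; by [apply/eqP; lia | lia].
Qed.

Lemma turn_x_gt n l w u : wt w u -> (n < l)%N -> (l < m)%N ->
  turn n * (x l * u) = x l * (turn n * u).
Proof.
move=> wu nl lm; rewrite !turnE.
suff -> : to_front n * (x l * u) = x l * (to_front n * u) by rewrite pi_x //; lia.
elim: n w u wu nl => [|n IHn] w u wu nl; first by rewrite !mul1r.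
rewrite !to_front_S (cross_far wu); try lia.
by apply: (IHn (swapf n w)); [apply: wt_s => //|]; lia.
Qed.

Lemma turn_x_n n w u : wt w u -> (n < m)%N -> opposed w n ->
  turn n * (x n * u) = - x 0%N * (turn n * u).
Proof.
elim: n w u => [|n IHn] w u wu nm ow; first by rewrite !turnE !mul1r pi_x0.
rewrite !turn_S (cross_mixed wu) ?ow // /swapn eqxx ifN; last by apply/eqP; lia.
by apply: (IHn (swapf n w)); [exact: wt_s | lia | exact: opposed_swap].
Qed.

Lemma turn_x_lt n l w u : wt w u -> (l < n)%N -> (n < m)%N -> opposed w n ->
  turn n * (x l * u) = x l.+1 * (turn n * u).
Proof.
elim: n w u => [|n IHn] w u wu // ln nm ow; have wsu := wt_s nm wu.
rewrite !turn_S (cross_mixed wu) ?ow //; last by lia.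
rewrite leq_eqVlt ltnS in ln; rewrite /swapn; case/orP: ln => [/eqP[->]|ln].
  by rewrite eqxx (turn_x_gt wsu).
rewrite !ifN; try by apply/eqP; lia.
by apply: (IHn _ _ wsu) => //; [lia | exact: opposed_swap].
Qed.

(** A crossing of two letters that are turned past moves up by one position: this is
    the braid relation, which has no correction as the turned letter has the
    opposite sign. *)
Lemma turn_s_lt n a w u : good w -> wt w u -> (a.+1 < n)%N -> (n < m)%N -> opposed w n ->
  turn n * (s a * u) = s a.+1 * (turn n * u).
Proof.
elim: n w u => [|n IHn] w u gw wu // an nm ow.
rewrite leq_eqVlt ltnS in an; case/orP: an => [/eqP[an]|an].
  rewrite -an in nm ow *; rewrite !turn_S -(braid_mixed gw wu) //.
    by rewrite turn_far //; lia.
  by rewrite andbC (negbTE (ow a _)).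
rewrite !turn_S -s_far // (IHn (swapf n w)) //.
- exact: good_swap.
- exact: wt_s.
- lia.
- exact: opposed_swap.
Qed.

(** Turning two neighbours of equal sign carries their crossing to the front, where
    it becomes sigma_1: for n = 0 this is the relation of type B between sigma_1
    and pi. *)
Lemma turn_pair n w u : good w -> wt w u -> (n.+1 < m)%N -> opposed w n ->
  pos (w n) = pos (w n.+1) ->
  turn n.+1 * (turn n * (s n * u)) = s 0%N * (turn n.+1 * (turn n * u)).
Proof.
elim: n w u => [|n IHn] w u gw wu nm ow pn.
  rewrite !turn_S !turnE !mul1r.
  by have := congr1 ( *%R^~ u) (vl_sp like nm); rewrite -!mulrA.
have rec v : turn n.+2 * (turn n.+1 * v) = turn n.+1 * (turn n * (s n.+1 * (s n * v))).
  by rewrite !turn_S (@turn_far n n.+1).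
have wt1 := wt_s nm wu; rewrite !rec.
have pn1 : pos (w n.+1) != pos (w n) by rewrite eq_sym ow.
rewrite (braid_mixed gw wu) //; last by rewrite (negbTE (ow n _)).
rewrite (IHn (swapf n.+1 (swapf n w))) //.
- by apply/good_swap => //; apply: good_swap => //; lia.
- by apply: wt_s => //; apply: wt_s => //; lia.
- lia.
- move=> l ln; rewrite /swapf.
  have -> : swapn n (swapn n.+1 l) = l by rewrite /swapn; do ?case: eqP; lia.
  have -> : swapn n (swapn n.+1 n) = n.+1 by rewrite /swapn; do ?case: eqP; lia.
  by apply: ow; lia.
- rewrite /swapf.
  have -> : swapn n (swapn n.+1 n) = n.+1 by rewrite /swapn; do ?case: eqP; lia.
  by have -> : swapn n (swapn n.+1 n.+1) = n.+2 by rewrite /swapn; do ?case: eqP; lia.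
Qed.

Lemma unturn_turn n u : unturn n * (turn n * u) = from_front n * (to_front n * u).
Proof. by rewrite turnE /unturn -!mulrA pipi. Qed.

(** Moving a letter to the front past letters of the other sign and back is a
    product of squares of crossings of mixed signs, each of which is 1 unless
    both letters are special. *)
Lemma undo_nospec n w u : good w -> wt w u -> (n < m)%N -> opposed w n ->
  (forall l, (l < n)%N -> ~~ (special (w l) && special (w n))) ->
  from_front n * (to_front n * u) = u.
Proof.
elim: n w u => [|n IHn] w u gw wu nm ow nospec; first by rewrite !mul1r.
rewrite from_front_S to_front_S (IHn (swapf n w)).
- by rewrite (sqr_mixed gw wu) ?ow // (negbTE (nospec n _)) // mul1r.
- exact: good_swap.
- exact: wt_s.
- lia.
- exact: opposed_swap.
- move=> l ln; rewrite /swapf.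
  have -> : swapn n l = l by rewrite /swapn; do ?case: eqP; lia.
  by rewrite /swapn eqxx nospec // ltnW.
Qed.

(** Exactly one of the crossings involves two special letters; its square is the
    difference of the x at these letters, and the other crossings carry it to
    the positions l and n. *)
Lemma undo_spec n l w u : good w -> wt w u -> (l < n)%N -> (n < m)%N -> opposed w n ->
  special (w l) -> special (w n) ->
  from_front n * (to_front n * u) = (if pos (w l) then x l - x n else x n - x l) * u.
Proof.
elim: n w u => [|n IHn] w u gw wu // ln nm ow sl sn.
have wt1 := wt_s nm wu; have gw1 := good_swap nm gw.
have ow1 := opposed_swap ow; have nm1 := ltnW nm.
rewrite from_front_S to_front_S.
rewrite leq_eqVlt ltnS in ln; case/orP: ln => [/eqP[ln]|ln].
  rewrite ln in sl *; rewrite (undo_nospec gw1 wt1) //.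
    by rewrite (sqr_mixed gw wu) ?ow // sl sn.
  move=> l' ln'; rewrite /swapf.
  have -> : swapn n l' = l' by rewrite /swapn; do ?case: eqP; lia.
  rewrite /swapn eqxx; apply/negP => /andP[sl' _].
  exact: (@spec3 w l' n n.+1).
rewrite (IHn _ _ gw1 wt1) // /swapf; last by rewrite /swapn eqxx.
  have swl : swapn n l = l by rewrite /swapn; do ?case: eqP; lia.
  have cr i : (i < m)%N -> s n * (x i * (s n * u)) = x (swapn n i) * (s n * (s n * u)).
    move=> im; apply: (cross_mixed wt1) => //.
    rewrite /swapf; have -> : swapn n n = n.+1 by rewrite /swapn eqxx.
    have -> : swapn n n.+1 = n by rewrite /swapn eqxx ifN //; apply/eqP; lia.
    by rewrite eq_sym ow.
  have sq : s n * (s n * u) = u.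
    rewrite (sqr_mixed gw wu) ?ow // ifN ?mul1r //; apply/negP => /andP[s1 _].
    exact: (@spec3 w l n n.+1).
  have swn : swapn n n = n.+1 by rewrite /swapn eqxx.
  rewrite swl; case: ifP => _; rewrite !mulrBl mulrBr !cr ?sq ?swl ?swn //; lia.
by have -> : swapn n l = l by rewrite /swapn; do ?case: eqP; lia.
Qed.

(** ** Turning all letters of the wrong sign *)

Section Target.
Variable b : bool.

Definition bad y := pos y != b.

(** The product of the turns of the bad letters of w, leftmost first. After the
    letters before position n are treated they all have the sign b, so the next bad
    letter passes letters of the opposite sign only. *)
Fixpoint straight n (w : nat -> k) : S :=
  if n is n'.+1
  then if bad (w n') then turn n' * straight n' w else straight n' w else 1.
Fixpoint straightw n (w : nat -> k) : nat -> k :=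
  if n is n'.+1
  then if bad (w n') then turnw n' (straightw n' w) else straightw n' w else w.

Definition bads (w : nat -> k) a n : nat := \sum_(a <= i < n) bad (w i).

Lemma straight_ext n w w' : (forall l, (l < n)%N -> bad (w l) = bad (w' l)) ->
  straight n w = straight n w'.
Proof.
elim: n => //= n IHn ww; rewrite ww // IHn // => l ln; apply: ww; exact: ltnW.
Qed.

Lemma straightw_ge n w l : (n <= l)%N -> straightw n w l = w l.
Proof.
elim: n => //= n IHn nl; case: ifP => _; last by rewrite IHn // ltnW.
by rewrite /turnw /invhead /rotw !ifN ?IHn //; by [rewrite ltnW | apply/eqP; lia | lia].
Qed.

Lemma good_straightw n w : (n <= m)%N -> good w -> good (straightw n w).
Proof.
elim: n => //= n IHn nm gw; have gn := IHn (ltnW nm) gw.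
by case: ifP => _ //; exact: good_turnw.
Qed.

Lemma straightw_lt n w l : (n <= m)%N -> good w -> (l < n)%N -> ~~ bad (straightw n w l).
Proof.
elim: n l => //= n IHn l nm gw ln.
case: ifP => bn; last first.
  rewrite leq_eqVlt ltnS in ln; case/orP: ln => [/eqP[->]|ln]; last by rewrite IHn // ltnW.
  by rewrite straightw_ge // bn.
rewrite /turnw /invhead /rotw; case: (eqVneq l 0%N) => [_|l0].
  rewrite /bad /= (posV (good_straightw (ltnW nm) gw) nm) straightw_ge //.
  by move: bn; rewrite /bad; case: pos; case: b.
by rewrite ifT ?IHn //; lia.
Qed.

Lemma opposed_straightw n w : (n < m)%N -> good w -> bad (w n) -> opposed (straightw n w) n.
Proof.
move=> nm gw bn l ln; have := @straightw_lt n w l (ltnW nm) gw ln.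
rewrite (straightw_ge w (leqnn n)); move: bn; rewrite /bad.
by case: pos; case: pos; case: b.
Qed.

Lemma wt_straight n w u : (n <= m)%N -> wt w u -> wt (straightw n w) (straight n w * u).
Proof.
elim: n => [|n IHn] nm wu /=; first by rewrite mul1r.
have ws := IHn (ltnW nm) wu.
by case: ifP => _ //; rewrite -mulrA; apply: wt_turn.
Qed.

Lemma straight_S n w u : straight n.+1 w * u =
  if bad (w n) then turn n * (straight n w * u) else straight n w * u.
Proof. by rewrite /=; case: ifP => _; rewrite ?mulrA. Qed.

Lemma bads_S w a n : (a <= n)%N -> bads w a n.+1 = (bads w a n + bad (w n))%N.
Proof. by move=> an; rewrite /bads big_nat_recr. Qed.

Lemma bads_le w a n : (bads w a n <= n - a)%N.
Proof.
rewrite /bads -[X in (_ <= X)%N]muln1 -sum_nat_const_nat.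
by apply: leq_sum => i _; case: bad.
Qed.

Lemma straight_x_ge n l w u : (n <= l)%N -> (l < m)%N -> wt w u ->
  straight n w * (x l * u) = x l * (straight n w * u).
Proof.
move=> + lm wu; elim: n => [|n IHn] nl; first by rewrite !mul1r.
rewrite !(straight_S n).
rewrite (IHn (ltnW nl)).
case: ifP => [_|_]; last by [].
by apply: (@turn_x_gt _ _ (straightw n w)) => //; apply: wt_straight => //; lia.
Qed.

(** A bad letter goes to the front, and every bad letter after position l pushes
    the letter by one position to the right. *)
Lemma straight_x n l w u : (l < n)%N -> (n <= m)%N -> good w -> wt w u ->
  straight n w * (x l * u) =
  (-1) ^+ bad (w l) * x ((if bad (w l) then 0 else l) + bads w l.+1 n)%N
    * (straight n w * u).
Proof.
move=> ln + gw wu; elim: n ln => [|n IHn] // ln nm.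
have nm' := ltnW nm; rewrite !(straight_S n).
rewrite leq_eqVlt ltnS in ln; case/orP: ln => [/eqP[ln]|ln].
  subst n; rewrite straight_x_ge // /bads big_geq // addn0.
  case: ifP => bl; last by rewrite expr0 mul1r.
  rewrite expr1 mulN1r; apply: (@turn_x_n _ (straightw l w)) => //.
    exact: wt_straight.
  exact: opposed_straightw.
rewrite IHn // bads_S //; case: ifP => bn; last by rewrite addn0.
rewrite addn1 addnS -[X in turn n * X]mulrA -[RHS]mulrA.
have -> v : turn n * ((-1) ^+ bad (w l) * v) = (-1) ^+ bad (w l) * (turn n * v).
  by case: bad; rewrite ?mul1r // !mulN1r mulrN.
congr (_ * _); apply: (@turn_x_lt _ _ (straightw n w)) => //.
- exact: wt_straight.
- have := bads_le w l.+1 n; case: ifP => _; lia.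
- exact: opposed_straightw.
Qed.

Lemma straight_s_ge n a w u : (n <= a)%N -> (a.+1 < m)%N ->
  straight n w * (s a * u) = s a * (straight n w * u).
Proof.
move=> + am; elim: n => [|n IHn] nl; first by rewrite !mul1r.
by rewrite !(straight_S n) IHn ?(ltnW nl) //; case: ifP => // _; rewrite turn_far.
Qed.

Let straight_swap_le n a w : (n <= a)%N -> straight n (swapf a w) = straight n w.
Proof.
move=> na; apply: straight_ext => l ln; rewrite /swapf.
by have -> : swapn a l = l by rewrite /swapn; do ?case: eqP; lia.
Qed.

Let swap_l a (w : nat -> k) : swapf a w a = w a.+1. Proof. by rewrite /swapf /swapn eqxx. Qed.
Let swap_r a (w : nat -> k) : swapf a w a.+1 = w a.
Proof. by rewrite /swapf /swapn eqxx ifN //; apply/eqP; lia. Qed.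
Let swap_gt a (w : nat -> k) n : (a.+1 < n)%N -> swapf a w n = w n.
Proof. by move=> an; rewrite /swapf /swapn !ifN //; apply/eqP; lia. Qed.

Lemma straight_s_same n a w u : (a.+1 < n)%N -> (n <= m)%N -> good w -> wt w u ->
  bad (w a) = bad (w a.+1) ->
  straight n (swapf a w) * (s a * u) =
  s ((if bad (w a) then 0 else a) + bads w a.+2 n)%N * (straight n w * u).
Proof.
move=> an + gw wu ba; elim: n an => [|n IHn] // an nm.
have nm' := ltnW nm.
rewrite leq_eqVlt ltnS in an; case/orP: an => [/eqP[an]|an]; last first.
  rewrite !(straight_S n) IHn // swap_gt // bads_S //.
  case: ifP => bn; last by rewrite addn0.
  rewrite addn1 addnS; apply: (@turn_s_lt _ _ (straightw n w)).
  - exact: good_straightw.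
  - exact: wt_straight.
  - have := bads_le w a.+2 n; case: ifP => _; lia.
  - by [].
  - exact: opposed_straightw.
rewrite -an in nm nm' *; have am := ltnW nm'.
rewrite !(straight_S a.+1) !(straight_S a) swap_l swap_r -ba straight_swap_le // straight_s_ge //.
rewrite /bads big_geq // addn0; case bl: (bad (w a)) => //.
apply: (@turn_pair _ (straightw a w)) => //.
- exact: good_straightw.
- exact: wt_straight.
- by apply: opposed_straightw; rewrite // ltnW.
- rewrite !straightw_ge //; move: ba bl; rewrite /bad.
  by case: pos; case: pos; case: b.
Qed.

(** Crossing a bad letter with the good letter before it is what the straightening
    of w does anyway. *)
Lemma straight_s_mixed n a w u : (a.+1 < n)%N -> (n <= m)%N ->
  ~~ bad (w a) -> bad (w a.+1) ->
  straight n (swapf a w) * (s a * u) = straight n w * u.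
Proof.
move=> an + ba ba1; elim: n an => [|n IHn] // an nm.
rewrite leq_eqVlt ltnS in an; case/orP: an => [/eqP[an]|an]; last first.
  by rewrite !(straight_S n) IHn // ?swap_gt // ltnW.
rewrite -an in nm *; rewrite !(straight_S a.+1) !(straight_S a) swap_l swap_r ba1 (negbTE ba) straight_swap_le //.
by rewrite straight_s_ge // turn_S.
Qed.

Lemma straight_pi n w u : (0 < n)%N -> (n <= m)%N -> good w ->
  straight n (invhead w) * (pi * u) = straight n w * u.
Proof.
move=> + + gw; elim: n => [|[|n] IHn] // _ nm; last first.
  by rewrite !(straight_S n.+1) IHn // ltnW.
rewrite !(straight_S 0) /bad /invhead eqxx posV // !mul1r /turn /= mulr1.
by case: pos; case: b; rewrite //= pipi.
Qed.

Lemma straight_nobad n w : (forall l, (l < n)%N -> ~~ bad (w l)) -> straight n w = 1.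
Proof.
elim: n => //= n IHn bw; rewrite (negbTE (bw n (ltnSn n))) IHn // => l ln.
exact/bw/ltnW.
Qed.

Lemma spec_straightw n w l : (l < n)%N ->
  exists2 l', (l' < n)%N & special (straightw n w l) = special (w l').
Proof.
elim: n l => // n IHn l ln /=.
have up l1 : (l1 < n)%N ->
    exists2 l', (l' < n.+1)%N & special (straightw n w l1) = special (w l').
  by move=> /IHn[l' ln' El]; exists l'; first exact: ltnW.
case: ifP => bn; last first.
  move: ln; rewrite leq_eqVlt ltnS => /orP[/eqP[->]|]; last exact: up.
  by exists n; rewrite ?straightw_ge.
rewrite /turnw /invhead /rotw; case: eqP => [_|/eqP l0].
  by exists n; rewrite // specV straightw_ge.
by rewrite ifT; [apply: up; lia | lia].
Qed.

(** A turn can fail to be invertible only if a special letter is turned past the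
    other special letter. *)
Lemma straight_inv n w : (n <= m)%N -> good w ->
  (forall l l', (l < l')%N -> (l' < n)%N -> bad (w l') -> ~~ (special (w l) && special (w l'))) ->
  exists S', forall u, wt w u -> S' * (straight n w * u) = u.
Proof.
elim: n => [|n IHn] nm gw free; first by exists 1 => u _; rewrite !mul1r.
have [|S' SE] := IHn (ltnW nm) gw; first by move=> l l' ll ln; apply: free => //; exact: ltnW.
case bn: (bad (w n)); last by exists S' => u wu; rewrite (straight_S n) bn SE.
exists (S' * unturn n) => u wu; rewrite (straight_S n) bn -mulrA unturn_turn.
rewrite (@undo_nospec n (straightw n w)) ?SE //.
- exact: good_straightw (ltnW nm) gw.
- exact: wt_straight (ltnW nm) wu.
- exact: opposed_straightw.
- move=> l ln; have [l' ln' ->] := spec_straightw w ln.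
  by rewrite straightw_ge // free.
Qed.

End Target.

(** ** Turning every letter *)

Fixpoint full_turn n : S := if n is n'.+1 then turn n' * full_turn n' else 1.
Fixpoint full_unturn n : S := if n is n'.+1 then full_unturn n' * unturn n' else 1.

Lemma straight_full b n w : (forall l, (l < n)%N -> bad b (w l)) ->
  straight b n w = full_turn n.
Proof. by elim: n => //= n IHn bw; rewrite bw // IHn // => l ln; apply/bw/ltnW. Qed.

Lemma full_turn_S n u : full_turn n.+1 * u = turn n * (full_turn n * u).
Proof. by rewrite /= mulrA. Qed.
Lemma full_unturn_S n u : full_unturn n.+1 * u = full_unturn n * (unturn n * u).
Proof. by rewrite /= mulrA. Qed.
Lemma unturn_S n u : unturn n.+1 * u = s n * (unturn n * u).
Proof. by rewrite /unturn /= !mulrA. Qed.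

Lemma full_turn_far n a u : (n <= a)%N -> (a.+1 < m)%N ->
  full_turn n * (s a * u) = s a * (full_turn n * u).
Proof.
move=> + am; elim: n u => [|n IHn] u nl; first by rewrite !mul1r.
rewrite !full_turn_S (IHn _ (ltnW nl)).
by apply: turn_far.
Qed.

(** The full turn is a reduced word of the longest element of type B, which is an
    involution; the commutation of distant generators suffices to reverse it. *)
Lemma full_turn_rev n : (n <= m)%N -> full_turn n = full_unturn n.
Proof.
suff: (n <= m)%N -> full_turn n = full_unturn n /\ ((n.+1 <= m)%N -> full_turn n.+1 = full_unturn n.+1).
  by move=> h /h[].
elim: n => [|n IHn] nm.
  by split=> //= _; rewrite /turn /unturn /= !mulr1 !mul1r.
have [fn /(_ nm) fn1] := IHn (ltnW nm); split=> // nm1.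
rewrite -[LHS]mulr1 -[RHS]mulr1 (full_turn_S n.+1) fn1 (full_unturn_S n 1).
rewrite (full_unturn_S n.+1 1) -fn turn_S unturn_S -fn1 full_turn_S.
by rewrite (@full_turn_far n n).
Qed.

Lemma straightw_full b n w l : (n <= m)%N -> (forall l, (l < n)%N -> bad b (w l)) ->
  (l < n)%N -> straightw b n w l = (w (n.-1 - l)%N)^-1.
Proof.
elim: n l => // n IHn l nm bw ln /=; rewrite bw // /turnw /invhead /rotw.
case: (eqVneq l 0%N) => [->|l0]; first by rewrite subn0 straightw_ge.
have ln' : (l <= n)%N by lia.
rewrite ln' IHn //; [|by lia|by move=> i ni; apply/bw/ltnW|by lia].
by congr (w _)^-1; lia.
Qed.

(** As the full turn equals its reverse, its square unfolds into nested products of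
    a move to the front and back; all of these are 1, except for the letter l2,
    which passes the other special letter l1. The difference of the x becomes a sum
    as pi changes the sign of x_1. *)
Lemma full_turnK b n w u l1 l2 : (n <= m)%N -> good w -> wt w u ->
  (forall l, (l < m)%N -> pos (w l) = b) -> (l1 < l2)%N -> (l2 < m)%N ->
  special (w l1) -> special (w l2) ->
  full_turn n * (full_turn n * u) =
  (if (l2 < n)%N then (-1) ^+ (~~ b) * (x l1 + x l2) else 1) * u.
Proof.
move=> nm gw wu posw l12 l2m sp1 sp2; rewrite {1}full_turn_rev //.
have sp l : (l < m)%N -> special (w l) -> l = l1 \/ l = l2.
  move=> lm sl; case: (ltngtP l l1) => [l1'|l1'|->]; [| |by left].
    by case: (@spec3 w l l1 l2).
  case: (ltngtP l l2) => [l2'|l2'|->]; [| |by right].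
    by case: (@spec3 w l1 l l2).
  by case: (@spec3 w l1 l2 l).
have allbad l : (l < m)%N -> bad (~~ b) (w l) by move=> lm; rewrite /bad posw //; case: (b).
have prefix i n' : (n' <= m)%N -> (i < n')%N ->
    straightw (~~ b) n' w i = (w (n'.-1 - i)%N)^-1.
  by move=> nm' ni; apply: straightw_full => // l ln; apply: allbad; lia.
elim: n u wu nm => [|n IHn] u wu nm; first by rewrite !mul1r.
have nm' := ltnW nm; have bn l (ln : (l < n)%N) : bad (~~ b) (w l) by apply: allbad; lia.
have gS := good_straightw (~~ b) nm' gw; have wS := wt_straight (~~ b) nm' wu.
have oS := opposed_straightw nm gw (allbad n nm); rewrite (straight_full bn) in wS.
have nn : straightw (~~ b) n w n = w n by rewrite straightw_ge.
rewrite full_turn_S full_unturn_S unturn_turn.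
have [n2|n2] := eqVneq n l2; last first.
  rewrite (undo_nospec gS wS) // ?IHn //.
    by have -> : (l2 < n.+1)%N = (l2 < n)%N by lia.
  move=> l ln; rewrite prefix // nn specV; apply/negP => /andP[s1 s2].
  case: (sp n nm s2) => // nl1; last by rewrite nl1 eqxx in n2.
  have ln1 : (n.-1 - l < m)%N by lia.
  by case: (sp _ ln1 s1); lia.
have l1n : (n.-1 - l1 < n)%N by lia.
have pre1 : straightw (~~ b) n w (n.-1 - l1)%N = (w l1)^-1.
  by rewrite prefix //; congr (w _)^-1; lia.
rewrite (@undo_spec n (n.-1 - l1) _ _ gS wS) ?pre1 ?specV ?nn ?n2 //; try by rewrite -n2.
have l1m : (l1 < m)%N by lia.
rewrite -n2 posV // posw //.
have xl1 : x (n.-1 - l1)%N * (full_turn n * u) = - (full_turn n * (x l1 * u)).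
  rewrite -(straight_full bn) (@straight_x _ n l1) //; try by lia.
  rewrite allbad // expr1 mulN1r mulNr opprK; congr (x _ * _).
  rewrite /bads (eq_big_nat _ _ (F2 := fun=> 1%N)) => [|i /andP[_ ni]].
    by rewrite sum_nat_const_nat muln1; lia.
  by rewrite allbad //; lia.
have xn : x n * (full_turn n * u) = full_turn n * (x n * u).
  by rewrite -(straight_full bn) straight_x_ge.
have IH v : wt w v -> full_unturn n * (full_turn n * v) = v.
  by move=> wv; have := IHn v wv nm'; rewrite n2 ltnn mul1r -n2.
have wx l : (l < m)%N -> wt w (x l * u) by move=> lm; apply: wt_x.
have [I1 I2] := (IH _ (wx l1 l1m), IH _ (wx n nm)).
rewrite ltnSn; case: (~~ b) => /=.
  rewrite mulrBl xl1 xn mulrBr mulrN I1 I2 -!mulNr -mulrDl.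
  by rewrite expr1 mulN1r opprD.
by rewrite mul1r mulrBl mulrDl xl1 xn opprK mulrDr I1 I2 addrC.
Qed.

End Straighten.

(** * Words and their signs *)

Section Letters.
Variables (k : fieldType) (p : k).
Hypotheses (p0 : p != 0) (p_not_root1 : forall n : nat, (0 < n)%N -> p ^+ n != 1).

Lemma expz_inj (a b : int) : p ^ a = p ^ b -> a = b.
Proof.
have key (c : int) : p ^ c = 1 -> c = 0.
  case: c => [[|n]|n] //.
    by move=> /eqP; rewrite -exprnP (negbTE (p_not_root1 _)).
  move=> /eqP; rewrite NegzE -exprnN invr_eq1 (negbTE (p_not_root1 _)) //.
move=> ab; apply/eqP; rewrite -subr_eq0; apply/eqP/key.
by rewrite expfzDr // ab -expfzDr // subrr.
Qed.

Definition pos (y : k) : bool := y \in Iplus p.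
Definition special (y : k) : bool := (y == p) || (y == p^-1).

Lemma pos_exp (n : int) : pos (p ^ (2 * n + 1)) = (0 <= n).
Proof.
apply/asboolP/idP => [[i] | n0].
  by rewrite exprnP => /expz_inj; lia.
by case: n n0 => // n _; exists n; rewrite exprnP; congr (_ ^ _); lia.
Qed.

Lemma p_exp : p = p ^ (2 * 0 + 1). Proof. by rewrite mulr0 add0r expr1z. Qed.
Lemma pV_exp : p^-1 = p ^ (2 * (-1) + 1). Proof. by []. Qed.

Lemma pos_p : pos p. Proof. by rewrite p_exp pos_exp. Qed.
Lemma pos_pV : ~~ pos p^-1. Proof. by rewrite pV_exp pos_exp. Qed.

Lemma posN y : y \in Iset p -> pos y^-1 = ~~ pos y.
Proof.
move/asboolP => [n ->]; have -> : (p ^ (2 * n + 1))^-1 = p ^ (2 * (- n - 1) + 1).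
  by rewrite invr_expz; congr (_ ^ _); lia.
by rewrite !pos_exp; lia.
Qed.

Lemma Iset_inv y : y \in Iset p -> y^-1 \in Iset p.
Proof.
move/asboolP => [n ->]; apply/asboolP; exists (- n - 1).
by rewrite invr_expz; congr (_ ^ _); lia.
Qed.

Lemma specN y : special y^-1 = special y.
Proof. by rewrite /special -!(inj_eq invr_inj y^-1) !invrK orbC. Qed.

Lemma spec_pos y : pos y -> special y = (y == p).
Proof. by rewrite /special => py; case: (y =P p^-1) py => [->|]; rewrite ?(negbTE pos_pV) ?orbF. Qed.

(** An arrow p^2 z -> z lowers the odd exponent of p by 2, so that it changes the
    sign only from p to p^-1. *)
Lemma arrow_signs y z : y \in Iset p -> z \in Iset p -> pos y != pos z ->
  arrow p y z = [&& pos y, special y & special z].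
Proof.
move=> yI zI yz; apply/eqP/and3P => [E | [py sy sz]].
  move/asboolP: zI E yz => [n ->] -> {y yI}.
  have -> : p ^+ 2 * p ^ (2 * n + 1) = p ^ (2 * (n + 1) + 1).
    by rewrite exprnP -expfzDr //; congr (_ ^ _); lia.
  rewrite !pos_exp => nn; have -> : n = -1 by lia.
  by rewrite /special -!pV_exp -p_exp !eqxx orbT.
rewrite (spec_pos py) in sy; move: yz sz; rewrite py (eqP sy) /special.
have [->|_ _ /= /eqP->] := eqVneq z p; first by rewrite pos_p.
by rewrite -mulrA mulfV // mulr1.
Qed.

End Letters.

(** ** Signed words *)

Section Positions.
Variables (k : fieldType) (m : nat).

(** A word w of W of length m has 2m letters when its reversed inverse is written in
    front of it, and m of these are positive. If s is the sequence of signs of w,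
    then posn s l is the position, among these positive letters, of the one that
    comes from position l of w. *)
Definition posn (s : nat -> bool) l : nat :=
  ((if s l then l else 0) + \sum_(l.+1 <= i < m) ~~ s i)%N.

(** The word with the signs s whose positive half is w. Every word of W
    arises in this way from a unique pair. *)
Definition wordf (s : nat -> bool) (w : nat -> k) : nat -> k :=
  fun l => if s l then w (posn s l) else (w (posn s l))^-1.

Lemma posn_ext s s' l : (l < m)%N -> (forall i, (i < m)%N -> s i = s' i) ->
  posn s l = posn s' l.
Proof.
move=> lm ss; rewrite /posn ss //; congr (_ + _)%N.
by apply: eq_big_nat => i /andP[_ im]; rewrite ss.
Qed.

Lemma posn_order s l l' : (l < l')%N -> (l' < m)%N ->
  if s l' then (posn s l < posn s l')%N else (posn s l' < posn s l)%N.
Proof.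
move=> ll lm; rewrite /posn (@big_cat_nat _ _ _ l' l.+1 m) //=; last exact: ltnW.
rewrite (@big_ltn _ _ _ l' m) //=.
set n' := (\sum_(l'.+1 <= i < m) _)%N; set n := (\sum_(l.+1 <= i < l') _)%N.
have nl : (n <= l' - l.+1)%N.
  rewrite /n -[X in (_ <= X)%N]muln1 -sum_nat_const_nat.
  by apply: leq_sum => i _; case: (s i).
by case: (s l'); case: (s l) => /=; lia.
Qed.

Lemma posn_inj s l l' : (l < m)%N -> (l' < m)%N -> posn s l = posn s l' -> l = l'.
Proof.
move=> lm lm' ll; case: (ltngtP l l') => // h.
  by have := posn_order s h lm'; case: ifP => _; lia.
by have := posn_order s h lm; case: ifP => _; lia.
Qed.

Lemma posn_lt s l : (l < m)%N -> (posn s l < m)%N.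
Proof.
move=> lm; rewrite /posn.
have : (\sum_(l.+1 <= i < m) ~~ s i <= m - l.+1)%N.
  rewrite -[X in (_ <= X)%N]muln1 -sum_nat_const_nat.
  by apply: leq_sum => i _; case: (s i).
by case: (s l); lia.
Qed.

Lemma posn_succ s a : (a.+1 < m)%N -> s a = s a.+1 ->
  if s a then posn s a.+1 = (posn s a).+1 else posn s a = (posn s a.+1).+1.
Proof.
move=> am sa; rewrite /posn (@big_ltn _ _ _ a.+1 m) //= -sa; case: (s a) => /=; lia.
Qed.

(** Exchanging neighbours of opposite sign in w leaves the positive half unchanged. *)
Lemma posn_swap s a l : (a.+1 < m)%N -> (l < m)%N -> s a != s a.+1 ->
  posn (swapf a s) l = posn s (swapn a l).
Proof.
move=> am lm sa; rewrite /posn /swapf.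
have gt n : (a.+1 < n)%N -> (\sum_(n <= i < m) ~~ s (swapn a i) = \sum_(n <= i < m) ~~ s i)%N.
  move=> an; apply: eq_big_nat => i /andP[ni _]; congr (nat_of_bool (~~ s _)).
  by rewrite /swapn; do ?case: eqP; lia.
have sl : swapn a a = a.+1 by rewrite /swapn eqxx.
have sr : swapn a a.+1 = a by rewrite /swapn eqxx ifN //; apply/eqP; lia.
have [->|la] := eqVneq l a.
  rewrite sl (@big_ltn _ _ _ a.+1 m) //= sr gt //.
  by move: sa; case: (s a); case: (s a.+1) => //= _; lia.
have [->|la1] := eqVneq l a.+1.
  rewrite sr gt // (@big_ltn _ _ _ a.+1 m) //=.
  by move: sa; case: (s a); case: (s a.+1) => //= _; lia.
have -> : swapn a l = l by rewrite /swapn (negbTE la) (negbTE la1).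
have [al|al] := ltnP a l; first by rewrite gt //; lia.
congr (_ + _)%N.
rewrite !(@big_cat_nat _ _ _ a l.+1 m) //=; try lia.
rewrite !(@big_ltn _ _ _ a m) //=; try lia.
rewrite !(@big_ltn _ _ _ a.+1 m) //= sl sr gt //.
have -> : (\sum_(l.+1 <= i < a) ~~ s (swapn a i) = \sum_(l.+1 <= i < a) ~~ s i)%N.
  apply: eq_big_nat => i /andP[_ ia]; congr (nat_of_bool (~~ s _)).
  by rewrite /swapn; do ?case: eqP; lia.
by lia.
Qed.

(** Neighbours of equal sign in w are neighbours in the positive half, and
    exchanging them there exchanges no other positions. *)
Lemma posn_swap_same s a l : (a.+1 < m)%N -> (l < m)%N -> s a = s a.+1 ->
  swapn (minn (posn s a) (posn s a.+1)) (posn s l) = posn s (swapn a l).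
Proof.
move=> am lm sa; have am' := ltnW am; have ps := posn_succ am sa.
have [->|la] := eqVneq l a.
  have -> : swapn a a = a.+1 by rewrite /swapn eqxx.
  case: ifP ps => _ ->.
    by rewrite (minn_idPl _) // /swapn eqxx.
  by rewrite (minn_idPr _) // /swapn ifN ?eqxx //; apply/eqP; lia.
have [->|la1] := eqVneq l a.+1.
  have -> : swapn a a.+1 = a by rewrite /swapn eqxx ifN //; apply/eqP; lia.
  case: ifP ps => _ ->.
    by rewrite (minn_idPl _) // /swapn ifN ?eqxx //; apply/eqP; lia.
  by rewrite (minn_idPr _) // /swapn eqxx.
have -> : swapn a l = l by rewrite /swapn (negbTE la) (negbTE la1).
have na : posn s l != posn s a by apply: contra la => /eqP/posn_inj->.
have na1 : posn s l != posn s a.+1 by apply: contra la1 => /eqP/posn_inj->.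
case: ifP ps => _ E; rewrite E in na na1 *.
  by rewrite (minn_idPl _) // /swapn (negbTE na) (negbTE na1).
by rewrite (minn_idPr _) // /swapn (negbTE na) (negbTE na1).
Qed.

Definition flip0 (s : nat -> bool) : nat -> bool :=
  fun l => if l == 0%N then ~~ s 0%N else s l.

Lemma posn_flip0 s l : posn (flip0 s) l = posn s l.
Proof.
rewrite /posn /flip0; congr (_ + _)%N; first by case: eqP => // ->; rewrite !if_same.
by apply: eq_big_nat => i /andP[li _]; rewrite ifN //; apply/eqP; lia.
Qed.

Lemma wordf_flip0 s w : wordf (flip0 s) w = invhead (wordf s w).
Proof.
apply/funext => l; rewrite /invhead /wordf posn_flip0 /flip0.
by case: eqP => // ->; case: (s 0%N) => //=; rewrite invrK.
Qed.

Lemma wordf_same s w a l : (a.+1 < m)%N -> (l < m)%N -> s a = s a.+1 ->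
  wordf s (swapf (minn (posn s a) (posn s a.+1)) w) l = swapf a (wordf s w) l.
Proof.
move=> am lm sa; rewrite /wordf /swapf posn_swap_same //; congr (if _ then _ else _).
by rewrite /swapn; case: eqP => [->|_] //; case: eqP => [->|].
Qed.

Lemma posn_const b l : (l < m)%N -> posn (fun=> b) l = if b then l else (m.-1 - l)%N.
Proof.
move=> lm; rewrite /posn; case: b => /=; first by rewrite big1 ?addn0.
by rewrite sum_nat_const_nat muln1; lia.
Qed.

Lemma swapn_perm a (am : (a.+1 < m)%N) : {h : {perm 'I_m} | forall l, h l = swapn a l :> nat}.
Proof.
have am' : (a < m.-1)%N by lia.
by exists (swap_pos (Ordinal am')) => l; rewrite swap_pos_swapn.
Qed.

End Positions.

Section Words.
Variables (k : fieldType) (p : k) (m : nat) (nu : {fsfun k -> nat with 0%N}).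
Hypotheses (p0 : p != 0) (p_not_root1 : forall n : nat, (0 < n)%N -> p ^+ n != 1).
Hypotheses (nu_theta : in_theta_NI p nu) (nu_p : nu p = 2%N).

Local Notation Th := (theta_words p m nu).
Local Notation J := (words p m (dv_plus p nu)).
Local Notation pos := (pos p).
Local Notation special := (special p).
Local Notation posn := (posn m).
Local Notation wordf := (wordf m).

(** Words of W are handled as functions on nat, restricted to the first m values. *)
Definition good (w : nat -> k) := tupf m w \in Th.

Lemma goodE w : good w = (tupf m w \in Th). Proof. by []. Qed.

Lemma tupf_mem (w : nat -> k) l : (l < m)%N -> w l \in tupf m w.
Proof. by move=> lm; apply/tnthP; exists (Ordinal lm); rewrite tnth_mktuple. Qed.

Lemma good_Iset w l : good w -> (l < m)%N -> w l \in Iset p.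
Proof. by move=> /mem_theta_words[wI _] lm; apply/wI/tupf_mem. Qed.

Lemma J_Iset w l : tupf m w \in J -> (l < m)%N -> w l \in Iset p.
Proof. by move=> /mem_words[wI _] lm; apply/wI/tupf_mem. Qed.

Definition signed_count (y : k) (i : seq k) : nat :=
  (count_mem y i + count_mem y [seq z^-1 | z <- i])%N.

Lemma signed_countE y (w : nat -> k) :
  signed_count y (tupf m w) = (\sum_(l < m) ((w l == y) + ((w l)^-1 == y)))%N.
Proof.
rewrite /signed_count big_split -!sum1_count !big_tuple /=.
by congr (_ + _)%N; rewrite big_mkcond /=; apply: eq_bigr => l _;
  rewrite ?tnth_map ?tnth_mktuple ?tnth_ord_tuple; case: eqP.
Qed.

Lemma countE y (w : nat -> k) : count_mem y (tupf m w) = (\sum_(l < m) (w l == y))%N.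
Proof.
rewrite -sum1_count big_tuple big_mkcond /=.
by apply: eq_bigr => l _; rewrite tnth_mktuple; case: eqP.
Qed.

Lemma good_intro (w : nat -> k) : (forall l, (l < m)%N -> w l \in Iset p) ->
  (forall y, signed_count y (tupf m w) = nu y) -> good w.
Proof.
move=> wI wc; apply/mem_theta_words; split=> // _ /tnthP[l ->].
by rewrite tnth_mktuple wI.
Qed.

Lemma good_count w y : good w -> (\sum_(l < m) ((w l == y) + ((w l)^-1 == y)))%N = nu y.
Proof. by rewrite -signed_countE => /mem_theta_words[_]; exact. Qed.

Lemma good_swap a w : (a.+1 < m)%N -> good w -> good (swapf a w).
Proof.
move=> am gw; have [h hE] := swapn_perm am.
apply: good_intro => [l lm|y]; first by apply: (good_Iset gw); rewrite swapn_lt.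
rewrite -(good_count y gw) signed_countE [RHS](reindex_inj (@perm_inj _ h)).
by apply: eq_bigr => l _; rewrite /swapf hE.
Qed.

Lemma good_invhead w : good w -> good (invhead w).
Proof.
move=> gw; apply: good_intro => [l lm|y].
  rewrite /invhead; case: eqP => [l0|_]; last exact: good_Iset.
  by apply: (Iset_inv p0); apply: (good_Iset gw); rewrite -l0.
rewrite -(good_count y gw) signed_countE; apply: eq_bigr => l _.
by rewrite /invhead; case: (nat_of_ord l =P 0%N) => [->|] //; rewrite invrK addnC.
Qed.

Lemma good_posV w l : good w -> (l < m)%N -> pos (w l)^-1 = ~~ pos (w l).
Proof. by move=> gw lm; apply: posN => //; exact: good_Iset. Qed.

Lemma good_arrow w l l' : good w -> (l < m)%N -> (l' < m)%N -> pos (w l) != pos (w l') ->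
  arrow p (w l) (w l') = [&& pos (w l), special (w l) & special (w l')].
Proof. by move=> gw lm lm'; apply: arrow_signs => //; exact: good_Iset. Qed.

(** Each of the letters p and p^-1 of w contributes 1 to the multiplicity of p in
    the sum of the letters of w and their inverses. *)
Lemma good_spec_count w : good w -> (\sum_(l < m) special (w l))%N = 2%N.
Proof.
move=> gw; rewrite -nu_p -(good_count p gw); apply: eq_bigr => l _.
rewrite /special -(inj_eq invr_inj (w l) p^-1) invrK; case: eqP => // ->; case: eqP => // pp.
by have := pos_pV p0 p_not_root1; rewrite pp pos_p.
Qed.

Lemma good_spec3 w l1 l2 l3 : good w -> (l1 < l2)%N -> (l2 < l3)%N -> (l3 < m)%N ->
  special (w l1) -> special (w l2) -> special (w l3) -> False.
Proof.
move=> gw l12 l23 l3m s1 s2 s3; have := good_spec_count gw.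
have l2m : (l2 < m)%N by lia.
have l1m : (l1 < m)%N by lia.
rewrite (bigD1 (Ordinal l1m)) //= (bigD1 (Ordinal l2m)) /=; last by rewrite -val_eqE /=; lia.
rewrite (bigD1 (Ordinal l3m)) /=; last by rewrite -!val_eqE /=; apply/andP; split; lia.
by rewrite s1 s2 s3.
Qed.

Lemma good_spec2 w : good w ->
  exists l1 l2, [/\ (l1 < l2)%N, (l2 < m)%N, special (w l1) & special (w l2)].
Proof.
move=> gw; have sc := good_spec_count gw.
have [i si] : exists i : 'I_m, special (w i).
  apply/existsP; apply: contra_eqT sc; rewrite negb_exists => /forallP sN.
  by rewrite big1 // => i _; rewrite (negbTE (sN i)).
have [j /andP[ij sj]] : exists j : 'I_m, (j != i) && special (w j).
  apply/existsP; apply: contra_eqT sc; rewrite negb_exists => /forallP sN.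
  rewrite (bigD1 i) //= si big1 // => j ji.
  by have := sN j; rewrite ji /= => /negbTE->.
have [lij|lij] := ltnP i j; first by exists i, j.
by exists j, i; split=> //; rewrite ltn_neqAle lij andbT.
Qed.

Lemma dv_plusE y : dv_plus p nu y = if pos y then nu y else 0%N.
Proof. by rewrite /dv_plus fsfunE; case: finsuppP => // _; rewrite if_same. Qed.

Lemma J_pos w l : tupf m w \in J -> (l < m)%N -> pos (w l).
Proof.
move=> /mem_words[_ wc] lm; have := wc (w l); rewrite dv_plusE; case: ifP => // _ c0.
by have := tupf_mem w lm; rewrite -has_pred1 has_count c0.
Qed.

Lemma nu_inv y : nu y^-1 = nu y.
Proof.
case: nu_theta => nuI nuV; have [yI|yI] := boolP (y \in Iset p); first by rewrite -nuV.
have -> : nu y = 0%N by apply/eqP; apply: contraNT yI; exact: nuI.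
by apply/eqP; apply: contraNT yI => /nuI/(Iset_inv p0); rewrite invrK.
Qed.

Lemma J_signed_count w y : tupf m w \in J ->
  (\sum_(l < m) ((w l == y) + ((w l)^-1 == y)))%N = nu y.
Proof.
move=> wJ; rewrite big_split /=; have /mem_words[_ wc] := wJ.
have cE z : (\sum_(l < m) (w l == z))%N = dv_plus p nu z by rewrite -countE wc.
rewrite cE; have -> : (\sum_(l < m) ((w l)^-1 == y))%N = dv_plus p nu y^-1.
  by rewrite -cE; apply: eq_bigr => l _; rewrite -(inj_eq invr_inj (w l)) invrK.
rewrite !dv_plusE nu_inv; case: nu_theta => nuI _.
have [nu0|/nuI yI] := eqVneq (nu y) 0%N; first by rewrite nu0 !if_same.
by rewrite posN //; case: pos; rewrite ?addn0.
Qed.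

Lemma good_J w : good w -> (forall l, (l < m)%N -> pos (w l)) -> tupf m w \in J.
Proof.
move=> gw wp; apply/mem_words; split=> [_ /tnthP[l ->]|y].
  by rewrite tnth_mktuple; exact: good_Iset.
rewrite countE dv_plusE; case: ifP => py; last first.
  by apply: big1 => l _; case: eqP => // wl; rewrite -wl wp in py.
rewrite -(good_count y gw); apply: eq_bigr => l _; case: ((w l)^-1 =P y) => [wl|_].
  by have := py; rewrite -wl (good_posV gw) // wp.
by rewrite addn0.
Qed.

Lemma good_revinv w : good w -> good (revinv m w).
Proof.
move=> gw; apply: good_intro => [l lm|y].
  by apply: (Iset_inv p0); apply: (good_Iset gw); lia.
rewrite -(good_count y gw) signed_countE [RHS](reindex_inj rev_ord_inj) /=.
apply: eq_bigr => l _; rewrite /revinv invrK addnC.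
by have -> : (m - l.+1 = m.-1 - l)%N by lia.
Qed.

Lemma wordf_good s w : tupf m w \in J -> good (wordf s w).
Proof.
move=> wJ; apply: good_intro => [l lm|y].
  have wI := J_Iset wJ (posn_lt s lm).
  by rewrite /wordf; case: ifP => _ //; exact: (Iset_inv p0).
rewrite signed_countE -(J_signed_count y wJ).
pose h (l : 'I_m) : 'I_m := Ordinal (posn_lt s (ltn_ord l)).
have hI : injective h by move=> l l' [] /posn_inj ll; apply/val_inj/ll.
rewrite [RHS](reindex_inj hI); apply: eq_bigr => l _; rewrite /wordf /=.
by case: ifP => // _; rewrite invrK addnC.
Qed.

Lemma wordf_pos s w l : tupf m w \in J -> (l < m)%N -> pos (wordf s w l) = s l.
Proof.
move=> wJ lm; have wl := posn_lt s lm; rewrite /wordf; case: ifP => _.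
  exact: J_pos wJ wl.
by rewrite posN ?(J_pos wJ) //; exact: J_Iset wJ wl.
Qed.

Lemma wordf_spec s w l : tupf m w \in J -> (l < m)%N ->
  special (wordf s w l) = (w (posn s l) == p).
Proof.
move=> wJ lm; rewrite -(@spec_pos _ p p0) ?(J_pos wJ) ?posn_lt //.
by rewrite /wordf; case: ifP => // _; rewrite specN.
Qed.

End Words.

(** * The representation on sign sequences *)

Section Tau.
Variables (k : fieldType) (p : k) (m : nat) (nu : {fsfun k -> nat with 0%N}).
Hypotheses (p0 : p != 0) (p_not_root1 : forall n : nat, (0 < n)%N -> p ^+ n != 1).
Hypotheses (nu_theta : in_theta_NI p nu) (nu_p : nu p = 2%N).
Local Notation J := (words p m (dv_plus p nu)).

Variables (R : pzRingType) (X Sg : nat -> R) (F : (nat -> k) -> R).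
Hypothesis kl : klr_like p m X Sg F.
Hypothesis Fout : forall w, tupf m w \notin J -> F w = 0.
Local Notation wt := (wt F).

Lemma wt_out w r : wt w r -> tupf m w \notin J -> r = 0.
Proof. by move=> <- wJ; rewrite Fout ?mul0r. Qed.

Lemma J_two w c c' l : tupf m w \in J -> (c < m)%N -> (c' < m)%N -> (l < m)%N -> c != c' ->
  w c = p -> w c' = p -> w l = p -> l = c \/ l = c'.
Proof.
move=> wJ cm cm' lm cc wc wc' wl.
have gw : good p m nu w.
  apply: good_intro => [i im|y]; first exact: J_Iset wJ im.
  by rewrite signed_countE -(J_signed_count p0 p_not_root1 nu_theta y wJ).
have sp i : w i = p -> special p (w i) by move=> ->; rewrite /special eqxx.
have h i j n (ij : (i < j)%N) (jn : (j < n)%N) (nm : (n < m)%N) :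
    w i = p -> w j = p -> w n = p -> False.
  by move=> /sp si /sp sj /sp sn; apply: (good_spec3 p0 p_not_root1 nu_p gw ij jn nm si sj sn).
case: (ltngtP l c) => [l1|l1|->]; [| |by left]; (case: (ltngtP l c') => [l2|l2|->]; [| |by right]).
- by case: (ltngtP c c') cc => // h1 _; [case: (h l c c') | case: (h l c' c)].
- by case: (h c' l c).
- by case: (h c l c').
- by case: (ltngtP c c') cc => // h1 _; [case: (h c c' l) | case: (h c' c l)].
Qed.

(** The weight of a crossing of letters of opposite sign, in the direction that
    does not have weight 1. Such a crossing leaves the positive half
    unchanged, and its square has to be the difference of the x at the special letters,
    one of which is negative and thus acts by the opposite of an x of R. *)
Definition tau_coef (w : nat -> k) c c' : R :=
  if (w c == p) && (w c' == p) then X c + X c' else 1.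

Definition tau c c' : R :=
  \sum_(j : J) tau_coef (nth 1 (val j)) c c' * F (nth 1 (val j)).

Lemma words_coef (a : (nat -> k) -> R) w r : tupf m w \in J ->
  (forall w', (forall l, (l < m)%N -> w l = w' l) -> a w = a w') ->
  wt w r -> (\sum_(j : J) a (nth 1 (val j)) * F (nth 1 (val j))) * r = a w * r.
Proof.
move=> wJ aext wr; rewrite -wr mulr_suml (bigD1 [` wJ]%fset) //= big1 ?addr0 => [|j jw].
  have E l : (l < m)%N -> w l = nth 1 (tupf m w) l by move=> lm; rewrite nth_tupf.
  rewrite -mulrA (mulrA (F _)) -(kl_Eext kl E) -(aext _ E) (kl_EE kl).
  by rewrite wr.
have [l lm jl] : exists2 l, (l < m)%N & nth 1 (val j) l != w l.
  have [l jl] : exists l : 'I_m, nth 1 (val j) l != w l.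
    apply/existsP; rewrite -negb_forall; apply: contra jw => /forallP jw.
    apply/eqP/val_inj/eq_from_tnth => l.
    by rewrite /= tnth_mktuple (tnth_nth 1) (eqP (jw l)).
  by exists l.
by rewrite -mulrA (mulrA (F _)) (kl_E0 kl lm jl) mul0r mulr0.
Qed.

Lemma tau_wt w c c' r : tupf m w \in J -> (c < m)%N -> (c' < m)%N -> wt w r ->
  tau c c' * r = tau_coef w c c' * r.
Proof.
by move=> wJ cm cm'; apply: (words_coef (a := fun w => tau_coef w c c')) => // w' ww;
  rewrite /tau_coef !ww.
Qed.

Lemma tau_sym c c' r w : (c < m)%N -> (c' < m)%N -> wt w r -> tau c c' * r = tau c' c * r.
Proof.
move=> cm cm' wr; have [wJ|wJ] := boolP (tupf m w \in J); last first.
  by rewrite (wt_out wr wJ) !mulr0.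
by rewrite !(tau_wt wJ) // /tau_coef andbC addrC.
Qed.

Lemma wt_tau w c c' r : (c < m)%N -> (c' < m)%N -> wt w r -> wt w (tau c c' * r).
Proof.
move=> cm cm' wr; have [wJ|wJ] := boolP (tupf m w \in J); last first.
  by rewrite (wt_out wr wJ) /wt !mulr0.
rewrite (tau_wt wJ) // /tau_coef; case: ifP => _; last by rewrite mul1r.
by rewrite mulrDl wtE mulrDr (wt_x kl) // (wt_x kl).
Qed.

Lemma tau_X l c c' r w : (l < m)%N -> (c < m)%N -> (c' < m)%N -> wt w r ->
  tau c c' * (X l * r) = X l * (tau c c' * r).
Proof.
move=> lm cm cm' wr; have [wJ|wJ] := boolP (tupf m w \in J); last first.
  by rewrite (wt_out wr wJ) !mulr0.
rewrite !(tau_wt wJ) //; last exact: (wt_x kl).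
rewrite /tau_coef; case: ifP => _; last by rewrite !mul1r.
by rewrite !mulrA mulrDl mulrDr !(kl_xx kl (l := l)) //.
Qed.

Lemma tau_tau c c' d d' r w : (c < m)%N -> (c' < m)%N -> (d < m)%N -> (d' < m)%N -> wt w r ->
  tau c c' * (tau d d' * r) = tau d d' * (tau c c' * r).
Proof.
move=> cm cm' dm dm' wr; have [wJ|wJ] := boolP (tupf m w \in J); last first.
  by rewrite (wt_out wr wJ) !mulr0.
have wtr := wt_tau cm cm' wr.
rewrite (tau_wt wJ dm dm' wr) (tau_wt wJ dm dm' wtr) /tau_coef.
case: ifP => _; last by rewrite !mul1r.
by rewrite !mulrDl mulrDr !(tau_X _ cm cm' wr).
Qed.

(** The sum over two positions that carry all letters p is symmetric in these, so
    the corrections of a crossing of the two letters p cancel. *)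
Lemma Sg_tau a c c' r w : (a.+1 < m)%N -> (c < m)%N -> (c' < m)%N -> c != c' -> wt w r ->
  Sg a * (tau c c' * r) = tau (swapn a c) (swapn a c') * (Sg a * r).
Proof.
move=> am cm cm' cc wr; have am' := ltnW am; have [wJ|wJ] := boolP (tupf m w \in J); last first.
  by rewrite (wt_out wr wJ) !mulr0.
have wsr := wt_s kl am wr.
have [wsJ|wsJ] := boolP (tupf m (swapf a w) \in J); last first.
  have am1 : (a < m.-1)%N by lia.
  case/negP: wsJ; rewrite -[a in swapf a]/(val (Ordinal am1)) tupf_swap.
  exact: (@words_swap _ _ _ _ _ [` wJ]%fset).
rewrite (tau_wt wJ) // (tau_wt wsJ _ _ wsr) ?swapn_lt // /tau_coef /swapf !swapnK.
case: ifP => [/andP[/eqP wc /eqP wc']|_]; last by rewrite !mul1r.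
rewrite !mulrDl mulrDr !(cross_at kl wr) //.
suff t0 : cross_coef R a c w + cross_coef R a c' w = 0.
  by rewrite addrACA -(mulrDl (cross_coef R a c w)) t0 mul0r addr0.
rewrite /cross_coef; case: eqP => [wa|_]; last by rewrite addr0.
have two l : (l < m)%N -> w l = p -> l = c \/ l = c'.
  by move=> lm wl; exact: (@J_two w c c' l).
have [ca|ca] := eqVneq c a.
  case: (two a.+1) => [//||c'a|c'a]; first by rewrite -wa -ca.
    by lia.
  have -> : (c == a.+1) = false by lia.
  have -> : (c' == a.+1) = true by lia.
  have -> : (c' == a) = false by lia.
  by rewrite subr0 sub0r addNr.
have [ca1|ca1] := eqVneq c a.+1.
  case: (two a) => [//||c'a|c'a]; first by rewrite wa -ca1.
    by lia.
  have -> : (c' == a.+1) = false by lia.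
  have -> : (c' == a) = true by lia.
  by rewrite subr0 sub0r subrr.
have [ca'|ca'] := eqVneq c' a.
  by case: (two a.+1) => [//||c'a|c'a]; [rewrite -wa -ca' | lia | lia].
have [ca1'|ca1'] := eqVneq c' a.+1.
  by case: (two a) => [//||c'a|c'a]; [rewrite wa -ca1' | lia | lia].
by rewrite subrr addr0.
Qed.

End Tau.

Section SignMatrices.
Variables (k : fieldType) (p : k) (m : nat) (nu : {fsfun k -> nat with 0%N}).
Hypotheses (p0 : p != 0) (p_not_root1 : forall n : nat, (0 < n)%N -> p ^+ n != 1).
Hypotheses (nu_theta : in_theta_NI p nu) (nu_p : nu p = 2%N).
Local Notation J := (words p m (dv_plus p nu)).
Local Notation good := (good p m nu).
Local Notation pos := (pos p).
Local Notation special := (special p).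

Variables (R : pzRingType) (X Sg : nat -> R) (F : (nat -> k) -> R).
Hypothesis kl : klr_like p m X Sg F.
Hypothesis Fout : forall w, tupf m w \notin J -> F w = 0.
Hypothesis F1 : \sum_(j : J) F (nth 1 (val j)) = 1.
Variable b : bool.
Local Notation wt := (wt F).
Local Notation tau := (tau p m nu X F).

Local Notation T := (m.-tuple bool).
Local Notation N := #|{: T}|.

(** ** Sign sequences *)

Definition sg (t : T) : nat -> bool := nth true t.
Definition pt (t : T) l := posn m (sg t) l.
Definition wT (t : T) (w : nat -> k) := wordf m (sg t) w.
Definition swT a (t : T) : T := tupf m (swapf a (sg t)).
Definition flT (t : T) : T := tupf m (flip0 (sg t)).

Lemma eq_sg (t t' : T) : (forall l, (l < m)%N -> sg t l = sg t' l) -> t = t'.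
Proof. by move=> tt; rewrite -(tupf_nth true t) -(tupf_nth true t'); exact: eq_tupf. Qed.

Lemma sg_swT a t l : (l < m)%N -> sg (swT a t) l = sg t (swapn a l).
Proof. by move=> lm; rewrite /sg nth_tupf. Qed.

Lemma sg_flT t l : (l < m)%N -> sg (flT t) l = flip0 (sg t) l.
Proof. by move=> lm; rewrite /sg nth_tupf. Qed.

Lemma pt_lt t l : (l < m)%N -> (pt t l < m)%N. Proof. exact: posn_lt. Qed.

Lemma pt_inj t l l' : (l < m)%N -> (l' < m)%N -> pt t l = pt t l' -> l = l'.
Proof. exact: posn_inj. Qed.

Lemma pt_swT a t l : (a.+1 < m)%N -> (l < m)%N -> sg t a != sg t a.+1 ->
  pt (swT a t) l = pt t (swapn a l).
Proof.
move=> am lm ta; rewrite /pt -posn_swap //; apply: posn_ext => // i im.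
exact: sg_swT.
Qed.

Lemma pt_flT t l : (l < m)%N -> pt (flT t) l = pt t l.
Proof.
move=> lm; rewrite /pt -[RHS]posn_flip0; apply: posn_ext => // i im.
exact: sg_flT.
Qed.

Lemma swT_same a t : (a.+1 < m)%N -> sg t a = sg t a.+1 -> swT a t = t.
Proof.
move=> am ta; apply: eq_sg => l lm; rewrite sg_swT // /swapn.
by case: eqP => [->|_] //; case: eqP => [->|].
Qed.

Lemma swTK a t : (a.+1 < m)%N -> swT a (swT a t) = t.
Proof. by move=> am; apply: eq_sg => l lm; rewrite !sg_swT ?swapn_lt ?swapnK. Qed.

Lemma swT_far a c t : (a.+1 < c)%N -> (c.+1 < m)%N -> swT a (swT c t) = swT c (swT a t).
Proof.
move=> ac cm; apply: eq_sg => l lm; rewrite !sg_swT ?swapn_lt //; try lia.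
by congr (sg t _); rewrite /swapn; do ?case: eqP; lia.
Qed.

Lemma flT_swT a t : (0 < a)%N -> (a.+1 < m)%N -> flT (swT a t) = swT a (flT t).
Proof.
move=> a0 am; apply: eq_sg => l lm.
rewrite sg_flT // sg_swT // sg_flT ?swapn_lt // /flip0 !sg_swT ?swapn_lt //; last by lia.
have -> : swapn a 0 = 0%N by rewrite /swapn; do ?case: eqP; lia.
by have -> : (swapn a l == 0%N) = (l == 0%N) by rewrite /swapn; do ?case: eqP; lia.
Qed.

Lemma wT_swT a t w l : (a.+1 < m)%N -> (l < m)%N -> sg t a != sg t a.+1 ->
  wT (swT a t) w l = swapf a (wT t w) l.
Proof. by move=> am lm ta; rewrite /wT /wordf -!/(pt _ _) sg_swT // pt_swT. Qed.

Lemma wT_pos t w l : tupf m w \in J -> (l < m)%N -> pos (wT t w l) = sg t l.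
Proof. exact: wordf_pos. Qed.

Lemma wT_spec t w l : tupf m w \in J -> (l < m)%N -> special (wT t w l) = (w (pt t l) == p).
Proof. exact: wordf_spec. Qed.

Lemma wT_flT t w l : (l < m)%N -> wT (flT t) w l = invhead (wT t w) l.
Proof. by move=> lm; rewrite -wordf_flip0 /wT /wordf -!/(pt _ _) sg_flT // pt_flT // posn_flip0. Qed.

(** ** Matrices acting on columns *)

(** The operator that sends t to f t with weight g t. The basis elements of the free
    right R-module are the sign sequences, so that R acts by left multiplication
    on the entries. *)
Definition wm (f : T -> T) (g : T -> R) : 'M[R]_N :=
  \matrix_(i, j) if enum_val i == f (enum_val j) then g (enum_val j) else 0.

Definition column (t : T) (r : R) : 'cV[R]_N := \col_i if enum_val i == t then r else 0.

Lemma columnD t r r' : column t (r + r') = column t r + column t r'.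
Proof. by apply/colP => i; rewrite !mxE; case: ifP; rewrite ?addr0. Qed.
Lemma columnN t r : column t (- r) = - column t r.
Proof. by apply/colP => i; rewrite !mxE; case: ifP; rewrite ?oppr0. Qed.
Lemma column0 t : column t 0 = 0.
Proof. by apply/colP => i; rewrite !mxE; case: ifP. Qed.

Lemma wm_column f g t r : wm f g *m column t r = column (f t) (g t * r).
Proof.
apply/colP => i; rewrite !mxE (bigD1 (enum_rank t)) //= !mxE enum_rankK eqxx.
rewrite big1 ?addr0 => [|j jt]; first by case: ifP; rewrite ?mul0r.
have /negbTE jt' : enum_val j != t by apply: contra jt => /eqP<-; rewrite enum_valK.
by rewrite !mxE jt' mulr0.
Qed.

(** It suffices to compare two matrices on the columns with a single entry, which
    may be taken of a fixed weight w in R; then t and w determine a word of W. *)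
Lemma mx_test (A B : 'M[R]_N) :
  (forall t w r, tupf m w \in J -> wt w r -> A *m column t r = B *m column t r) -> A = B.
Proof.
move=> AB; have AB1 t : A *m column t 1 = B *m column t 1.
  have -> : column t 1 = \sum_(j : J) column t (F (nth 1 (val j))).
    by rewrite -F1; apply: (big_morph (column t) (columnD t) (column0 t)).
  rewrite !mulmx_sumr; apply: eq_bigr => j _.
  by apply: (AB _ (nth 1 (val j))); [rewrite tupf_nth; exact: valP | exact: (wt_E kl)].
have col (M : 'M[R]_N) i j : (M *m column (enum_val j) 1) i 0 = M i j.
  rewrite !mxE (bigD1 j) //= !mxE eqxx mulr1 big1 ?addr0 // => l lj.
  by rewrite !mxE (inj_eq enum_val_inj) (negbTE lj) mulr0.
by apply/matrixP => i j; rewrite -col AB1 col.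
Qed.

Lemma mul_column (A B : 'M[R]_N) t r : (A * B) *m column t r = A *m (B *m column t r).
Proof. by rewrite -mulmxA. Qed.

Definition Mx l : 'M[R]_N := wm id (fun t => (-1) ^+ (~~ sg t l) * X (pt t l)).

(** The parameter b selects, among the two crossings of letters of opposite sign,
    the one of weight 1. *)
Definition omega a (t : T) : R :=
  if sg t a == sg t a.+1 then Sg (minn (pt t a) (pt t a.+1))
  else if sg t a == b then 1 else tau (pt t a) (pt t a.+1).

Definition Ms a : 'M[R]_N := wm (swT a) (omega a).
Definition Mpi : 'M[R]_N := wm flT (fun=> 1).
Definition ME w : 'M[R]_N :=
  wm id (fun t => \sum_(j : J) (tupf m (wT t (nth 1 (val j))) == tupf m w)%:R
                    * F (nth 1 (val j))).

Lemma Mx_column l t r : Mx l *m column t r = column t ((-1) ^+ (~~ sg t l) * (X (pt t l) * r)).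
Proof. by rewrite wm_column mulrA. Qed.

Lemma Ms_column a t r : Ms a *m column t r = column (swT a t) (omega a t * r).
Proof. exact: wm_column. Qed.

Lemma Mpi_column t r : Mpi *m column t r = column (flT t) r.
Proof. by rewrite wm_column mul1r. Qed.

Lemma ME_column i t w r : tupf m w \in J -> wt w r ->
  ME i *m column t r = if tupf m (wT t w) == tupf m i then column t r else 0.
Proof.
move=> wJ wr; rewrite wm_column.
rewrite (words_coef kl (a := fun w => (tupf m (wT t w) == tupf m i)%:R) wJ) //.
  by case: ifP => _; rewrite ?mul1r // mul0r column0.
move=> w' ww; congr (_ == _)%:R; apply: eq_tupf => l lm.
by rewrite /wT /wordf !ww //; exact: posn_lt.
Qed.

(** The crossing either acts on the positive half, for equal signs, or on the sign
    sequence, for opposite signs; in both cases it exchanges two letters of the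
    word of W. *)
Lemma omega_wt a t w r : (a.+1 < m)%N -> tupf m w \in J -> wt w r ->
  exists w', [/\ tupf m w' \in J, wt w' (omega a t * r) &
    forall l, (l < m)%N -> wT (swT a t) w' l = swapf a (wT t w) l].
Proof.
move=> am wJ wr; rewrite /omega; have am' := ltnW am.
have [ta|ta] := eqVneq (sg t a) (sg t a.+1).
  set c := minn _ _; exists (swapf c w); rewrite swT_same //.
  have cm : (c.+1 < m)%N.
    have := posn_succ am ta; rewrite -!/(pt _ _) /c.
    have := pt_lt t am; have := pt_lt t am'; case: ifP => _; lia.
  split=> [||l lm]; last exact: wordf_same.
    have cm1 : (c < m.-1)%N by lia.
    rewrite -[c in swapf c]/(val (Ordinal cm1)) tupf_swap.
    exact: (@words_swap _ _ _ _ _ [` wJ]%fset).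
  exact: (wt_s kl).
exists w; split=> [//||l lm]; last exact: wT_swT.
case: ifP => _; first by rewrite mul1r.
by apply: (wt_tau kl Fout) => //; exact: pt_lt.
Qed.

Lemma ME_test (i : nat -> k) (A B : 'M[R]_N) :
  (forall t w r, tupf m w \in J -> wt w r -> (forall l, (l < m)%N -> wT t w l = i l) ->
     A *m column t r = B *m column t r) -> A * ME i = B * ME i.
Proof.
move=> AB; apply: mx_test => t w r wJ wr; rewrite !mul_column !(ME_column _ _ wJ wr).
case: eqP => [wi|_]; last by rewrite !mulmx0.
by apply: (AB _ w) => // l lm; rewrite -(nth_tupf 1 (wT t w) lm) wi nth_tupf.
Qed.

(** ** The KLR relations *)

Lemma swT_ne a t : (a.+1 < m)%N -> sg t a != sg t a.+1 -> sg (swT a t) a != sg (swT a t) a.+1.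
Proof.
move=> am ta; rewrite !sg_swT //; last exact: ltnW.
by rewrite /swapn !eqxx ifN 1?eq_sym //; apply/eqP; lia.
Qed.

Lemma sign_mul n (r r' : R) : r * ((-1) ^+ n * r') = (-1) ^+ n * (r * r').
Proof. by rewrite mulrA (commr_sign r n) mulrA. Qed.

(** Negative letters occur in the positive half in reverse order. *)
Lemma pt_same a t : (a.+1 < m)%N -> sg t a = sg t a.+1 ->
  let c := minn (pt t a) (pt t a.+1) in
  (c.+1 < m)%N /\ if sg t a then pt t a = c /\ pt t a.+1 = c.+1
                  else pt t a = c.+1 /\ pt t a.+1 = c.
Proof.
move=> am ta; have := posn_succ am ta; rewrite -!/(pt _ _).
have := pt_lt t am; have := pt_lt t (ltnW am).
case: ifP => _ h1 h2 E; rewrite E; first by rewrite (minn_idPl _) //; lia.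
by rewrite (minn_idPr _) //; lia.
Qed.

Lemma M_ss a i : (a.+1 < m)%N -> Ms a * (Ms a * ME i) = sqr_coef p Mx a i * ME i.
Proof.
move=> am; have am' := ltnW am; rewrite mulrA; apply: ME_test => t w r wJ wr wi.
rewrite mul_column !Ms_column swTK //.
have gi := wordf_good p0 p_not_root1 nu_theta (sg t) wJ.
have MB c c' : (Mx c - Mx c') *m column t r =
    column t (((-1) ^+ (~~ sg t c) * X (pt t c) - (-1) ^+ (~~ sg t c') * X (pt t c')) * r).
  by rewrite mulmxBl !Mx_column mulrBl columnD columnN !mulrA.
have [ta|ta] := eqVneq (sg t a) (sg t a.+1).
  have [cm E] := pt_same am ta; rewrite swT_same // /omega ta eqxx.
  set c := minn _ _ in cm E *; rewrite (sqr_at kl wr) //.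
  rewrite /sqr_coef -!wi // /wT /wordf -!/(pt _ _) -ta.
  case ta0: (sg t a) E ta => -[E1 E2] ta; rewrite E1 E2 /=.
    case: eqP => _; first by rewrite mul0mx mul0r column0.
    case: ifP => _; first by rewrite MB ta0 -ta E1 E2 !mul1r.
    by case: ifP => _; [rewrite MB ta0 -ta E1 E2 !mul1r | rewrite mul1mx mul1r].
  rewrite (inj_eq invr_inj) eq_sym !arrowV //.
  case: eqP => _; first by rewrite mul0mx mul0r column0.
  case: ifP => _; first by rewrite MB ta0 -ta E1 E2 !expr1 !mulN1r opprK addrC.
  by case: ifP => _; [rewrite MB ta0 -ta E1 E2 !expr1 !mulN1r opprK addrC | rewrite mul1mx mul1r].
have pij : pos (i a) != pos (i a.+1) by rewrite -!wi // !(wT_pos _ wJ).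
have gi' : good i by move: gi; rewrite !goodE (eq_tupf wi).
rewrite /sqr_coef ifN; last by apply: contra pij => /eqP->.
rewrite !(good_arrow p0 p_not_root1 gi') // 1?eq_sym //.
rewrite -!wi // !(wT_pos _ wJ) // !(wT_spec _ wJ) //.
have ptm := pt_lt t am; have ptm' := pt_lt t am'.
have -> : omega a (swT a t) * (omega a t * r) = tau (pt t a) (pt t a.+1) * r.
  rewrite /omega (negbTE (swT_ne am ta)) (negbTE ta) !pt_swT // !sg_swT //.
  have -> : swapn a a = a.+1 by rewrite /swapn eqxx.
  have -> : swapn a a.+1 = a by rewrite /swapn eqxx ifN //; apply/eqP; lia.
  have tS := tau_sym kl Fout ptm ptm' wr.
  by case: (sg t a) ta; case: (sg t a.+1); case: (b) => //= _; rewrite !mul1r.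
rewrite (tau_wt kl wJ) // /tau_coef; move: ta MB.
case: (w _ == p); case: (w _ == p) => /=; rewrite ?andbF ?mul1r ?mul1mx //.
by case E: (sg t a); case E1: (sg t a.+1) => //= _ ->; rewrite E E1 !expr1 !mulN1r expr0 !mul1r opprK // addrC.
Qed.

Lemma pt_swT_far a t l : (a.+1 < m)%N -> (l < m)%N -> l != a -> l != a.+1 ->
  pt (swT a t) l = pt t l.
Proof.
move=> am lm la la1; have [ta|ta] := eqVneq (sg t a) (sg t a.+1).
  by rewrite swT_same.
by rewrite pt_swT // /swapn (negbTE la) (negbTE la1).
Qed.

Lemma sg_swT_far a t l : (l < m)%N -> l != a -> l != a.+1 -> sg (swT a t) l = sg t l.
Proof. by move=> lm la la1; rewrite sg_swT // /swapn (negbTE la) (negbTE la1). Qed.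

Lemma omega_far a c t : (a.+1 < m)%N -> (c.+1 < m)%N -> (a.+1 < c)%N || (c.+1 < a)%N ->
  omega a (swT c t) = omega a t.
Proof.
move=> am cm ac.
have /andP[n1 n2] : (a != c) && (a != c.+1) by lia.
have /andP[n3 n4] : (a.+1 != c) && (a.+1 != c.+1) by lia.
have am' := ltnW am.
by rewrite /omega !pt_swT_far // !sg_swT_far.
Qed.

Lemma swapn_pt a t l : (a.+1 < m)%N -> (l < m)%N -> sg t a = sg t a.+1 ->
  swapn (minn (pt t a) (pt t a.+1)) (pt t l) = pt t (swapn a l).
Proof. exact: posn_swap_same. Qed.

Lemma omega_comm a c t w r : (a.+1 < c)%N -> (c.+1 < m)%N -> wt w r ->
  omega a t * (omega c t * r) = omega c t * (omega a t * r).
Proof.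
move=> ac cm wr; have am : (a.+1 < m)%N by lia.
have [am' cm'] := (ltnW am, ltnW cm).
have ptm l : (l < m)%N -> (pt t l < m)%N by exact: pt_lt.
have pt_ne l : (l.+1 < m)%N -> pt t l != pt t l.+1.
  by move=> lm; apply/eqP => /pt_inj; lia.
have fx e l : (e.+1 < m)%N -> (l < m)%N -> sg t e = sg t e.+1 -> l != e -> l != e.+1 ->
    swapn (minn (pt t e) (pt t e.+1)) (pt t l) = pt t l.
  by move=> em lm te le le1; rewrite swapn_pt // /swapn (negbTE le) (negbTE le1).
have [ta|ta] := eqVneq (sg t a) (sg t a.+1).
  have [am1 _] := pt_same am ta.
  have f1 := fx a c am cm' ta; have f2 := fx a c.+1 am cm ta.
  have {}f1 : swapn (minn (pt t a) (pt t a.+1)) (pt t c) = pt t c by apply: f1; lia.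
  have {}f2 : swapn (minn (pt t a) (pt t a.+1)) (pt t c.+1) = pt t c.+1 by apply: f2; lia.
  have [tc|tc] := eqVneq (sg t c) (sg t c.+1).
    rewrite /omega ta tc !eqxx; have [cm1 E] := pt_same cm tc.
    set u := minn (pt t a) _ in am1 f1 f2 *; set v := minn (pt t c) _ in cm1 E *.
    have [fv fv1] : swapn u v = v /\ swapn u v.+1 = v.+1.
      by case: ifP E => _ [<- <-].
    have uv : (u.+1 < v)%N || (v.+1 < u)%N.
      by move: fv fv1; rewrite /swapn; do ?case: eqP; lia.
    by case/orP: uv => uv; [rewrite (s_far kl _ uv) | rewrite -(s_far kl _ uv)].
  rewrite /omega ta eqxx (negbTE tc); case: ifP => _; first by rewrite !mul1r.
  by rewrite (Sg_tau p0 p_not_root1 nu_theta nu_p kl Fout am1 _ _ _ wr) ?ptm ?pt_ne // f1 f2.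
rewrite {1 4}/omega (negbTE ta); case: ifP => _; first by rewrite !mul1r.
have [tc|tc] := eqVneq (sg t c) (sg t c.+1).
  have [cm1 _] := pt_same cm tc.
  have f1 : swapn (minn (pt t c) (pt t c.+1)) (pt t a) = pt t a by apply: fx => //; lia.
  have f2 : swapn (minn (pt t c) (pt t c.+1)) (pt t a.+1) = pt t a.+1 by apply: fx => //; lia.
  rewrite /omega tc eqxx.
  by rewrite (Sg_tau p0 p_not_root1 nu_theta nu_p kl Fout cm1 _ _ _ wr) ?ptm ?pt_ne // f1 f2.
rewrite /omega (negbTE tc); case: ifP => _; first by rewrite !mul1r.
by apply: (tau_tau kl Fout _ _ _ _ wr); exact: ptm.
Qed.

Lemma M_far a c : (a.+1 < c)%N -> (c.+1 < m)%N -> Ms a * Ms c = Ms c * Ms a.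
Proof.
move=> ac cm; apply: mx_test => t w r wJ wr; rewrite !mul_column !Ms_column swT_far //.
have am : (a.+1 < m)%N by lia.
by rewrite !omega_far ?ac ?orbT // (omega_comm t ac cm wr).
Qed.

Lemma bool_column (e e' : bool) t r : ((e%:R - e'%:R : 'M[R]_N) *m column t r) = column t ((e%:R - e'%:R) * r).
Proof.
have one (c : bool) : (c%:R : 'M[R]_N) *m column t r = column t (c%:R * r).
  by case: c; rewrite ?mul1mx ?mul1r // mul0mx mul0r column0.
by rewrite mulmxBl !one mulrBl columnD columnN.
Qed.

Lemma M_sx a l i : (a.+1 < m)%N -> (l < m)%N ->
  Ms a * (Mx l * ME i) = Mx (swapn a l) * (Ms a * ME i) + cross_coef _ a l i * ME i.
Proof.
move=> am lm; rewrite !mulrA -mulrDl; apply: ME_test => t w r wJ wr wi.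
have am' := ltnW am; have sm : (swapn a l < m)%N by rewrite swapn_lt.
rewrite mulmxDl !mul_column Mx_column !Ms_column Mx_column.
have [ta|ta] := eqVneq (sg t a) (sg t a.+1); last first.
  have pij : pos (i a) != pos (i a.+1) by rewrite -!wi // !(wT_pos _ wJ).
  rewrite /cross_coef ifN; last by apply: contra pij => /eqP->.
  rewrite mul0mx addr0 sg_swT // pt_swT // swapnK sign_mul; congr (column _ (_ * _)).
  rewrite /omega (negbTE ta); case: ifP => _; first by rewrite !mul1r.
  by rewrite (tau_X kl Fout _ _ _ wr) //; exact: pt_lt.
have ssg : sg t (swapn a l) = sg t l.
  by rewrite /swapn; case: eqP => [->|_] //; case: eqP => [->|].
rewrite swT_same // /omega ta eqxx; have [cm E] := pt_same am ta.
have ptl : (pt t l < m)%N by apply: pt_lt.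
rewrite sign_mul (cross_at kl wr) // swapn_pt // ssg mulrDr columnD; congr (_ + _).
set c := minn _ _ in cm E *.
have wE : (i a == i a.+1) = (w c == w c.+1).
  rewrite -!wi // /wT /wordf -!/(pt _ _) -ta.
  by case: (sg t a) E => -[-> ->] //; rewrite (inj_eq invr_inj) eq_sym.
rewrite /cross_coef wE; case: ifP => _; last by rewrite mul0mx mul0r mulr0 column0.
rewrite bool_column; congr (column _ _); rewrite mulrA; congr (_ * _).
have inj l' : (l' < m)%N -> (pt t l == pt t l') = (l == l').
  by move=> lm'; apply/eqP/eqP => [/pt_inj->|->].
have [i1 i2] := (inj a am', inj a.+1 am).
have sl : l = a \/ l = a.+1 -> sg t l = sg t a by case=> ->.
have [la|la] := eqVneq l a.
  rewrite (sl (or_introl la)).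
  have -> : (l == a.+1) = false by lia.
  move: i1 i2; case: (sg t a) E => -[-> ->] -> ->; rewrite ?mul1r ?la ?eqxx //.
    by have -> : (a == a.+1) = false by lia.
  have -> : (a == a.+1) = false by lia.
  by rewrite expr1 mulN1r opprB.
have [la1|la1] := eqVneq l a.+1.
  rewrite (sl (or_intror la1)).
  move: i1 i2; case: (sg t a) E => -[-> ->] -> ->; rewrite ?mul1r.
    by rewrite (negbTE la) la1 eqxx.
  by rewrite (negbTE la) la1 eqxx expr1 mulN1r opprB.
rewrite subrr; move: i1 i2; rewrite (negbTE la) (negbTE la1).
by case: (sg t a) E => -[-> ->] -> ->; rewrite subrr mulr0.
Qed.

(** Both sides of a braid relation change only the signs and positions of three
    letters, which st3 keeps track of. *)
Definition st3 a (t : T) (e0 e1 e2 : bool) (P0 P1 P2 : nat) : Prop :=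
  [/\ sg t a = e0, sg t a.+1 = e1 & sg t a.+2 = e2] /\
  [/\ pt t a = P0, pt t a.+1 = P1 & pt t a.+2 = P2].

Lemma st3_l a t e0 e1 e2 P0 P1 P2 : (a.+2 < m)%N -> st3 a t e0 e1 e2 P0 P1 P2 ->
  st3 a (swT a t) e1 e0 e2 (if e0 == e1 then P0 else P1) (if e0 == e1 then P1 else P0) P2.
Proof.
move=> am [[<- <- <-] [<- <- <-]]; have am1 := ltnW am; have am0 := ltnW am1.
have sw0 : swapn a a = a.+1 by rewrite /swapn eqxx.
have sw1 : swapn a a.+1 = a by rewrite /swapn eqxx ifN //; apply/eqP; lia.
have sw2 : swapn a a.+2 = a.+2 by rewrite /swapn !ifN //; apply/eqP; lia.
split; first by rewrite !sg_swT // sw0 sw1 sw2.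
have [ta|ta] := eqVneq (sg t a) (sg t a.+1); first by rewrite swT_same.
by rewrite !pt_swT // sw0 sw1 sw2.
Qed.

Lemma st3_r a t e0 e1 e2 P0 P1 P2 : (a.+2 < m)%N -> st3 a t e0 e1 e2 P0 P1 P2 ->
  st3 a (swT a.+1 t) e0 e2 e1 P0 (if e1 == e2 then P1 else P2) (if e1 == e2 then P2 else P1).
Proof.
move=> am [[<- <- <-] [<- <- <-]]; have am1 := ltnW am; have am0 := ltnW am1.
have sw0 : swapn a.+1 a = a by rewrite /swapn !ifN //; apply/eqP; lia.
have sw1 : swapn a.+1 a.+1 = a.+2 by rewrite /swapn eqxx.
have sw2 : swapn a.+1 a.+2 = a.+1 by rewrite /swapn eqxx ifN //; apply/eqP; lia.
split; first by rewrite !sg_swT // sw0 sw1 sw2.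
have [ta|ta] := eqVneq (sg t a.+1) (sg t a.+2); first by rewrite swT_same.
by rewrite !pt_swT // sw0 sw1 sw2.
Qed.

Definition om e e' P Q : R :=
  if e == e' then Sg (minn P Q) else if e == b then 1 else tau P Q.

Lemma om_l a t e0 e1 e2 P0 P1 P2 : st3 a t e0 e1 e2 P0 P1 P2 -> omega a t = om e0 e1 P0 P1.
Proof. by move=> [[E0 E1 _] [Q0 Q1 _]]; rewrite /omega /om E0 E1 Q0 Q1. Qed.

Lemma om_r a t e0 e1 e2 P0 P1 P2 : st3 a t e0 e1 e2 P0 P1 P2 -> omega a.+1 t = om e1 e2 P1 P2.
Proof. by move=> [[_ E0 E1] [_ Q0 Q1]]; rewrite /omega /om E0 E1 Q0 Q1. Qed.

Lemma swT_braid a t : (a.+2 < m)%N -> swT a.+1 (swT a (swT a.+1 t)) = swT a (swT a.+1 (swT a t)).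
Proof.
move=> am; have am1 := ltnW am; apply: eq_sg => l lm; rewrite !sg_swT ?swapn_lt //.
by congr (sg t _); rewrite /swapn; do ?case: eqP; lia.
Qed.

(** For equal signs this is the braid relation of R. For mixed signs each side
    consists of one crossing of equal signs and two of opposite signs; the
    latter have weights 1 or tau, and the former permutes the
    positions in the weights as it passes them. *)
Lemma M_br a i : (a.+2 < m)%N ->
  Ms a.+1 * (Ms a * (Ms a.+1 * ME i)) =
  Ms a * (Ms a.+1 * (Ms a * ME i)) + braid_coef p _ a i * ME i.
Proof.
move=> am; rewrite !mulrA -mulrDl; apply: ME_test => t w r wJ wr wi.
have am1 := ltnW am; have am0 := ltnW am1.
rewrite mulmxDl !(mul_column, Ms_column) swT_braid //.
have [[P0m P1m] P2m] := (pt_lt t am0, pt_lt t am1, pt_lt t am).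
have st : st3 a t (sg t a) (sg t a.+1) (sg t a.+2) (pt t a) (pt t a.+1) (pt t a.+2) by [].
have str := st3_r am st; have strl := st3_l am str.
have stl := st3_l am st; have stlr := st3_r am stl.
rewrite (om_r st) (om_l str) (om_r strl) (om_l st) (om_r stl) (om_l stlr).
rewrite /om; have pti l l' : (l < m)%N -> (l' < m)%N -> l != l' -> pt t l != pt t l'.
  by move=> lm lm' ll; apply: contra ll => /eqP/pt_inj->.
have [ne01 ne02 ne12] : [/\ pt t a != pt t a.+1, pt t a != pt t a.+2 & pt t a.+1 != pt t a.+2].
  by split; apply: pti => //; lia.
have Sgt c A B r' := @Sg_tau _ _ _ _ p0 p_not_root1 nu_theta nu_p _ _ _ _ kl Fout c A B r'.
have tt A B A' B' r' w' := @tau_tau _ _ _ _ _ _ _ _ kl Fout A B A' B' r' w'.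
have gi : good i.
  by rewrite goodE -(eq_tupf wi); exact: (wordf_good p0 p_not_root1 nu_theta).
have mixed : ~~ ((sg t a == sg t a.+1) && (sg t a == sg t a.+2)) ->
    braid_coef p (matrix_matrix__canonical__GRing_PzRing R #|{: T}|) a i = 0.
  move=> mix; apply: (@braid_coef_mixed _ p m good pos special) => //.
  - exact: (good_arrow p0 p_not_root1).
  - exact: (good_spec3 p0 p_not_root1 nu_p).
  - by rewrite -!wi // !(wT_pos _ wJ).
have N1 : (sg t a == ~~ sg t a) = false by case: (sg t a).
have N2 : (~~ sg t a == sg t a) = false by case: (sg t a).
have swl c : swapn c c = c.+1 by rewrite /swapn eqxx.
have swr c : swapn c c.+1 = c by rewrite /swapn eqxx ifN //; apply/eqP; lia.
have swo c l : l != c -> l != c.+1 -> swapn c l = l.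
  by rewrite /swapn => /negbTE-> /negbTE->.
have al : a.+2 != a by lia.
have al1 : a.+2 != a.+1 by lia.
have la : a != a.+1 by lia.
have la2 : a != a.+2 by lia.
have eq_or e e' : (e == e') || (e' == ~~ e) by case: e; case: e'.
have /orP[/eqP e1|/eqP e1] := eq_or (sg t a) (sg t a.+1);
  have /orP[/eqP e2|/eqP e2] := eq_or (sg t a) (sg t a.+2).
- have e12 : sg t a.+1 = sg t a.+2 by rewrite -e1.
  have [cm E] := pt_same am1 e1; have [dm E'] := pt_same am e12.
  rewrite !(swT_same (a := a)) ?(swT_same (a := a.+1)) // -?e1 -?e2 !eqxx.
  move: cm E dm E'; set c := minn (pt t a) _; set d := minn (pt t a.+1) _ => cm E dm E'.
  have bc (e0 e' : bool) : (if i a == i a.+2 then e0%:R - e'%:R else 0 : 'M[R]_N) *m column t r =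
      column t ((if i a == i a.+2 then e0%:R - e'%:R else 0) * r).
    by case: ifP => _; rewrite ?bool_column // mul0mx mul0r column0.
  rewrite /braid_coef bc -!wi // /wT /wordf -!/(pt _ _) -e1 -e2 -columnD; congr (column _ _).
  case e0: (sg t a) E E' => -[c0 c1]; rewrite -?e1 e0 => -[d1 d2].
    have dE : d = c.+1 by rewrite -d1.
    rewrite c0 c1 d2 dE (braid_at kl wr) //; last by lia.
  have cE : c = d.+1 by rewrite -d1.
  rewrite c0 c1 d2 cE (braid_at kl wr) //; last by lia.
  rewrite -[LHS]addr0 -addrA; congr (_ + _); rewrite -mulrDl /braid_coef.
  rewrite (inj_eq invr_inj) eq_sym !arrowV //; case: eqP => [->|_].
    by rewrite -[X in _ + X]opprB subrr mul0r.
  by rewrite addr0 mul0r.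
- have [cm _] := pt_same am1 e1; set c := minn (pt t a) (pt t a.+1) in cm *.
  have c0 : swapn c (pt t a) = pt t a.+1 by rewrite swapn_pt // swl.
  have c1 : swapn c (pt t a.+1) = pt t a by rewrite swapn_pt // swr.
  have c2 : swapn c (pt t a.+2) = pt t a.+2 by rewrite swapn_pt // swo.
  rewrite mixed; last by rewrite -e1 e2 N1 andbF.
  rewrite mul0mx addr0 -e1 e2 !(eqxx, N1, N2) /= -/c.
  congr (column _ _); case: ifP => _; first by rewrite !mul1r.
  rewrite (Sgt _ _ _ _ _ cm P0m P2m ne02 (wt_tau kl Fout P1m P2m wr)).
  rewrite (Sgt _ _ _ _ _ cm P1m P2m ne12 wr) c0 c1 c2.
  exact: (tt _ _ _ _ _ _ P1m P2m P0m P2m (wt_s kl cm wr)).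
- have e02 : sg (swT a.+1 t) a = sg (swT a.+1 t) a.+1.
    by case: str => -[-> -> _] _.
  have [cm _] := pt_same am1 e02; have [_ [q0 q1 q2]] := str.
  have e12 : (sg t a.+1 == sg t a.+2) = false by rewrite e1 -e2 N2.
  rewrite e12 in q0 q1 q2; rewrite q0 q1 in cm; set c := minn (pt t a) (pt t a.+2) in cm *.
  have c0 : swapn c (pt t a) = pt t a.+2.
    by rewrite /c -q0 -q1 swapn_pt // swl.
  have c2 : swapn c (pt t a.+2) = pt t a.
    by rewrite /c -q0 -q1 swapn_pt // swr.
  have c1 : swapn c (pt t a.+1) = pt t a.+1.
    by rewrite /c -q2 -{1}q0 -{1}q1 swapn_pt // swo.
  rewrite mixed; last by rewrite e1 N1.
  rewrite mul0mx addr0 -e2 e1 !(eqxx, N1, N2) /= -/c.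
  congr (column _ _).
  have [sb|sb] := eqVneq (sg t a) b.
    have -> : (~~ sg t a == b) = false by rewrite -sb N2.
    by rewrite !mul1r (Sgt _ _ _ _ _ cm P1m P2m ne12 wr) c1 c2.
  have -> : ~~ sg t a == b by move: sb; case: (sg t a); case: (b).
  rewrite !mul1r (Sgt _ _ _ _ _ cm P0m P1m ne01 wr) c0 c1 //.
- have e12 : sg t a.+1 = sg t a.+2 by rewrite e1 e2.
  have [cm _] := pt_same am e12; set c := minn (pt t a.+1) (pt t a.+2) in cm *.
  have c0 : swapn c (pt t a) = pt t a by rewrite swapn_pt // swo.
  have c1 : swapn c (pt t a.+1) = pt t a.+2 by rewrite swapn_pt // swl.
  have c2 : swapn c (pt t a.+2) = pt t a.+1 by rewrite swapn_pt // swr.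
  rewrite mixed; last by rewrite e1 N1.
  rewrite mul0mx addr0 e1 e2 !(eqxx, N1, N2) /= -/c.
  congr (column _ _); case: ifP => _; first by rewrite !mul1r.
  rewrite (Sgt _ _ _ _ _ cm P0m P2m ne02 (wt_tau kl Fout P0m P1m wr)).
  rewrite (Sgt _ _ _ _ _ cm P0m P1m ne01 wr) c0 c1 c2.
  exact: (tt _ _ _ _ _ _ P0m P2m P0m P1m (wt_s kl cm wr)).
Qed.

Lemma tupf_swapK a (f g : nat -> k) : (a.+1 < m)%N ->
  (tupf m (swapf a f) == tupf m (swapf a g)) = (tupf m f == tupf m g).
Proof.
move=> am; have am1 : (a < m.-1)%N by lia.
rewrite -[a in swapf a f]/(val (Ordinal am1)) -[a in swapf a g]/(val (Ordinal am1)) !tupf_swap.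
apply: (inj_eq (can_inj (g := swap_word (Ordinal am1)) _)) => u.
by apply: eq_from_tnth => l; rewrite !tnth_mktuple /swap_pos tpermK.
Qed.

Lemma wt_X t w l r : (l < m)%N -> wt w r -> wt w ((-1) ^+ (~~ sg t l) * (X (pt t l) * r)).
Proof.
move=> lm wr; have wX := wt_x kl (pt_lt t lm) wr.
by rewrite wtE sign_mul wX.
Qed.

Lemma M_klr_like : klr_like p m Mx Ms ME.
Proof.
split.
- move=> i; apply: mx_test => t w r wJ wr; rewrite mul_column !(ME_column _ _ wJ wr).
  by case: ifP => E; rewrite ?mulmx0 // (ME_column _ _ wJ wr) E.
- move=> i i' l lm ii; apply: mx_test => t w r wJ wr; rewrite mul_column !(ME_column _ _ wJ wr) mul0mx.
  case: eqP => E; rewrite ?mulmx0 // (ME_column _ _ wJ wr) ifN // E.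
  by apply: contra ii => /eqP E'; rewrite -(nth_tupf 1 i lm) -E' nth_tupf.
- by move=> i i' ii; rewrite /ME (eq_tupf ii).
- move=> a i am; apply: mx_test => t w r wJ wr; rewrite !mul_column (ME_column _ _ wJ wr) !Ms_column.
  have [w' [wJ' wr' wE]] := omega_wt t am wJ wr.
  rewrite (ME_column _ _ wJ' wr') (eq_tupf wE) tupf_swapK //.
  by case: ifP => _; rewrite ?Ms_column // mulmx0.
- move=> l i lm; apply: mx_test => t w r wJ wr; rewrite !mul_column (ME_column _ _ wJ wr) Mx_column.
  rewrite (ME_column _ _ wJ (wt_X t lm wr)).
  by case: ifP => _; rewrite ?Mx_column // mulmx0.
- move=> l l' lm lm'; apply: mx_test => t w r wJ wr; rewrite !mul_column !Mx_column; congr (column _ _).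
  have XX : X (pt t l) * (X (pt t l') * r) = X (pt t l') * (X (pt t l) * r).
    by rewrite !mulrA (kl_xx kl (pt_lt t lm) (pt_lt t lm')).
  by case: (sg t l); case: (sg t l');
    rewrite /= ?expr0 ?expr1 ?mul1r ?mulN1r ?mulrN ?opprK ?XX.
- exact: M_ss.
- exact: M_far.
- exact: M_br.
- exact: M_sx.
Qed.

Lemma M_pE i : Mpi * ME i = ME (invhead i) * Mpi.
Proof.
apply: mx_test => t w r wJ wr; rewrite !mul_column (ME_column _ _ wJ wr) Mpi_column (ME_column _ _ wJ wr).
have -> : (tupf m (wT (flT t) w) == tupf m (invhead i)) = (tupf m (wT t w) == tupf m i).
  have E l : (l < m)%N -> wT (flT t) w l = invhead (wT t w) l by exact: wT_flT.
  rewrite (eq_tupf E); apply/eqP/eqP => ti; apply: eq_tupf => l lm.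
    have := congr1 (fun u : m.-tuple k => nth 1 u l) ti; rewrite !nth_tupf // /invhead.
    by case: eqP => [->|] // /invr_inj.
  have tn n : (n < m)%N -> wT t w n = i n by move=> nm; rewrite -(nth_tupf 1 (wT t w) nm) ti nth_tupf.
  by rewrite /invhead; case: eqP => [l0|_]; rewrite tn // -l0.
by case: ifP => _; rewrite ?Mpi_column // mulmx0.
Qed.

Lemma flTK t : flT (flT t) = t.
Proof.
apply: eq_sg => l lm; have m0 : (0 < m)%N by lia.
rewrite sg_flT // /flip0; case: eqP => [->|/eqP/negbTE l0]; rewrite sg_flT // /flip0 ?eqxx ?negbK //.
by rewrite l0.
Qed.

(** One of the two crossings acts on equal signs and the other on opposite signs, as
    pi changes the first sign in between. *)
Lemma M_sp : (1 < m)%N -> Ms 0 * (Mpi * (Ms 0 * Mpi)) = Mpi * (Ms 0 * (Mpi * Ms 0)).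
Proof.
move=> m1; have m0 := ltnW m1; apply: mx_test => t w r wJ wr.
rewrite !(mul_column, Ms_column, Mpi_column).
have sw0 : swapn 0 0 = 1%N by [].
have sw1 : swapn 0 1 = 0%N by [].
have fl0 u : sg (flT u) 0 = ~~ sg u 0 by rewrite sg_flT.
have fl1 u : sg (flT u) 1 = sg u 1 by rewrite sg_flT.
have -> : swT 0 (flT (swT 0 (flT t))) = flT (swT 0 (flT (swT 0 t))).
  apply: eq_sg => l lm; rewrite sg_swT // !sg_flT ?swapn_lt // /flip0.
  rewrite !sg_swT ?swapn_lt // !sg_flT ?swapn_lt // /flip0 !sg_swT ?swapn_lt //.
  by case: l lm => [|[|l]].
congr (column _ _).
have ptf u l : (l < m)%N -> pt (flT u) l = pt u l by exact: pt_flT.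
have [P0m P1m] := (pt_lt t m0, pt_lt t m1).
have ne10 : pt t 1 != pt t 0 by apply/eqP => /pt_inj; lia.
have ne01 : pt t 0 != pt t 1 by rewrite eq_sym.
have Sgt c A B r' := @Sg_tau _ _ _ _ p0 p_not_root1 nu_theta nu_p _ _ _ _ kl Fout c A B r'.
have [e01|e01] := eqVneq (sg t 0) (sg t 1).
  have [cm _] := pt_same m1 e01; set c := minn (pt t 0) (pt t 1) in cm *.
  have c0 : swapn c (pt t 0) = pt t 1 by rewrite swapn_pt // sw0.
  have c1 : swapn c (pt t 1) = pt t 0 by rewrite swapn_pt // sw1.
  have fne : sg (flT t) 0 != sg (flT t) 1 by rewrite fl0 fl1 e01; case: (sg t 1).
  rewrite (swT_same m1 e01) /omega !fl0 !fl1 !ptf // !pt_swT // !ptf // !sg_swT //.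
  rewrite !sw0 !sw1 !fl0 !fl1 e01 eqxx.
  have -> : (~~ sg t 1 == sg t 1) = false by case: (sg t 1).
  rewrite eqxx (minnC (pt t 1)) -/c; case: ifP => _; first by rewrite !mul1r.
  rewrite (Sgt _ _ _ _ _ cm P0m P1m ne01 wr) c0 c1.
  exact: (tau_sym kl Fout P1m P0m (wt_s kl cm wr)).
have f01 : sg (flT t) 0 = sg (flT t) 1.
  by rewrite fl0 fl1; move: e01; case: (sg t 0); case: (sg t 1).
have [cm _] := pt_same m1 f01; rewrite !ptf // in cm; set c := minn (pt t 0) (pt t 1) in cm *.
have c0 : swapn c (pt t 0) = pt t 1.
  by rewrite /c -!(ptf t) // swapn_pt // sw0.
have c1 : swapn c (pt t 1) = pt t 0.
  by rewrite /c -!(ptf t) // swapn_pt // sw1.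
have e0E : sg t 0 = ~~ sg t 1 by move: e01; case: (sg t 0); case: (sg t 1).
rewrite (swT_same m1 f01) flTK /omega !fl0 !fl1 !ptf // !pt_swT // !sg_swT //.
rewrite !sw0 !sw1 e0E negbK !eqxx.
have -> : (~~ sg t 1 == sg t 1) = false by case: (sg t 1).
rewrite (minnC (pt t 1)) -/c; case: ifP => _; first by rewrite !mul1r.
rewrite (Sgt _ _ _ _ _ cm P0m P1m ne01 wr) c0 c1.
exact: (tau_sym kl Fout P0m P1m (wt_s kl cm wr)).
Qed.

Lemma M_vv_like : vv_like p m Mx Ms ME Mpi.
Proof.
split.
- exact: M_klr_like.
- exact: M_pE.
- by apply: mx_test => t w r wJ wr; rewrite mul_column !Mpi_column flTK mul1mx.
- move=> m0; apply: mx_test => t w r wJ wr; rewrite !mul_column mulNmx Mx_column !Mpi_column Mx_column.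
  rewrite pt_flT // sg_flT // /flip0 eqxx -columnN -mulNr; congr (column _ (_ * _)).
  by case: (sg t 0); rewrite ?expr0 ?expr1 ?opprK.
- move=> l l0 lm; apply: mx_test => t w r wJ wr; rewrite !mul_column Mx_column !Mpi_column Mx_column.
  by rewrite pt_flT // sg_flT // /flip0 ifN //; apply/eqP; lia.
- exact: M_sp.
- move=> a a0 am; apply: mx_test => t w r wJ wr; rewrite !mul_column Ms_column !Mpi_column Ms_column flT_swT //.
  have am' := ltnW am; have a0' : (a == 0%N) = false by lia.
  by rewrite /omega !sg_flT // /flip0 a0' !pt_flT.
Qed.

Local Notation Th := (theta_words p m nu).

Lemma ME1 : \sum_(i : Th) ME (nth 1 (val i)) = 1.
Proof.
apply: mx_test => t w r wJ wr; rewrite mulmx_suml mul1mx.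
have gw : tupf m (wT t w) \in Th by exact: (wordf_good p0 p_not_root1 nu_theta).
rewrite (bigD1 [` gw]%fset) // (ME_column _ _ wJ wr) tupf_nth eqxx big1 => [|i iw].
  exact: addr0.
rewrite (ME_column _ _ wJ wr) tupf_nth ifN //; apply: contra iw => /eqP wi.
by apply/eqP/val_inj.
Qed.

End SignMatrices.

(** * The generators of W *)
Section VVData.
Variables (k : fieldType) (p : k) (m : nat) (nu : {fsfun k -> nat with 0%N}).
Hypotheses (p0 : p != 0) (p_not_root1 : forall n : nat, (0 < n)%N -> p ^+ n != 1).

Let p4 : p ^+ 4 != 1. Proof. exact: p_not_root1. Qed.

Local Notation Th := (theta_words p m nu).
Local Notation W := (VV p m nu).

Definition vv_x (l : 'I_m) : W := pgen (@VV_rel k p m nu) (VV_klr (KLR_x l)).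
Definition vv_s (a : 'I_m.-1) : W := pgen (@VV_rel k p m nu) (VV_klr (KLR_s a)).
Definition vv_e (i : Th) : W := pgen (@VV_rel k p m nu) (VV_klr (KLR_e i)).
Definition vv_pi : W := pgen (@VV_rel k p m nu) VV_pi.

Lemma VV_klr_relP u v : klr_rel p vv_x vv_s vv_e u v -> u = v.
Proof.
case/(@klr_rel_lift _ _ _ _ _ _ (rqpi (@VV_rel k p m nu))
  (fun l => fgen k (VV_klr (KLR_x l))) (fun a => fgen k (VV_klr (KLR_s a)))
  (fun i => fgen k (VV_klr (KLR_e i)))).
by move=> u0 [v0 [uv0 -> ->]]; apply: presented_rel; exact: vv_klr.
Qed.

Lemma theta_arrow (i : m.-tuple k) y z : i \in Th -> y \in i -> z \in i ->
  arrow p y z -> ~~ arrow p z y.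
Proof. by move=> /mem_theta_words[iI _] /iI yI _; apply: arrow_asym. Qed.

Lemma theta_swap (a : 'I_m.-1) (i : m.-tuple k) : i \in Th -> swap_word a i \in Th.
Proof.
rewrite -{1}(tupf_nth 1 i) -/(good p m nu _) => gi.
rewrite -(tupf_nth 1 i) -tupf_swap; apply: good_swap gi.
by case: a => a /=; lia.
Qed.

Definition Wx := nat_x vv_x.
Definition Ws := nat_s vv_s.
Definition WE := nat_e vv_e.

Lemma W_klr_like : klr_like p m Wx Ws WE.
Proof. exact: nat_klr_like VV_klr_relP theta_swap theta_arrow. Qed.

Lemma WE1 : \sum_(i : Th) WE (nth 1 (val i)) = 1.
Proof.
rewrite -(VV_klr_relP (klr_e1 _ _ _ _)); apply: eq_bigr => i _.
by apply: nat_eE; rewrite tupf_nth.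
Qed.

Lemma WE_out w : ~~ good p m nu w -> WE w = 0.
Proof. exact: nat_e_out. Qed.

Lemma WE_good w (gw : good p m nu w) : WE w = vv_e ([` gw]%fset).
Proof. exact: nat_eE. Qed.

Let pr : {rmorphism free_alg k (vv_gen m Th) -> W} := rqpi (@VV_rel k p m nu).

Let pr_eq u v : VV_rel u v -> pr u = pr v.
Proof. exact: presented_rel. Qed.

Lemma tupf_invhead w : tupf m (invhead w) = invert_head (tupf m w) :> m.-tuple k.
Proof.
by apply: eq_from_tnth => l; rewrite !tnth_mktuple /invhead; case: eqP => // ->.
Qed.

(** The relations of W are imposed on each idempotent; as these sum to 1 they hold
    without idempotents. *)
Lemma sum_WE (u v : W) : (forall w, good p m nu w -> u * WE w = v * WE w) -> u = v.
Proof.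
move=> uv; rewrite -[u]mulr1 -[v]mulr1 -WE1 !mulr_sumr; apply: eq_bigr => i _.
by apply: uv; rewrite /good tupf_nth; exact: valP.
Qed.

Lemma W_vv_like : vv_like p m Wx Ws WE vv_pi.
Proof.
have kl := W_klr_like.
split.
- exact: kl.
- move=> w; have [gw|gw] := boolP (good p m nu w); last first.
    rewrite (WE_out gw) mulr0 WE_out ?mul0r //; apply: contra gw.
    move=> /(good_invhead p0); rewrite /good (@eq_tupf _ _ _ w) // => l _.
    by rewrite /invhead; case: eqP => [->|] //=; rewrite invrK.
  have giw := good_invhead p0 gw.
  rewrite (WE_good gw) (WE_good giw).
  rewrite -!(rmorphM pr); apply: pr_eq; apply: vv_pe.
  exact: tupf_invhead.
- apply: sum_WE => w gw; rewrite mul1r -expr2 (WE_good gw).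
  rewrite -(rmorphXn pr) -!(rmorphM pr).
  by apply: pr_eq; exact: vv_ppe.
- move=> m0; rewrite (nat_xE vv_x (Ordinal m0) : Wx 0 = _).
  rewrite -(rmorphN pr) -!(rmorphM pr).
  by apply: pr_eq; exact: vv_px0.
- move=> l l0 lm; rewrite (nat_xE vv_x (Ordinal lm) : Wx l = _).
  rewrite -!(rmorphM pr).
  by apply: pr_eq; exact: vv_px.
- move=> m1; have m1' : (0 < m.-1)%N by lia.
  rewrite (nat_sE vv_s (Ordinal m1') : Ws 0 = _).
  apply: sum_WE => w gw; rewrite (WE_good gw).
  have sq (A : pzRingType) (u v w' : A) : (u * v) ^+ 2 * w' = (v * u) ^+ 2 * w' ->
      u * (v * (u * v)) * w' = v * (u * (v * u)) * w'.
    by rewrite !expr2 !mulrA.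
  pose o := Ordinal m1'; pose i : Th := [` gw]%fset.
  have H1 : (vv_s o * vv_pi) ^+ 2 * vv_e i = (vv_pi * vv_s o) ^+ 2 * vv_e i.
    have hm (u v w' : free_alg k (vv_gen m Th)) :
        (pr u * pr v) ^+ 2 * pr w' = pr ((u * v) ^+ 2 * w').
      by rewrite rmorphM rmorphXn rmorphM.
    pose gs := fgen k (VV_klr (KLR_s o)) : free_alg k (vv_gen m Th).
    pose gi := fgen k (VV_klr (KLR_e i)) : free_alg k (vv_gen m Th).
    pose gp := fgen k VV_pi : free_alg k (vv_gen m Th).
    have H : pr ((gs * gp) ^+ 2 * gi) = pr ((gp * gs) ^+ 2 * gi).
      by apply: pr_eq; apply: vv_sp.
    exact: (etrans (hm gs gp gi) (etrans H (esym (hm gp gs gi)))).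
  exact: (sq W _ _ _ H1).
- move=> a a0 am; have am' : (a < m.-1)%N by lia.
  rewrite (nat_sE vv_s (Ordinal am') : Ws a = _).
  rewrite -!(rmorphM pr).
  by apply: pr_eq; exact: vv_ps.
Qed.

End VVData.

(** * The two ends of W *)

(** A word of R becomes a word of the end of sign b by itself or by reversing and
    inverting it, and positions and crossings are reversed accordingly. *)
Section EndPositions.
Variables (k : fieldType) (m : nat).

Definition end_word (b : bool) (w : nat -> k) := if b then w else revinv m w.
Definition end_pos (b : bool) l := if b then l else (m.-1 - l)%N.
Definition end_cross (b : bool) a := if b then a else (m - a.+2)%N.

Lemma end_posK b l : (l < m)%N -> end_pos b (end_pos b l) = l.
Proof. by case: b => //= lm; rewrite subKn //; lia. Qed.

Lemma end_pos_lt b l : (l < m)%N -> (end_pos b l < m)%N.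
Proof. by case: b => //= lm; lia. Qed.

Lemma end_wordK b w l : (l < m)%N -> end_word b (end_word b w) l = w l.
Proof. by case: b => //= lm; rewrite /revinv invrK subKn //; lia. Qed.

Lemma word_eqP (w w' : nat -> k) :
  (forall l, (l < m)%N -> w l = w' l) \/ exists2 l, (l < m)%N & w l != w' l.
Proof.
have [/existsP[l ww]|] := boolP [exists l : 'I_m, w l != w' l]; first by right; exists l.
rewrite negb_exists => /forallP ww; left=> l lm.
by have := ww (Ordinal lm); rewrite negbK => /eqP.
Qed.

End EndPositions.

Section Ends.
Variables (k : fieldType) (p : k) (m : nat) (nu : {fsfun k -> nat with 0%N}).
Hypotheses (p0 : p != 0) (p_not_root1 : forall n : nat, (0 < n)%N -> p ^+ n != 1).
Hypotheses (nu_theta : in_theta_NI p nu) (nu_p : nu p = 2%N).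
Local Notation J := (words p m (dv_plus p nu)).
Local Notation Th := (theta_words p m nu).
Local Notation good := (good p m nu).
Local Notation pos := (pos p).
Local Notation special := (special p).
Local Notation end_word := (end_word m).
Local Notation end_pos := (end_pos m).
Local Notation end_cross := (end_cross m).

Definition allsign b (w : nat -> k) := forall l, (l < m)%N -> pos (w l) = b.
Lemma end_word_good b w : tupf m w \in J -> good (end_word b w) /\ allsign b (end_word b w).
Proof.
move=> wJ; have gw : good w.
  apply: good_intro => [i im|y]; first exact: J_Iset wJ im.
  by rewrite signed_countE -(J_signed_count p0 p_not_root1 nu_theta y wJ).
case: b => /=; first by split=> // l lm; exact: J_pos wJ lm.
split=> [|l lm]; first exact: good_revinv.
by rewrite /revinv (good_posV p0 p_not_root1 gw) ?(J_pos wJ) //; lia.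
Qed.

Lemma end_word_J b w : good w -> allsign b w -> tupf m (end_word b w) \in J.
Proof.
move=> gw sw; apply: (good_J p0 p_not_root1).
  by case: b sw => // _; exact: good_revinv.
case: b sw => //= sw l lm; have lm' : (m.-1 - l < m)%N by lia.
by rewrite /revinv (good_posV p0 p_not_root1 gw) ?sw.
Qed.

Lemma good_two w l1 l2 l : good w -> (l1 < l2)%N -> (l2 < m)%N -> (l < m)%N ->
  special (w l1) -> special (w l2) -> special (w l) -> l = l1 \/ l = l2.
Proof.
move=> gw l12 l2m lm s1 s2 sl.
case: (ltngtP l l1) => [l1'|l1'|->]; [| |by left].
  by case: (good_spec3 p0 p_not_root1 nu_p gw l1' l12 l2m sl s1 s2).
case: (ltngtP l l2) => [l2'|l2'|->]; [| |by right].
  by case: (good_spec3 p0 p_not_root1 nu_p gw l1' l2' l2m s1 sl s2).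
by case: (good_spec3 p0 p_not_root1 nu_p gw l12 l2' lm s1 s2 sl).
Qed.

Variables (W : alg k) (x s : nat -> W) (E : (nat -> k) -> W) (pi : W).
Hypothesis like : vv_like p m x s E pi.
Hypothesis E1 : \sum_(i : Th) E (nth 1 (val i)) = 1.
Hypothesis W_ind : forall P : W -> Prop,
  (forall c, P (alg_scalar W c)) -> (forall l, (l < m)%N -> P (x l)) ->
  (forall a, (a.+1 < m)%N -> P (s a)) -> (forall w, good w -> P (E w)) -> P pi ->
  (forall u v, P u -> P v -> P (u + v)) -> (forall u v, P u -> P v -> P (u * v)) ->
  forall u, P u.

Variables (R : alg k) (X Sg : nat -> R) (F : (nat -> k) -> R).
Hypothesis F1 : \sum_(j : J) F (nth 1 (val j)) = 1.
Hypothesis R_ind : forall P : R -> Prop,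
  (forall c, P (alg_scalar R c)) -> (forall l, (l < m)%N -> P (X l)) ->
  (forall a, (a.+1 < m)%N -> P (Sg a)) -> (forall w, tupf m w \in J -> P (F w)) ->
  (forall u v, P u -> P v -> P (u + v)) -> (forall u v, P u -> P v -> P (u * v)) ->
  forall u, P u.

Variable phi : bool -> R -> W.
Hypothesis phiD : forall b r t, phi b (r + t) = phi b r + phi b t.
Hypothesis phiM : forall b r t, phi b (r * t) = phi b r * phi b t.
Local Notation c b := (phi b 1).
Hypothesis phi_scalar : forall b a, phi b (alg_scalar R a) = alg_scalar W a * c b.
Hypothesis phi_X : forall b l, (l < m)%N ->
  phi b (X l) = (-1) ^+ (~~ b) * x (end_pos b l) * c b.
Hypothesis phi_S : forall b a, (a.+1 < m)%N -> phi b (Sg a) = s (end_cross b a) * c b.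
Hypothesis phi_F : forall b w, tupf m w \in J -> phi b (F w) = E (end_word b w).

Let kl := vl_klr like.
Local Notation wt := (wt E).
Local Notation straight := (straight s pi pos).
Local Notation full := (full_turn s pi m).

Let phi0 b : phi b 0 = 0.
Proof. by apply: (addrI (phi b 0)); rewrite -phiD !addr0. Qed.

Let phiN b r : phi b (- r) = - phi b r.
Proof. by apply: (addrI (phi b r)); rewrite -phiD !subrr phi0. Qed.

Let phi_sum b (I : finType) (P : pred I) (f : I -> R) :
  phi b (\sum_(i | P i) f i) = \sum_(i | P i) phi b (f i).
Proof. exact: (big_morph _ (phiD b) (phi0 b)). Qed.

Lemma end_idemE b : c b = \sum_(j : J) E (end_word b (nth 1 (val j))).
Proof.
rewrite -F1 phi_sum; apply: eq_bigr => j _.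
by rewrite phi_F // tupf_nth; exact: valP.
Qed.

Lemma E_word b w : good w -> allsign b w -> E w = phi b (F (end_word b w)).
Proof.
move=> gw sw; rewrite phi_F; last exact: end_word_J.
by apply: (kl_Eext kl) => l lm; rewrite end_wordK.
Qed.

Lemma end_idem_wt b w u : good w -> allsign b w -> wt w u -> c b * u = u.
Proof.
move=> gw sw wu; rewrite -wu (E_word gw sw) mulrA -phiM mul1r.
by rewrite -(E_word gw sw).
Qed.

Lemma E_c b w : good w -> allsign b w -> E w * c b = E w.
Proof. by move=> gw sw; rewrite (E_word gw sw) -phiM mulr1. Qed.

Lemma end_idem_test b u v : (forall w, good w -> allsign b w -> u * E w = v * E w) ->
  u * c b = v * c b.
Proof.
move=> uv; rewrite end_idemE !mulr_sumr; apply: eq_bigr => j _.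
have jJ : tupf m (nth 1 (val j)) \in J by rewrite tupf_nth; exact: valP.
by have [gj sj] := end_word_good b jJ; exact: uv.
Qed.

Lemma end_idem_out b w : (0 < m)%N -> good w -> allsign (~~ b) w -> c b * E w = 0.
Proof.
move=> m0 gw sw; rewrite end_idemE mulr_suml big1 // => j _.
have jJ : tupf m (nth 1 (val j)) \in J by rewrite tupf_nth; exact: valP.
have [gj sj] := end_word_good b jJ; apply: (kl_E0 kl m0).
by apply: contraT => /negPn/eqP jw; have := sj _ m0; rewrite jw sw //; case: (b).
Qed.

Lemma end_idem_ortho b : (0 < m)%N -> c b * c (~~ b) = 0.
Proof.
move=> m0; rewrite -[RHS](mul0r (c (~~ b))); apply: end_idem_test => w gw sw.
by rewrite mul0r end_idem_out.
Qed.

(** ** The full turn between the ends *)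

Let gswap := @good_swap k p m nu.
Let ginv := @good_invhead k p m nu p0.
Let posV := @good_posV k p m nu p0 p_not_root1.
Let arrM := @good_arrow k p m nu p0 p_not_root1.
Let sp3 := @good_spec3 k p m nu p0 p_not_root1 nu_p.
Let specV := @specN k p.

Lemma allsign_bad b w n : allsign b w -> (n <= m)%N ->
  forall l, (l < n)%N -> bad pos (~~ b) (w l).
Proof. by move=> sw nm l ln; rewrite /bad sw; [case: b {sw} | lia]. Qed.

Lemma straight_allsign b w : allsign b w -> straight (~~ b) m w = full.
Proof. by move=> sw; apply/straight_full/(allsign_bad sw). Qed.

Lemma bads_allsign b w a : allsign b w -> (a <= m)%N -> bads pos (~~ b) w a m = (m - a)%N.
Proof.
move=> sw am; rewrite /bads (eq_big_nat _ _ (F2 := fun=> 1%N)) => [|i /andP[_ im]].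
  by rewrite sum_nat_const_nat muln1.
by rewrite (allsign_bad sw (leqnn m) im).
Qed.

Lemma straightw_end b w : good w -> good (straightw pos b m w) /\ allsign b (straightw pos b m w).
Proof.
move=> gw; split=> [|l lm]; first exact: (good_straightw _ gswap ginv).
have := straightw_lt gswap ginv posV b (leqnn m) gw lm.
by rewrite /bad negbK => /eqP.
Qed.

Lemma straight_c b w u : good w -> wt w u -> c b * (straight b m w * u) = straight b m w * u.
Proof.
move=> gw wu; have [gs ss] := straightw_end b gw.
by apply: (end_idem_wt gs ss); exact: (wt_straight like).
Qed.

Lemma full_c b w u : good w -> allsign b w -> wt w u -> c (~~ b) * (full * u) = full * u.
Proof. by move=> gw sw wu; rewrite -(straight_allsign sw) straight_c. Qed.

Lemma wt_full b w u : good w -> allsign b w -> wt w u -> wt (revinv m w) (full * u).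
Proof.
move=> gw sw wu; have := wt_straight like pos (~~ b) (leqnn m) wu.
rewrite (straight_allsign sw); apply: (wt_ext kl) => l lm.
by rewrite (straightw_full (leqnn m) (allsign_bad sw (leqnn m)) lm).
Qed.

(** It suffices to compare both sides on generators of R and on the idempotents of
    the end b. There all letters are bad, and the straightening lemmas reverse
    positions and crossings. *)
Lemma turn_phi b r : full * phi b r = phi (~~ b) r * (full * c b).
Proof.
have cc : c b * c b = c b by rewrite -phiM mulr1.
have cfull : c (~~ b) * (full * c b) = full * c b.
  by rewrite mulrA; apply: end_idem_test => w gw sw; rewrite -mulrA (full_c gw sw) //; exact: wt_E kl _.
have key u v : u * c b = u -> (forall w, good w -> allsign b w ->
    full * (u * E w) = v * (full * E w)) -> full * u = v * (full * c b).
  move=> uc uv; rewrite -uc !mulrA; apply: end_idem_test => w gw sw.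
  by rewrite -!mulrA uv.
elim/R_ind: r => [a|l lm|a am|w wJ|r t IHr IHt|r t IHr IHt].
- by rewrite !phi_scalar -mulrA cfull mulrA -alg_central mulrA.
- rewrite !phi_X //; apply: key => [|w gw sw]; first by rewrite -!mulrA cc.
  have lm' := end_pos_lt b lm.
  have wE := wt_E kl w; rewrite -(mulrA _ (c b)) (end_idem_wt gw sw wE).
  rewrite -(mulrA _ (c (~~ b))) (full_c gw sw wE) -(mulrA _ (x _)).
  have xE := straight_x like gswap ginv posV (~~ b) lm' (leqnn m) gw wE.
  rewrite (straight_allsign sw) bads_allsign // (allsign_bad sw (leqnn m) lm') in xE.
  rewrite mulrA (commr_sign full) -mulrA xE; set v := full * E w; clearbody v.
  rewrite add0n expr1 mulN1r mulrA.
  case: (b) => /=.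
    by rewrite mul1r mulN1r; congr (- x _ * _); lia.
  by rewrite expr1 mulN1r opprK mul1r; congr (x _ * _); lia.
- rewrite !phi_S //; apply: key => [|w gw sw]; first by rewrite -mulrA cc.
  have wE := wt_E kl w; rewrite -(mulrA _ (c b)) (end_idem_wt gw sw wE).
  rewrite -(mulrA _ (c (~~ b))) (full_c gw sw wE).
  have am' : ((end_cross b a).+1 < m)%N by case: (b) => //=; lia.
  have ssw : allsign b (swapf (end_cross b a) w).
    by move=> l lm; rewrite /swapf sw // swapn_lt.
  have all_bad := allsign_bad sw (leqnn m).
  have sE := straight_s_same like gswap ginv posV arrM sp3 am' (leqnn m) gw wE (b := ~~ b).
  rewrite (straight_allsign sw) (straight_allsign ssw) bads_allsign // in sE.
  rewrite !all_bad // in sE; last exact: ltnW.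
  rewrite sE // add0n; congr (s _ * _).
  by case: (b) => //=; lia.
- have [ge se] := end_word_good b wJ.
  rewrite !phi_F //; apply: key => [|w' gw sw]; first exact: E_c.
  have wE := wt_E kl w'; have wfE := wt_full gw sw wE.
  have [ww|[l lm ww]] := word_eqP m (end_word b w) w'.
    rewrite (kl_Eext kl ww) (kl_EE kl); symmetry; apply: (wt_ext kl) wfE => l lm.
    rewrite /revinv -ww; last by lia.
    by case: (b) => //=; rewrite /revinv ?invrK ?subKn //; lia.
  have lm' : (m.-1 - l < m)%N by lia.
  have wl' : end_word (~~ b) w (m.-1 - l)%N != revinv m w' (m.-1 - l)%N.
    apply: contra ww => /eqP; rewrite /revinv subKn; last by lia.
    case: (b) => /=; rewrite /revinv; first by rewrite subKn; [move/invr_inj-> | lia].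
    by move=> ->; rewrite invrK.
  by rewrite (kl_E0 kl lm ww) mulr0 -wfE mulrA (kl_E0 kl lm' wl') mul0r.
- by rewrite !phiD mulrDr IHr IHt mulrDl.
- by rewrite !phiM mulrA IHr -!mulrA -phiM mul1r IHt.
Qed.

Variable z : R.
Hypothesis zE : forall w, tupf m w \in J -> z * F w = (\sum_(l < m | w l == p) X l) * F w.

(** Both special letters of a word of the end b are the letters p of the
    corresponding word of R. *)
Lemma turn_turn b : full * (full * c b) = phi b z.
Proof.
rewrite -[z in RHS]mulr1 phiM mulrA; apply: end_idem_test => w gw sw.
have wE := wt_E kl w; have [l1 [l2 [l12 l2m s1 s2]]] := good_spec2 p0 p_not_root1 nu_p gw.
have l1m : (l1 < m)%N by lia.
rewrite -mulrA (full_turnK like gswap ginv posV arrM sp3 specV (leqnn m) gw wE sw l12 l2m s1 s2).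
rewrite l2m {2}(E_word gw sw) -phiM; have ewJ := end_word_J gw sw.
have [gew _] := end_word_good true ewJ; rewrite /= in gew.
rewrite zE // phiM -(E_word gw sw) phi_sum.
have spE l : (l < m)%N -> (end_word b w (end_pos b l) == p) = special (w l).
  move=> lm; have lm' := end_pos_lt b lm.
  rewrite -(spec_pos p0 p_not_root1 (J_pos ewJ lm')); case: (b) => //=.
  by rewrite /revinv specV subKn //; lia.
pose o1 := Ordinal (end_pos_lt b l1m); pose o2 := Ordinal (end_pos_lt b l2m).
rewrite (bigD1 o1) /= ?spE // (bigD1 o2) /= ?spE // ?s2; last first.
  by rewrite -val_eqE /=; case: (b) => /=; lia.
rewrite big1 ?addr0 => [|l /andP[/andP[/eqP wl n1] n2]]; last first.
  have lK := end_posK b (ltn_ord l); have lm := end_pos_lt b (ltn_ord l).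
  have sl : special (w (end_pos b l)) by rewrite -spE // lK wl.
  case: (good_two gw l12 l2m lm s1 s2 sl) => ll.
    by case/eqP: n1; apply: val_inj; rewrite /= -ll lK.
  by case/eqP: n2; apply: val_inj; rewrite /= -ll lK.
rewrite !phi_X ?end_pos_lt // !end_posK // -mulrDl -(mulrA _ (phi b 1)) (end_idem_wt gw sw wE).
by rewrite mulrDr.
Qed.

(** ** Fullness of the ends *)

(** For b the sign of the second special letter, this letter is not turned, so that
    the straightening towards b is invertible. *)
Lemma word_factor w : good w ->
  exists S' T, S' * (c true + c false) * T = E w.
Proof.
move=> gw; have wE := wt_E kl w.
have [l1 [l2 [l12 l2m s1 s2]]] := good_spec2 p0 p_not_root1 nu_p gw.
have m0 : (0 < m)%N by lia.
have [|S' SE] := straight_inv like gswap ginv posV arrM specV (leqnn m) gw (b := pos (w l2)).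
  move=> l l' ll lm'; apply: contraTN => /andP[sl sl'].
  have lm : (l < m)%N by lia.
  have h := good_two gw l12 l2m lm s1 s2 sl; have h' := good_two gw l12 l2m lm' s1 s2 sl'.
  by have -> : l' = l2 by [lia]; rewrite /bad eqxx.
have sc := straight_c (pos (w l2)) gw wE.
exists S', (straight (pos (w l2)) m w * E w); rewrite -mulrA mulrDl.
case: (pos (w l2)) sc (SE _ wE) => sc {}SE; rewrite -{1 2}sc.
  by rewrite (mulrA (c false)) (end_idem_ortho false m0) mul0r addr0 !sc.
by rewrite (mulrA (c true)) (end_idem_ortho true m0) mul0r add0r !sc.
Qed.

(** ** Elements between two ends *)

(** Straightening the target e(w') of e(w') u e(w) takes it to an element of R times
    the straightening of w. This property of u passes to sums and products, so
    only generators have to be checked. *)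
Section Spanning.
Variable b : bool.

Definition spanned w v := exists r, v = phi b r * (straight b m w * E w).
Definition spanning u := forall w w', good w -> good w' -> spanned w (straight b m w' * (E w' * (u * E w))).

Lemma spanned0 w : spanned w 0. Proof. by exists 0; rewrite phi0 mul0r. Qed.

Lemma spannedD w v v' : spanned w v -> spanned w v' -> spanned w (v + v').
Proof. by move=> [r ->] [r' ->]; exists (r + r'); rewrite phiD mulrDl. Qed.

Lemma spannedM w r v : spanned w v -> spanned w (phi b r * v).
Proof. by move=> [r' ->]; exists (r * r'); rewrite phiM mulrA. Qed.

Lemma spannedN w v : spanned w v -> spanned w (- v).
Proof. by move=> [r ->]; exists (- r); rewrite phiN mulNr. Qed.

Lemma spanned1 w : good w -> spanned w (straight b m w * E w).
Proof. by move=> gw; exists 1; rewrite (straight_c b gw (wt_E kl w)). Qed.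

Lemma spanning_intro u : (forall w, good w ->
  exists w'', wt w'' (u * E w) /\ spanned w (straight b m w'' * (u * E w))) -> spanning u.
Proof.
move=> uw w w' gw gw'; have [w'' [wu hw]] := uw w gw.
have [ww|[l lm ww]] := word_eqP m w' w''.
  rewrite (kl_Eext kl ww) wu (straight_ext _ _ (w' := w'')) // => l lm.
  by rewrite ww.
by rewrite -wu (mulrA (E w')) (kl_E0 kl lm ww) mul0r mulr0; exact: spanned0.
Qed.

Lemma spanned_x l w : good w -> (l < m)%N -> spanned w (straight b m w * (x l * E w)).
Proof.
move=> gw lm; have wE := wt_E kl w.
rewrite (straight_x like gswap ginv posV b lm (leqnn m) gw wE).
set i := (_ + _)%N; have im : (i < m)%N.
  by rewrite /i; have := bads_le pos b w l.+1 m; case: ifP => _; lia.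
suff xi : spanned w (x i * (straight b m w * E w)).
  by rewrite -mulrA; case: bad; rewrite ?mul1r // mulN1r; exact: spannedN.
have := spannedM (X (end_pos b i)) (spanned1 gw); rewrite phi_X ?end_pos_lt // end_posK //.
rewrite -(mulrA _ (phi b 1)) (straight_c b gw wE) -(mulrA _ (x i)); case: (b) => /=; first by rewrite mul1r.
by rewrite expr1 mulN1r => /spannedN; rewrite opprK.
Qed.

Lemma spanned_s a w : good w -> (a.+1 < m)%N ->
  spanned w (straight b m (swapf a w) * (s a * E w)).
Proof.
move=> gw am; have wE := wt_E kl w; have am' := ltnW am.
have [same|] := eqVneq (bad pos b (w a)) (bad pos b (w a.+1)).
  rewrite (straight_s_same like gswap ginv posV arrM sp3 am (leqnn m) gw wE same).
  set i := (_ + _)%N; have im : (i.+1 < m)%N.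
    by rewrite /i; have := bads_le pos b w a.+2 m; case: ifP => _; lia.
  have icm : ((end_cross b i).+1 < m)%N by case: (b) => //=; lia.
  have := spannedM (Sg (end_cross b i)) (spanned1 gw); rewrite phi_S // -(mulrA _ (phi b 1)) (straight_c b gw wE).
  by have -> // : end_cross b (end_cross b i) = i by case: (b) => //=; lia.
case ba: (bad pos b (w a)); case ba1: (bad pos b (w a.+1)) => // _.
  (* Here w is obtained by a crossing of the previous kind, so that the square of
     this crossing appears. *)
  have swK : swapf a (swapf a w) = w by apply/funext => l; rewrite /swapf swapnK.
  have := straight_s_mixed like (s a * E w) am (leqnn m) (b := b) (pos := pos) (w := swapf a w).
  rewrite swK {1 2}/swapf /swapn eqxx ifN; last by apply/eqP; lia.
  rewrite eqxx ba ba1 => /(_ isT isT) <-.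
  have pp : pos (w a) != pos (w a.+1).
    by move: ba ba1; rewrite /bad; do 2!case: pos; case: b.
  rewrite (sqr_mixed like arrM gw wE am pp); case: ifP => _.
    by case: ifP => _; rewrite mulrBl mulrBr; apply: spannedD; try apply: spannedN; exact: spanned_x.
  by rewrite mul1r; exact: spanned1.
rewrite (straight_s_mixed like) ?ba ?ba1 //; exact: spanned1.
Qed.

Lemma spanning_all u : spanning u.
Proof.
elim/W_ind: u => [a|l lm|a am|w1 gw1||u v IHu IHv|u v IHu IHv].
- apply: spanning_intro => w gw; have wE := wt_E kl w; exists w; split.
    by rewrite wtE mulrA -alg_central -mulrA wE.
  rewrite mulrA -alg_central -mulrA -(straight_c b gw wE) mulrA -phi_scalar.
  exact/spannedM/spanned1.
- apply: spanning_intro => w gw; exists w; split; last exact: spanned_x.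
  exact/(wt_x kl lm)/(wt_E kl).
- apply: spanning_intro => w gw; exists (swapf a w); split; last exact: spanned_s.
  exact/(wt_s kl am)/(wt_E kl).
- apply: spanning_intro => w gw; exists w; have [ww|[l lm ww]] := word_eqP m w1 w.
    rewrite (kl_Eext kl ww) (kl_EE kl); split; first exact: wt_E kl w.
    exact: spanned1.
  by rewrite (kl_E0 kl lm ww) wtE !mulr0; split=> //; exact: spanned0.
- apply: spanning_intro => w gw; exists (invhead w); split; first exact/(wt_pi like)/(wt_E kl).
  have [l1 [l2 [l12 l2m _ _]]] := good_spec2 p0 p_not_root1 nu_p gw.
  rewrite (straight_pi like posV b) //; [exact: spanned1 | by lia].
- by move=> w w' gw gw'; rewrite mulrDl !mulrDr; apply: spannedD; [exact: IHu | exact: IHv].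
move=> w w' gw gw'; rewrite -[v]mul1r -E1 mulr_suml mulr_sumr mulr_suml !mulr_sumr.
elim/big_ind: _ => [|*|i _]; [exact: spanned0 | exact: spannedD |].
set i' := nth 1 (val i); have gi : good i' by rewrite goodE tupf_nth; exact: valP.
have [r rE] := IHu i' w' gi gw'; have [r' rE'] := IHv w i' gw gi.
exists (r * r'); have e := congr1 ( *%R^~ (E i' * (v * E w))) rE.
rewrite -!mulrA in e; rewrite -{1}(kl_EE kl i') -!mulrA e.
by rewrite (mulrA (E i')) (kl_EE kl) rE' (mulrA (phi b r)) -phiM.
Qed.

End Spanning.

Definition between b b' v :=
  exists r, v = if b == b' then phi b r else phi b' r * (full * c b).

Lemma between_all b b' u : between b b' (c b' * u * c b).
Proof.
have b0 : between b b' 0 by exists 0; rewrite !phi0 mul0r if_same.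
have bD v v' : between b b' v -> between b b' v' -> between b b' (v + v').
  move=> [r ->] [r' ->]; exists (r + r').
  by rewrite !phiD mulrDl; case: ifP.
rewrite (end_idemE b) mulr_sumr; elim/big_ind: _ => // j _.
rewrite (end_idemE b') 2!mulr_suml; elim/big_ind: _ => // j' _.
have jJ : tupf m (nth 1 (val j)) \in J by rewrite tupf_nth; exact: valP.
have jJ' : tupf m (nth 1 (val j')) \in J by rewrite tupf_nth; exact: valP.
have [gw sw] := end_word_good b jJ; have [gw' sw'] := end_word_good b' jJ'.
set w := end_word b _ in gw sw *; set w' := end_word b' _ in gw' sw' *.
have [r] := @spanning_all b' u w w' gw gw'.
rewrite (straight_nobad _ _ (w := w')) => [|l lm]; last by rewrite /bad sw' ?eqxx.
rewrite mul1r -mulrA => ->; rewrite /between.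
have [bb|bb] := eqVneq b b'.
  rewrite (straight_nobad _ _ (w := w)) => [|l lm]; last by rewrite /bad sw ?bb ?eqxx.
  by exists (r * F (end_word b w)); rewrite bb phiM mul1r (E_word gw sw) bb.
have bE : b' = ~~ b by move: bb; case: (b); case: (b').
rewrite bE (straight_allsign sw) (E_word gw sw) turn_phi.
by exists (r * F (end_word b w)); rewrite phiM mulrA.
Qed.
End Ends.

(** * The morphism from R (x)_k[z] A~ *)

Lemma alg_termM (S : comPzRingType) (A : alg S) x y (a b : A) :
  alg_scalar A x * a * (alg_scalar A y * b) = alg_scalar A (x * y) * (a * b).
Proof. by rewrite rmorphM -!mulrA (mulrA a) -alg_central -mulrA. Qed.

Lemma pamul_scalarU (Q : quiver) (k : fieldType) x (a : qpath Q) :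
  pamul (pascalar Q x) << a >> = << x *g a >> :> {malg k[qpath Q]}.
Proof.
rewrite /pascalar pamul_suml (bigD1 (qtgt a)) //= big1 => [|v va].
  by rewrite addr0 pamulUU /pamulU qcomp_trivl eqxx mulr1.
by rewrite pamulUU /pamulU qcomp_trivl eq_sym (negbTE va).
Qed.

Lemma path_termE (Q : quiver) (k : fieldType) x (a : qpath Q) :
  alg_scalar (path_alg Q k) x * path_elt k a = << x *g a >> :> {malg k[qpath Q]}.
Proof. exact: pamul_scalarU. Qed.

Lemma path_termM (Q : quiver) (k : fieldType) x y (a b : qpath Q) :
  alg_scalar (path_alg Q k) x * path_elt k a * (alg_scalar (path_alg Q k) y * path_elt k b) =
  if qcomp a b is Some d then alg_scalar (path_alg Q k) (x * y) * path_elt k d else 0.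
Proof. by rewrite alg_termM path_eltM; case: qcomp => // ; rewrite mulr0. Qed.

(** Two images of R in orthogonal corners of W, exchanged by D with D D = z. *)
Section TwoEnds.
Variables (k : fieldType) (W R : alg k) (phi : bool -> R -> W) (D : W) (z : R).
Hypothesis zC : forall a, z * a = a * z.
Hypothesis phiD : forall b r t, phi b (r + t) = phi b r + phi b t.
Hypothesis phiM : forall b r t, phi b (r * t) = phi b r * phi b t.
Local Notation c b := (phi b 1).
Hypothesis phi_scalar : forall b a, phi b (alg_scalar R a) = alg_scalar W a * c b.
Hypothesis end_idem_ortho : forall b, c b * c (~~ b) = 0.
Hypothesis turn_phi : forall b r, D * phi b r = phi (~~ b) r * (D * c b).
Hypothesis turn_turn : forall b, D * (D * c b) = phi b z.

Local Notation At := (Atilde k).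
Local Notation Rz := (poly_alg zC).

Let phi0 b : phi b 0 = 0.
Proof. by apply: (addrI (phi b 0)); rewrite -phiD !addr0. Qed.

Let c_phi b r : c b * phi b r = phi b r. Proof. by rewrite -phiM mul1r. Qed.
Let phi_c b r : phi b r * c b = phi b r. Proof. by rewrite -phiM mulr1. Qed.

Lemma phi_phiN b r t : phi b r * phi (~~ b) t = 0.
Proof. by rewrite -(phi_c b) -(c_phi (~~ b)) -mulrA (mulrA (c b)) end_idem_ortho mul0r mulr0. Qed.

Lemma phiN_phi b r t : phi (~~ b) r * phi b t = 0.
Proof. by have := phi_phiN (~~ b) r t; rewrite negbK. Qed.

Let D_c b : D * c b = c (~~ b) * (D * c b). Proof. exact: turn_phi. Qed.

(** The image of a path of the quiver: a vertex is sent to the idempotent of its end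
    and each arrow to D. *)
Fixpoint dwalk (v : bool) (s : seq bool) : W :=
  if s is _ :: s' then dwalk (~~ v) s' * (D * c v) else c v.

Lemma dwalk_c v s : dwalk v s * c v = dwalk v s.
Proof. by case: s => [|a s] /=; rewrite -?mulrA ?c_phi. Qed.

Lemma dwalk_phi v s r : @is_walk cyc2 v s ->
  dwalk v s * phi v r = phi (last v (map negb s)) r * dwalk v s.
Proof.
elim: s v => [|a s IHs] v /=; first by rewrite c_phi phi_c.
move=> /andP[/eqP av ws]; rewrite av in ws *; rewrite -mulrA -(mulrA D) c_phi turn_phi.
by rewrite mulrA IHs // -mulrA.
Qed.

Lemma dwalk_cat v s t : @is_walk cyc2 v s ->
  dwalk v (s ++ t) = dwalk (last v (map negb s)) t * dwalk v s.
Proof.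
elim: s v => [|a s IHs] v /=; first by rewrite dwalk_c.
by move=> /andP[/eqP av ws]; rewrite av in ws *; rewrite IHs // -mulrA.
Qed.

Definition dpath (a : qpath cyc2) : W := dwalk (qsrc a) (qarrows a).

Lemma dpath_phi (a : qpath cyc2) r : dpath a * phi (qsrc a) r = phi (qtgt a) r * dpath a.
Proof. exact: dwalk_phi (valP a). Qed.

Lemma dpath_src (a : qpath cyc2) : dpath a * c (qsrc a) = dpath a.
Proof. exact: dwalk_c. Qed.

Lemma dpath_tgt (a : qpath cyc2) : c (qtgt a) * dpath a = dpath a.
Proof. by rewrite -dpath_phi dpath_src. Qed.

Definition delta (u : At) : W := lin_ext dpath (u : {malg k[qpath cyc2]}).

Lemma deltaD u v : delta (u + v) = delta u + delta v.
Proof. exact: raddfD. Qed.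

Lemma delta_path a : delta (path_elt k a) = dpath a.
Proof. by rewrite /delta lin_extU rmorph1 mul1r. Qed.

Lemma At_termE x a : alg_scalar At x * path_elt k a = << x *g a >> :> {malg k[qpath cyc2]}.
Proof. exact: path_termE. Qed.

Lemma At_ind (P : At -> Prop) : P 0 ->
  (forall x a, P (alg_scalar At x * path_elt k a)) -> (forall u v, P u -> P v -> P (u + v)) ->
  forall u, P u.
Proof.
move=> P0 Pt PD u; rewrite [u]monalgE; elim/big_ind: _ => [//|u' v' /PD|a _].
  by move=> h /h.
by rewrite -At_termE; exact: Pt.
Qed.

Lemma delta0 : delta 0 = 0. Proof. exact: raddf0. Qed.

Lemma delta_term x a : delta (alg_scalar At x * path_elt k a) = alg_scalar W x * dpath a.
Proof. by rewrite /delta At_termE lin_extU. Qed.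

Lemma deltaM u v : delta (u * v) = delta u * delta v.
Proof.
elim/At_ind: u => [|x a|u u' IHu IHu']; first by rewrite mul0r delta0 mul0r.
  elim/At_ind: v => [|y b|v v' IHv IHv']; first by rewrite mulr0 delta0 mulr0.
    apply: etrans (congr1 delta (@path_termM cyc2 k x y a b)) _.
    apply: etrans _ (esym (congr2 *%R (delta_term x a) (delta_term y b))).
    rewrite alg_termM.
    have [ba|ba] := eqVneq (qtgt b) (qsrc a).
      have [d -> vd] := qcompP ba; rewrite delta_term; congr (_ * _).
      rewrite /dpath /qsrc /qarrows vd dwalk_cat; last exact: (valP b).
      by rewrite -[last _ _]/(qtgt b) ba.
    rewrite (qcompN (elimN eqP ba)) delta0 -(dpath_src a) -(dpath_tgt b) -mulrA.
    rewrite (mulrA (c _) (c _)); have -> : qtgt b = ~~ qsrc a by move: ba; case: (qtgt b); case: (qsrc a).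
    by rewrite end_idem_ortho mul0r !mulr0.
  apply: etrans (congr1 delta (mulrDr _ v v')) _; apply: etrans (deltaD _ _) _.
  by apply: etrans (congr2 +%R IHv IHv') _; rewrite (deltaD v v') mulrDr.
apply: etrans (congr1 delta (mulrDl u u' v)) _; apply: etrans (deltaD _ _) _.
by apply: etrans (congr2 +%R IHu IHu') _; rewrite (deltaD u u') mulrDl.
Qed.

Definition phis r := phi true r + phi false r.

Lemma phisD r t : phis (r + t) = phis r + phis t.
Proof. by rewrite /phis !phiD addrACA. Qed.

Lemma phisM r t : phis (r * t) = phis r * phis t.
Proof.
rewrite /phis !phiM mulrDl !mulrDr (phi_phiN true) (phi_phiN false).
by rewrite addr0 add0r.
Qed.

Lemma phis_c b r : phis r * c b = phi b r.
Proof.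
rewrite /phis mulrDl; case: b.
  by rewrite phi_c (phi_phiN false) addr0.
by rewrite phi_c (phi_phiN true) add0r.
Qed.

Lemma c_phis b r : c b * phis r = phi b r.
Proof.
rewrite /phis mulrDr; case: b.
  by rewrite c_phi (phi_phiN true) addr0.
by rewrite c_phi (phi_phiN false) add0r.
Qed.

Lemma phis_dpath (a : qpath cyc2) r : phis r * dpath a = phi (qtgt a) r * dpath a.
Proof. by rewrite -[in LHS](dpath_tgt a) mulrA phis_c. Qed.

(** The images of R and of the path algebra commute because D intertwines the two
    images of R. *)
Lemma phis_delta r u : phis r * delta u = delta u * phis r.
Proof.
elim/At_ind: u => [|x a|u u' IHu IHu']; first by rewrite delta0 mul0r mulr0.
  rewrite delta_term mulrA -alg_central -!mulrA; congr (_ * _).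
  by rewrite phis_dpath -dpath_phi -(c_phis (qsrc a)) mulrA dpath_src.
by rewrite (deltaD u u') mulrDr (mulrDl (delta u)) IHu IHu'.
Qed.

Lemma At_1E : (1 : At) = path_elt k (@qtriv cyc2 true) + path_elt k (@qtriv cyc2 false).
Proof. exact: (@big_bool _ _ +%R (fun v => path_elt k (@qtriv cyc2 v))). Qed.

Lemma delta1 : delta 1 = phis 1.
Proof.
apply: etrans (congr1 delta At_1E) _; apply: etrans (deltaD _ _) _.
by rewrite /phis; apply: congr2; exact: delta_path.
Qed.

Lemma delta_arrow v : delta (path_elt k (cyc2_arrow v)) = D * c v.
Proof. by rewrite delta_path /dpath /= -D_c. Qed.

Lemma delta_z : delta (At_z k) = phis z.
Proof.
have loop v : delta (path_elt k (cyc2_arrow (~~ v)) * path_elt k (cyc2_arrow v)) = phi v z.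
  apply: etrans (deltaM _ _) _.
  apply: etrans (congr2 *%R (delta_arrow _) (delta_arrow _)) _; rewrite -mulrA.
  by apply: etrans (congr1 ( *%R D) (esym (D_c v))) (turn_turn v).
apply: etrans (deltaD _ _) _; rewrite /phis addrC.
by apply: congr2; [exact: (loop true) | exact: (loop false)].
Qed.

(** As the square of D is the image of z, both k[z]-structures agree and the map is
    balanced. *)
Lemma delta_ev f : delta (ev_at (At_z k) f) = phis (ev_at z f).
Proof.
elim/poly_ind: f => [|f x IHf].
  rewrite -polyC0 !ev_atC !rmorph0 delta0 /phis !phi0 addr0 //.
have ezD := raddfD (ev_at_rmorphism zC); have etD := raddfD (ev_at_rmorphism (@At_z_central k)).
rewrite [ev_at z _]ezD [ev_at _ _]etD /= !ev_atMX !ev_atC deltaD deltaM IHf delta_z phisD phisM.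
congr (_ + _); rewrite -[alg_scalar At x]mulr1.
apply: etrans (congr1 (fun u => delta (alg_scalar At x * u)) At_1E) _.
apply: etrans (congr1 delta (mulrDr _ _ _)) _; apply: etrans (deltaD _ _) _.
by apply: etrans (congr2 +%R (delta_term _ _) (delta_term _ _)) _; rewrite /phis !phi_scalar.
Qed.

Lemma end_map_bal f r u :
  phis (alg_scalar Rz f * r) * delta u = phis r * delta (alg_scalar (Atilde_z k) f * u).
Proof. by rewrite alg_central phisM -mulrA deltaM /= delta_ev. Qed.

Local Notation B := (alg_restrict (@polyC k) (tensor_alg Rz (Atilde_z k))).

Definition end_map (t : B) : W :=
  @tens_lift _ Rz (Atilde_z k) W (fun r u => phis r * delta u) t.

Lemma end_map_tens r u : end_map (@tens _ Rz (Atilde_z k) r u) = phis r * delta u.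
Proof.
apply: tens_lift_tens => [r1 r2 v|r1 v v'|f r1 v]; last exact: end_map_bal.
  by rewrite phisD mulrDl.
by rewrite deltaD mulrDr.
Qed.

Lemma end_mapD t t' : end_map (t + t') = end_map t + end_map t'.
Proof.
apply: tens_liftD => [r1 r2 v|r1 v v'|f r1 v]; last exact: end_map_bal.
  by rewrite phisD mulrDl.
by rewrite deltaD mulrDr.
Qed.

Lemma end_map0 : end_map 0 = 0.
Proof. by apply: (addrI (end_map 0)); rewrite -end_mapD !addr0. Qed.

Lemma end_mapM t t' : end_map (t * t') = end_map t * end_map t'.
Proof.
have [u ->] := tensE t; have [v ->] := tensE t'.
have sumE := big_morph _ end_mapD end_map0.
rewrite mulr_suml !sumE mulr_suml; apply: eq_bigr => x _.
rewrite mulr_sumr !sumE mulr_sumr; apply: eq_bigr => y _.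
rewrite tensM !end_map_tens phisM deltaM -!mulrA; congr (_ * _).
by rewrite !mulrA phis_delta.
Qed.

Lemma end_map1 : end_map 1 = phis 1.
Proof. by rewrite [LHS]end_map_tens delta1 -phisM mulr1. Qed.

Lemma end_map_scalar x : end_map (alg_scalar B x) = alg_scalar W x * end_map 1.
Proof.
rewrite end_map1 [LHS]end_map_tens /= ev_atC /phis !phi_scalar -mulrDr -mulrA delta1.
by rewrite -phisM mulr1.
Qed.

Local Notation tens := (@tens _ Rz (Atilde_z k)).
Local Notation triv v := (path_elt k (@qtriv cyc2 v)).
Local Notation arrow v := (path_elt k (cyc2_arrow v)).

Lemma tens0l u : tens 0 u = 0.
Proof. by apply: (addrI (tens 0 u)); rewrite -tensDl !addr0. Qed.

Lemma tens0r r : tens r 0 = 0.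
Proof. by apply: (addrI (tens r 0)); rewrite -tensDr !addr0. Qed.

(** Multiplication by z extends a path by two arrows, so the vertices and the
    arrows span the path algebra over k[z]; every element of the tensor product is
    thus a combination of these four with coefficients in R. *)
Definition short (t : B) := exists r r' : bool -> R,
  t = \sum_(v : bool) (tens (r v) (triv v) + tens (r' v) (arrow v)).

Lemma short0 : short 0.
Proof.
exists (fun=> 0), (fun=> 0); rewrite big1 // => v _.
exact: etrans (congr2 +%R (tens0l _) (tens0l _)) (addr0 _).
Qed.

Lemma shortD t t' : short t -> short t' -> short (t + t').
Proof.
move=> [r [r' ->]] [s [s' ->]]; exists (fun v => r v + s v), (fun v => r' v + s' v).
by rewrite -big_split; apply: eq_bigr => v _; rewrite !tensDl addrACA.
Qed.

Lemma short_triv r v : short (tens r (triv v)).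
Proof.
exists (fun b => if b == v then r else 0), (fun=> 0); rewrite (bigD1 v) //= eqxx big1.
  by rewrite tens0l !addr0.
by move=> b /negbTE->; exact: etrans (congr2 +%R (tens0l _) (tens0l _)) (addr0 _).
Qed.

Lemma short_arrow r v : short (tens r (arrow v)).
Proof.
exists (fun=> 0), (fun b => if b == v then r else 0); rewrite (bigD1 v) //= eqxx big1.
  by rewrite tens0l add0r addr0.
by move=> b /negbTE->; exact: etrans (congr2 +%R (tens0l _) (tens0l _)) (addr0 _).
Qed.

Lemma extend_z a : path_elt k (cyc2_extend a) = At_z k * path_elt k a.
Proof.
rewrite At_zE; apply: esym; apply: etrans (mulrDl _ _ _) _.
apply: etrans (congr2 +%R (cyc2_loopl _ _ _) (cyc2_loopl _ _ _)) _.
by case: (qtgt a) => /=; [exact: add0r | exact: addr0].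
Qed.

Lemma tens_z r u : tens r (At_z k * u) = tens (z * r) u.
Proof.
have evX (A : alg k) (y : A) : ev_at y 'X = y.
  by rewrite -['X]mul1r ev_atMX -polyC1 ev_atC rmorph1 mul1r.
have := @tens_bal _ Rz (Atilde_z k) 'X r u.
by rewrite /= !evX => ->.
Qed.

Lemma is_walk_traject (v : bool) n : @is_walk cyc2 v (traject negb v n).
Proof. by elim: n v => //= n IHn v; rewrite eqxx IHn. Qed.

Lemma short_path r a : short (tens r (path_elt k a)).
Proof.
have [n] := ubnP (size (qarrows a)); elim: n a r => // n IHn a r an.
case sa: (size (qarrows a)) => [|[|l]].
- rewrite (_ : a = qtriv (qsrc a)); first exact: short_triv.
  exact: qpath_cyc2_inj.
- rewrite (_ : a = cyc2_arrow (qsrc a)); first exact: short_arrow.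
  exact: qpath_cyc2_inj.
pose b := @QPath cyc2 (qsrc a, traject negb (qsrc a) l) (is_walk_traject _ _).
have sb : size (qarrows b) = l by rewrite /= size_traject.
rewrite (_ : a = cyc2_extend b); last first.
  by apply: qpath_cyc2_inj => //; rewrite sa /= size_cat sb addn2.
by rewrite extend_z tens_z; apply: IHn; rewrite sb; lia.
Qed.

Lemma short_all t : short t.
Proof.
have [w ->] := tensE t; elim/big_ind: _ => [|*|[r u] _]; [exact: short0 | exact: shortD |].
rewrite /=; elim/At_ind: u => [|x a|u u' su su'].
- rewrite tens0r; exact: short0.
- have := @tens_bal _ Rz (Atilde_z k) x%:P r (path_elt k a).
  by rewrite /= !ev_atC => <-; exact: short_path.
- by rewrite tensDr; exact: shortD.
Qed.

Lemma end_map_triv r v : end_map (tens r (triv v)) = phi v r.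
Proof. by rewrite end_map_tens delta_path phis_c. Qed.

Lemma end_map_arrow r v : end_map (tens r (arrow v)) = D * phi v r.
Proof. by rewrite end_map_tens delta_arrow (turn_phi v r) {1}D_c mulrA phis_c. Qed.

Lemma end_map_short (r r' : bool -> R) t :
  t = \sum_(v : bool) (tens (r v) (triv v) + tens (r' v) (arrow v)) ->
  end_map t = phi true (r true) + D * phi true (r' true) +
              (phi false (r false) + D * phi false (r' false)).
Proof.
have e v : end_map (tens (r v) (triv v) + tens (r' v) (arrow v)) = phi v (r v) + D * phi v (r' v).
  exact: etrans (end_mapD _ _) (congr2 +%R (end_map_triv _ _) (end_map_arrow _ _)).
move=> /(congr1 end_map) tE; apply: etrans tE _.
apply: etrans (congr1 end_map (@big_bool B _ +%R (fun v => tens (r v) (triv v) + tens (r' v) (arrow v)))) _.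
exact: etrans (end_mapD _ _) (congr2 +%R (e true) (e false)).
Qed.

(** The four components of an element of the tensor product are separated by the
    two idempotents, so only the maps phi b and D phi b on R have to be injective. *)
Section Full.
Hypothesis phi_inj : forall b r, phi b r = 0 -> r = 0.
Hypothesis turn_inj : forall b r, D * phi b r = 0 -> r = 0.
Hypothesis between : forall b b' u,
  exists r, c b' * u * c b = if b == b' then phi b r else phi b' r * (D * c b).
Variables (I : finType) (L T : I -> W).
Hypothesis full : \sum_i L i * (c true + c false) * T i = 1.

Lemma end_map_inj t : end_map t = 0 -> t = 0.
Proof.
have [r [r' tE]] := short_all t => /(etrans (esym (end_map_short tE))) t0.
have step v : phi v (r v) + D * phi v (r' v) = 0.
  have := congr1 ( *%R^~ (c v)) t0; rewrite mul0r; case: v => <-.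
    rewrite !mulrDl -!mulrA !phi_c (phiN_phi true) (phiN_phi true).
    by rewrite mulr0 !addr0.
  rewrite !mulrDl -!mulrA !phi_c (phiN_phi false) (phiN_phi false).
  by rewrite mulr0 !add0r.
have r0 v : r v = 0.
  apply: (phi_inj (b := v)); have := congr1 ( *%R (c v)) (step v).
  by rewrite mulr0 mulrDr c_phi turn_phi mulrA phi_phiN mul0r addr0.
have r0' v : r' v = 0.
  by apply: (turn_inj (b := v)); have := step v; rewrite r0 phi0 add0r.
rewrite tE big1 // => v _; rewrite r0 r0'; exact: etrans (congr2 +%R (tens0l _) (tens0l _)) (addr0 _).
Qed.

Lemma end_map_onto a : exists t, end_map t = end_map 1 * a * end_map 1.
Proof.
have one b b' : exists t, end_map t = c b' * a * c b.
  have [r ->] := between b b' a; case: eqVneq => [_|bb].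
    by exists (tens r (triv b)); exact: end_map_triv.
  have -> : b' = ~~ b by move: bb; case: (b); case: (b').
  by exists (tens r (arrow b)); rewrite end_map_arrow turn_phi.
have [[t1 E1] [t2 E2]] := (one true true, one true false).
have [[t3 E3] [t4 E4]] := (one false true, one false false).
exists ((t1 + t3) + (t2 + t4)); rewrite end_map1 /phis 3!end_mapD E1 E2 E3 E4.
by rewrite !mulrDl !mulrDr.
Qed.

Lemma two_ends_morita : morita_equivalent W B.
Proof.
apply: full_corner_morita.
refine (@FullCorner _ W B end_map end_mapD end_mapM end_map_scalar end_map_inj end_map_onto
  I L T _).
by rewrite -[RHS]full; apply: eq_bigr => i _; rewrite end_map1.
Qed.

End Full.

End TwoEnds.

(** * The representation separates the ends *)
Section VVLikeRel.
Variables (k : fieldType) (p : k) (m : nat) (J : {fset m.-tuple k}) (S : pzRingType).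
Variables (x s : nat -> S) (E : (nat -> k) -> S) (pi : S).
Hypothesis like : vv_like p m x s E pi.
Hypothesis E1 : \sum_(i : J) E (nth 1 (val i)) = 1.
Hypothesis J_arrow : forall (i : m.-tuple k) y z, i \in J -> y \in i -> z \in i ->
  arrow p y z -> ~~ arrow p z y.

Lemma vv_like_rel u v :
  vv_rel p (fun l : 'I_m => x l) (fun a : 'I_m.-1 => s a)
    (fun i : J => E (nth 1 (val i))) pi u v -> u = v.
Proof.
case=> {u v}.
- move=> u v; exact: (klr_like_rel (vl_klr like) E1 J_arrow).
- move=> i j ji; rewrite (vl_pE like); congr (_ * _).
  apply: (kl_Eext (vl_klr like)) => l lm.
  rewrite -[in RHS](nth_tupf 1 (nth 1 (val j)) lm) tupf_nth ji.
  rewrite -[l in RHS]/(nat_of_ord (Ordinal lm)) -tnth_nth tnth_mktuple /invhead /=.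
  by rewrite (tnth_nth 1) /=; case: eqP => // ->.
- by move=> i; rewrite expr2 (vl_pp like) mul1r.
- by move=> l l0; rewrite l0; apply: (vl_px0 like); rewrite -[0%N]l0.
- by move=> l l0; apply: (vl_px like).
- move=> a i a0; rewrite a0 !expr2 -!mulrA; have m1 : (1 < m)%N by case: a a0 => a /=; lia.
  by have := congr1 ( *%R^~ (E (nth 1 (val i)))) (vl_sp like m1); rewrite -!mulrA.
- by move=> a a0; apply: (vl_ps like) => //; case: a a0 => a /=; lia.
Qed.

End VVLikeRel.

Section MatrixAlg.
Variables (k : fieldType) (A : alg k) (n : nat).

Definition mx_scalar (a : k) : 'M[A]_n := (alg_scalar A a)%:M.

Fact mx_scalar_is_zmod_morphism : zmod_morphism mx_scalar.
Proof. by move=> a a'; rewrite /mx_scalar !rmorphB. Qed.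
Fact mx_scalar_is_monoid_morphism : monoid_morphism mx_scalar.
Proof.
split=> [|a a']; rewrite /mx_scalar ?rmorph1 // rmorphM.
exact: scalar_mxM.
Qed.
HB.instance Definition _ := GRing.isZmodMorphism.Build k 'M[A]_n mx_scalar mx_scalar_is_zmod_morphism.
HB.instance Definition _ := GRing.isMonoidMorphism.Build k 'M[A]_n mx_scalar mx_scalar_is_monoid_morphism.

Fact mx_scalar_central a (M : 'M[A]_n) : mx_scalar a * M = M * mx_scalar a.
Proof.
rewrite -[LHS]/((alg_scalar A a)%:M *m M) -[RHS]/(M *m (alg_scalar A a)%:M).
apply/matrixP => i j; rewrite mul_scalar_mx !mxE (bigD1 j) //= !mxE eqxx mulr1n.
rewrite alg_central big1 ?addr0 // => l lj; rewrite !mxE (negbTE lj).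
by rewrite mulr0.
Qed.

Definition mx_alg : alg k := Alg mx_scalar_central.

End MatrixAlg.

Section SignAction.
Variables (k : fieldType) (p : k) (m : nat) (nu : {fsfun k -> nat with 0%N}).
Hypotheses (p0 : p != 0) (p_not_root1 : forall n : nat, (0 < n)%N -> p ^+ n != 1).
Hypotheses (nu_theta : in_theta_NI p nu) (nu_p : nu p = 2%N).
Local Notation J := (words p m (dv_plus p nu)).
Local Notation Th := (theta_words p m nu).
Local Notation good := (good p m nu).

Variables (R : alg k) (X Sg : nat -> R) (F : (nat -> k) -> R).
Hypothesis klR : klr_like p m X Sg F.
Hypothesis F1 : \sum_(j : J) F (nth 1 (val j)) = 1.
Hypothesis R_ind : forall P : R -> Prop,
  (forall c, P (alg_scalar R c)) -> (forall l, (l < m)%N -> P (X l)) ->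
  (forall a, (a.+1 < m)%N -> P (Sg a)) -> (forall w, tupf m w \in J -> P (F w)) ->
  (forall u v, P u -> P v -> P (u + v)) -> (forall u v, P u -> P v -> P (u * v)) ->
  forall u, P u.

Local Notation T := (m.-tuple bool).
Local Notation N := #|{: T}|.
Local Notation column := (@column m R).

Variables (W : alg k) (x s : nat -> W) (E : (nat -> k) -> W) (pi : W) (phi : bool -> R -> W).
Hypothesis phiD : forall b r t, phi b (r + t) = phi b r + phi b t.
Hypothesis phiM : forall b r t, phi b (r * t) = phi b r * phi b t.
Local Notation c b := (phi b 1).
Hypothesis phi_scalar : forall b a, phi b (alg_scalar R a) = alg_scalar W a * c b.
Hypothesis phi_X : forall b l, (l < m)%N ->
  phi b (X l) = (-1) ^+ (~~ b) * x (end_pos m b l) * c b.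
Hypothesis phi_S : forall b a, (a.+1 < m)%N -> phi b (Sg a) = s (end_cross m b a) * c b.
Hypothesis phi_F : forall b w, tupf m w \in J -> phi b (F w) = E (end_word m b w).

Variables (beta : bool) (Psi : W -> 'M[R]_N).
Hypothesis PsiD : forall u v, Psi (u + v) = Psi u + Psi v.
Hypothesis PsiM : forall u v, Psi (u * v) = Psi u *m Psi v.
Hypothesis Psi_scalar : forall a, Psi (alg_scalar W a) = (alg_scalar R a)%:M.
Hypothesis Psi_x : forall l, (l < m)%N -> Psi (x l) = Mx m X l.
Hypothesis Psi_s : forall a, (a.+1 < m)%N -> Psi (s a) = Ms p m nu X Sg F beta a.
Hypothesis Psi_E : forall w, good w -> Psi (E w) = ME p m nu F w.
Hypothesis Psi_pi : Psi pi = Mpi m R.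

Definition const_sign b : T := tupf m (fun=> b).

Lemma column_test (A : 'M[R]_N) t t' g : (forall w r, tupf m w \in J -> wt F w r ->
  A *m column t r = column t' (g * r)) -> forall r, A *m column t r = column t' (g * r).
Proof.
move=> AB r; rewrite -[r]mul1r -F1 mulr_suml mulr_sumr.
rewrite (big_morph (column t) (columnD t) (column0 R t)) (big_morph (column t') (columnD t') (column0 R t')) mulmx_sumr.
apply: eq_bigr => j _; apply: (AB (nth 1 (val j))); first by rewrite tupf_nth; exact: valP.
exact: (wt_EM klR).
Qed.

Lemma column_inj t r : column t r = 0 -> r = 0.
Proof. by move=> /colP/(_ (enum_rank t)); rewrite !mxE enum_rankK eqxx. Qed.

Lemma sg_const b l : (l < m)%N -> sg (const_sign b) l = b.
Proof. by move=> lm; rewrite /sg nth_tupf. Qed.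

Lemma pt_const b l : (l < m)%N -> pt (const_sign b) l = end_pos m b l.
Proof.
by move=> lm; apply: etrans (posn_const b lm); apply: posn_ext => // i im; rewrite sg_const.
Qed.

Lemma wT_const b (w : nat -> k) l : (l < m)%N -> wT (const_sign b) w l = end_word m b w l.
Proof.
move=> lm; rewrite /wT /wordf -/(pt _ _) sg_const // pt_const //.
by case: b.
Qed.

Lemma end_word_inj b (w w' : nat -> k) : (forall l, (l < m)%N -> end_word m b w l = end_word m b w' l) ->
  forall l, (l < m)%N -> w l = w' l.
Proof.
move=> ww l lm; rewrite -(end_wordK b w lm) -(end_wordK b w' lm).
case: b ww => //= ww; first by rewrite ww.
by rewrite /revinv; congr _^-1; apply: ww; lia.
Qed.

Lemma Psi_phiF b w r : tupf m w \in J -> Psi (phi b (F w)) *m column (const_sign b) r =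
  column (const_sign b) (F w * r).
Proof.
move=> wJ; have [gw _] := end_word_good p0 p_not_root1 nu_theta nu_p b wJ.
rewrite phi_F // Psi_E //; move: r; apply: column_test => w' r wJ' wr.
rewrite (ME_column klR _ _ wJ' wr) (eq_tupf (wT_const b w')); case: eqP => [ww|ww].
  have ww2 : forall l, (l < m)%N -> w l = w' l.
    apply: (@end_word_inj b) => l lm.
    by rewrite -(nth_tupf 1 (end_word m b w) lm) -ww nth_tupf.
  by rewrite (kl_Eext klR ww2) wr.
have [ww'|[l lm ww']] := word_eqP m w w'.
  case: ww; apply: eq_tupf => l lm; case: (b) => //=; first by rewrite ww'.
  by rewrite /revinv ww' //; lia.
by rewrite -wr mulrA (kl_E0 klR lm ww') mul0r column0.
Qed.

Lemma phi_zero b : phi b 0 = 0.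
Proof. by apply: (addrI (phi b 0)); rewrite -phiD !addr0. Qed.

Lemma Psi_zero : Psi 0 = 0.
Proof. by apply: (addrI (Psi 0)); rewrite -PsiD !addr0. Qed.

Lemma Psi_opp u : Psi (- u) = - Psi u.
Proof. by apply: (addrI (Psi u)); rewrite -PsiD !subrr Psi_zero. Qed.

Lemma Psi_c b r : Psi (c b) *m column (const_sign b) r = column (const_sign b) r.
Proof.
rewrite -[in LHS]F1 (big_morph _ (phiD b) (phi_zero b)) (big_morph _ PsiD Psi_zero) mulmx_suml.
rewrite -[r in RHS]mul1r -F1 mulr_suml (big_morph _ (columnD _) (column0 R _)).
by apply: eq_bigr => j _; rewrite Psi_phiF // tupf_nth; exact: valP.
Qed.

(** At the constant sign sequence b the positive half of a word of the end b is the
    word itself or its reversed inverse, and no signs are mixed. *)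
Lemma Psi_phi b r y : Psi (phi b r) *m column (const_sign b) y = column (const_sign b) (r * y).
Proof.
elim/R_ind: r y => [a|l lm|a am|w wJ|r t IHr IHt|r t IHr IHt] y.
- rewrite phi_scalar PsiM -mulmxA Psi_c Psi_scalar mul_scalar_mx.
  by apply/colP => i; rewrite !mxE; case: ifP; rewrite ?mulr0.
- have lm' := end_pos_lt b lm; rewrite phi_X // PsiM -mulmxA Psi_c.
  have -> : Psi ((-1) ^+ (~~ b) * x (end_pos m b l)) = (-1) ^+ (~~ b) *: Mx m X (end_pos m b l).
    move: (end_pos m b l) lm' => i im; case: (b) => /=.
      by rewrite mul1r scale1r Psi_x.
    by rewrite expr1 mulN1r scaleN1r Psi_opp Psi_x.
  rewrite -scalemxAl Mx_column sg_const // pt_const // end_posK //.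
  by case: (b); rewrite /= ?mul1r ?scale1r // !expr1 mulN1r scaleN1r columnN opprK.
- have am' : ((end_cross m b a).+1 < m)%N by case: (b) => //=; lia.
  have am'' := ltnW am'; rewrite phi_S // PsiM -mulmxA Psi_c Psi_s // Ms_column.
  rewrite /omega swT_same ?sg_const // eqxx !pt_const //.
  congr (column _ (Sg _ * _)).
  by case: (b); rewrite /=; lia.
- exact: Psi_phiF.
- by rewrite phiD PsiD mulmxDl IHr IHt mulrDl columnD.
- by rewrite phiM PsiM -mulmxA IHt IHr mulrA.
Qed.

Lemma Psi_phi_inj b r : phi b r = 0 -> r = 0.
Proof.
move=> r0; have := Psi_phi b r 1; rewrite r0 Psi_zero mul0mx mulr1 => /esym; exact: column_inj.
Qed.

(** The signs while the letter of position n is turned: it has arrived at position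
    a, and the other letters up to position n have been turned to the sign beta
    before. *)
Definition travel a n : T := tupf m (fun l => ((l <= n)%N && (l != a)) (+) ~~ beta).

Lemma sg_travel a n l : (l < m)%N -> sg (travel a n) l = ((l <= n)%N && (l != a)) (+) ~~ beta.
Proof. by move=> lm; rewrite /sg nth_tupf. Qed.

(** The letter passes letters of sign beta from right to left, and these are the
    crossings of weight 1. *)
Lemma Psi_to_front a n y : (a <= n)%N -> (n < m)%N ->
  Psi (to_front s a) *m column (travel a n) y = column (travel 0 n) y.
Proof.
move=> + nm; elim: a y => [|a IHa] y an /=.
  have -> : Psi 1 = 1%:M by rewrite -(rmorph1 (alg_scalar W)) Psi_scalar rmorph1.
  by rewrite mul1mx.
have am : (a.+1 < m)%N by lia.
have am' : (a < m)%N by lia.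
rewrite PsiM -mulmxA Psi_s // Ms_column.
have -> : swT a (travel a.+1 n) = travel a n.
  apply: eq_sg => l lm; rewrite sg_swT // !sg_travel ?swapn_lt //; congr (_ (+) _).
  by rewrite /swapn; do ?case: eqP; lia.
rewrite /omega !sg_travel //.
have -> : (a <= n)%N by lia.
have -> : (a != a.+1) by lia.
rewrite an eqxx andbF addFb andbT addTb negbK; have -> : (beta == ~~ beta) = false by case: (beta).
by rewrite eqxx mul1r IHa // ltnW.
Qed.

Lemma Psi_full_turn n y : (n <= m)%N ->
  Psi (full_turn s pi n) *m column (const_sign (~~ beta)) y = column (travel n n) y.
Proof.
elim: n y => [|n IHn] y nm /=.
  have -> : Psi 1 = 1%:M by rewrite -(rmorph1 (alg_scalar W)) Psi_scalar rmorph1.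
  rewrite mul1mx; congr (column _ _); apply: eq_sg => l lm; rewrite sg_const // sg_travel //.
  by rewrite leqn0; case: eqP => //= ->.
rewrite /turn !PsiM -!mulmxA IHn; last exact: ltnW.
rewrite Psi_to_front // Psi_pi Mpi_column; congr (column _ _); apply: eq_sg => l lm.
have m0 : (0 < m)%N by lia.
rewrite sg_flT // /flip0; case: eqP => [l0|/eqP l0]; rewrite !sg_travel //.
  by rewrite l0.
by congr (_ (+) _); lia.
Qed.

Lemma Psi_turn r y : Psi (full_turn s pi m * phi (~~ beta) r) *m column (const_sign (~~ beta)) y =
  column (const_sign beta) (r * y).
Proof.
rewrite PsiM -mulmxA Psi_phi Psi_full_turn //; congr (column _ _); apply: eq_sg => l lm.
rewrite sg_travel // sg_const //.
have -> : (l <= m)%N && (l != m) by lia.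
by rewrite addTb negbK.
Qed.

Lemma Psi_turn_inj r : full_turn s pi m * phi (~~ beta) r = 0 -> r = 0.
Proof.
move=> r0; have := Psi_turn r 1; rewrite r0 Psi_zero mul0mx mulr1 => /esym; exact: column_inj.
Qed.

End SignAction.

(** * The positive half and its images *)
Section KLRData.
Variables (k : fieldType) (p : k) (m : nat) (nu : {fsfun k -> nat with 0%N}).
Hypotheses (p0 : p != 0) (p_not_root1 : forall n : nat, (0 < n)%N -> p ^+ n != 1).
Local Notation J := (words p m (dv_plus p nu)).
Local Notation R := (KLR p m (dv_plus p nu)).

Let p4 : p ^+ 4 != 1. Proof. exact: p_not_root1. Qed.

Definition Rx : nat -> R := nat_x (klr_x p (dv_plus p nu)).
Definition Rs : nat -> R := nat_s (klr_s p (dv_plus p nu)).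
Definition RE : (nat -> k) -> R := nat_e (@klr_e k p m (dv_plus p nu)).

Lemma R_klr_like : klr_like p m Rx Rs RE.
Proof.
apply: nat_klr_like; first exact: KLR_relP.
  by move=> a i iJ; exact: (words_swap a [` iJ]%fset).
by move=> i y z; exact: words_arrow.
Qed.

Lemma RE1 : \sum_(j : J) RE (nth 1 (val j)) = 1.
Proof.
rewrite -(KLR_relP (klr_e1 _ _ _ _)); apply: eq_bigr => j _.
by apply: nat_eE; rewrite tupf_nth.
Qed.

Lemma RE_out w : tupf m w \notin J -> RE w = 0.
Proof. exact: nat_e_out. Qed.

Lemma R_ind (P : R -> Prop) :
  (forall c, P (alg_scalar R c)) -> (forall l, (l < m)%N -> P (Rx l)) ->
  (forall a, (a.+1 < m)%N -> P (Rs a)) -> (forall w, tupf m w \in J -> P (RE w)) ->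
  (forall u v, P u -> P v -> P (u + v)) -> (forall u v, P u -> P v -> P (u * v)) ->
  forall u, P u.
Proof.
move=> Pc Px Ps Pe PD PM; apply: presented_ind => // -[l|a|j].
- by rewrite -[pgen _ _](nat_xE (klr_x p (dv_plus p nu))); apply: Px.
- rewrite -[pgen _ _](nat_sE (klr_s p (dv_plus p nu))); apply: Ps.
  by case: a => a /=; lia.
- have jE : tupf m (nth 1 (val j)) = val j by rewrite tupf_nth.
  rewrite -[pgen _ _](nat_eE (@klr_e k p m (dv_plus p nu)) jE); apply: Pe.
  by rewrite jE; exact: valP.
Qed.

Lemma klr_z_word (nu_p : dv_plus p nu p = 2%N) w : tupf m w \in J ->
  klr_z p m (dv_plus p nu) * RE w = (\sum_(l < m | w l == p) Rx l) * RE w.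
Proof.
move=> wJ; pose a (w : nat -> k) : R := \sum_(l < m | w l == p) Rx l.
have aE (j : J) : \sum_(l < m | tnth (val j) l == p) klr_x p (dv_plus p nu) l = a (nth 1 (val j)).
  apply: eq_big => [l|l _]; first by rewrite (tnth_nth 1).
  exact: esym (nat_xE _ _).
have eE (j : J) : klr_e j = RE (nth 1 (val j)).
  by apply: esym; apply: nat_eE; rewrite tupf_nth.
have zE : klr_z p m (dv_plus p nu) = \sum_(j : J) a (nth 1 (val j)) * RE (nth 1 (val j)).
  apply: etrans (klr_zE m nu_p) _; apply: eq_bigr => j _.
  exact: (congr2 (fun u v : R => u * v) (aE j) (eE j)).
apply: etrans (congr1 ( *%R^~ (RE w)) zE) _; apply: (words_coef R_klr_like wJ).
  by move=> w' ww; apply: eq_bigl => l; rewrite ww.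
exact: wt_E R_klr_like w.
Qed.

Section EndHom.
Variables (W : alg k) (x s : nat -> W) (E : (nat -> k) -> W).
Hypothesis kl : klr_like p m x s E.

Definition end_hom (b : bool) : R -> W :=
  if b then klr_hom kl else klr_hom (flip_klr_like p0 kl).

Lemma end_homD b r t : end_hom b (r + t) = end_hom b r + end_hom b t.
Proof. by case: b; apply: klr_homD. Qed.
Lemma end_homM b r t : end_hom b (r * t) = end_hom b r * end_hom b t.
Proof. by case: b; apply: klr_homM. Qed.

Lemma end_hom_scalar b a : end_hom b (alg_scalar R a) = alg_scalar W a * end_hom b 1.
Proof. by case: b; apply: (etrans (klr_hom_scalar _ _ p0 p4 _)); apply: esym; rewrite /end_hom klr_hom1. Qed.

Lemma end_hom_x b l : (l < m)%N ->
  end_hom b (Rx l) = (-1) ^+ (~~ b) * x (end_pos m b l) * end_hom b 1.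
Proof.
move=> lm; rewrite /Rx -[l in nat_x _ l]/(nat_of_ord (Ordinal lm)) nat_xE.
case: b; apply: (etrans (klr_hom_x _ _ p0 p4 _)); apply: esym; rewrite /end_hom klr_hom1 //.
  by rewrite mul1r.
by rewrite expr1 mulN1r.
Qed.

Lemma end_hom_s b a : (a.+1 < m)%N -> end_hom b (Rs a) = s (end_cross m b a) * end_hom b 1.
Proof.
move=> am; have am' : (a < m.-1)%N by lia.
rewrite /Rs -[a in nat_s _ a]/(nat_of_ord (Ordinal am')) nat_sE.
by case: b; apply: (etrans (klr_hom_s _ _ p0 p4 _)); apply: esym; rewrite /end_hom klr_hom1.
Qed.

Lemma end_hom_e b w : tupf m w \in J -> end_hom b (RE w) = E (end_word m b w).
Proof.
move=> wJ; rewrite /RE (@nat_eE _ _ _ _ (@klr_e k p m (dv_plus p nu)) [` wJ]%fset) //.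
have ext l : (l < m)%N -> nth 1 (tupf m w) l = w l by exact: nth_tupf.
case: b; rewrite /end_hom klr_hom_e //; apply: (kl_Eext kl) => l lm /=; first exact: ext.
by rewrite /revinv ext //; lia.
Qed.

End EndHom.
End KLRData.

(** * The action of W on sign sequences *)
Section VVAction.
Variables (k : fieldType) (p : k) (m : nat) (nu : {fsfun k -> nat with 0%N}).
Hypotheses (p0 : p != 0) (p_not_root1 : forall n : nat, (0 < n)%N -> p ^+ n != 1).
Hypotheses (nu_theta : in_theta_NI p nu) (nu_p : nu p = 2%N).
Local Notation R := (KLR p m (dv_plus p nu)).
Local Notation W := (VV p m nu).
Local Notation Th := (theta_words p m nu).
Local Notation N := #|{: m.-tuple bool}|.
Variable beta : bool.

Let Mxx : nat -> 'M[R]_N := Mx m (Rx p m nu).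
Let Mss : nat -> 'M[R]_N := Ms p m nu (Rx p m nu) (Rs p m nu) (RE p m nu) beta.
Let MEE : (nat -> k) -> 'M[R]_N := ME p m nu (RE p m nu).

Definition sign_gen (g : vv_gen m Th) : mx_alg R N :=
  match g with
  | VV_klr (KLR_x l) => Mxx l
  | VV_klr (KLR_s a) => Mss a
  | VV_klr (KLR_e i) => MEE (nth 1 (val i))
  | VV_pi => Mpi m R
  end.

Lemma sign_rel u v : VV_rel u v -> free_lift sign_gen u = free_lift sign_gen v.
Proof.
move=> /(vv_rel_map (f := free_lift sign_gen) (fun l => free_lift_gen _ _)
  (fun a => free_lift_gen _ _) (fun i => free_lift_gen _ _) (free_lift_gen _ _)).
have like := M_vv_like p0 p_not_root1 nu_theta nu_p (R_klr_like m nu p0 p_not_root1)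
  (@RE_out _ p m nu) (RE1 p m nu) beta.
have E1 := ME1 p0 p_not_root1 nu_theta (R_klr_like m nu p0 p_not_root1) (RE1 p m nu).
exact: (vv_like_rel like E1 (theta_arrow p0 p_not_root1)).
Qed.

Definition sign_action : W -> mx_alg R N := presented_lift sign_gen.

Lemma sign_actionD u v : sign_action (u + v) = sign_action u + sign_action v.
Proof. exact: (presented_liftD sign_rel). Qed.

Lemma sign_actionM u v : sign_action (u * v) = sign_action u * sign_action v.
Proof. exact: (presented_liftM sign_rel). Qed.

Lemma sign_action_scalar a : sign_action (alg_scalar W a) = (alg_scalar R a)%:M.
Proof. exact: (presented_lift_scalar sign_rel). Qed.

Lemma sign_action_x l : (l < m)%N -> sign_action (Wx p m nu l) = Mxx l.
Proof.
move=> lm; rewrite (nat_xE (vv_x p nu) (Ordinal lm) : Wx p m nu l = _).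
exact: (presented_lift_gen sign_rel (VV_klr (KLR_x (Ordinal lm)))).
Qed.

Lemma sign_action_s a : (a.+1 < m)%N -> sign_action (Ws p m nu a) = Mss a.
Proof.
move=> am; have am' : (a < m.-1)%N by lia.
rewrite (nat_sE (vv_s p nu) (Ordinal am') : Ws p m nu a = _).
exact: (presented_lift_gen sign_rel (VV_klr (KLR_s (Ordinal am')))).
Qed.

Lemma sign_action_E w : good p m nu w -> sign_action (WE p m nu w) = MEE w.
Proof.
move=> gw; rewrite (WE_good gw).
apply: etrans (presented_lift_gen sign_rel (VV_klr (KLR_e [` gw]%fset))) _.
have like := M_vv_like p0 p_not_root1 nu_theta nu_p (R_klr_like m nu p0 p_not_root1)
  (@RE_out _ p m nu) (RE1 p m nu) beta.
by apply: (kl_Eext (vl_klr like)) => l lm; exact: nth_tupf.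
Qed.

Lemma sign_action_pi : sign_action (vv_pi p m nu) = Mpi m R.
Proof. exact: (presented_lift_gen sign_rel VV_pi). Qed.

Lemma VV_ind (P : W -> Prop) :
  (forall c, P (alg_scalar W c)) -> (forall l, (l < m)%N -> P (Wx p m nu l)) ->
  (forall a, (a.+1 < m)%N -> P (Ws p m nu a)) -> (forall w, good p m nu w -> P (WE p m nu w)) ->
  P (vv_pi p m nu) ->
  (forall u v, P u -> P v -> P (u + v)) -> (forall u v, P u -> P v -> P (u * v)) ->
  forall u, P u.
Proof.
move=> Pc Px Ps Pe Ppi PD PM; apply: presented_ind => // -[[l|a|i]|//].
- by rewrite -[pgen _ _](nat_xE (vv_x p nu)); apply: Px.
- rewrite -[pgen _ _](nat_sE (vv_s p nu)); apply: Ps.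
  by case: a => a /=; lia.
- have iE : tupf m (nth 1 (val i)) = val i by rewrite tupf_nth.
  rewrite -[pgen _ _](nat_eE (@vv_e k p m nu) iE); apply: Pe.
  by rewrite /good iE; exact: valP.
Qed.

End VVAction.

(** * The Morita equivalence *)

(** The algebra W is kept abstract here, with its generators, an induction principle
    and an action on the sign sequences for each choice of the weights. *)
Section Assembly.
Variables (k : fieldType) (p : k) (m : nat) (nu : {fsfun k -> nat with 0%N}).
Hypotheses (p0 : p != 0) (p_not_root1 : forall n : nat, (0 < n)%N -> p ^+ n != 1).
Hypotheses (nu_theta : in_theta_NI p nu) (nu_p : nu p = 2%N) (m0 : (0 < m)%N).
Local Notation R := (KLR p m (dv_plus p nu)).
Local Notation Th := (theta_words p m nu).
Local Notation good := (good p m nu).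
Local Notation N := #|{: m.-tuple bool}|.

Variables (W : alg k) (x s : nat -> W) (E : (nat -> k) -> W) (pi : W).
Hypothesis like : vv_like p m x s E pi.
Hypothesis E1 : \sum_(i : Th) E (nth 1 (val i)) = 1.
Hypothesis W_ind : forall P : W -> Prop,
  (forall c, P (alg_scalar W c)) -> (forall l, (l < m)%N -> P (x l)) ->
  (forall a, (a.+1 < m)%N -> P (s a)) -> (forall w, good w -> P (E w)) -> P pi ->
  (forall u v, P u -> P v -> P (u + v)) -> (forall u v, P u -> P v -> P (u * v)) ->
  forall u, P u.

Variable Psi : bool -> W -> 'M[R]_N.
Hypothesis PsiD : forall b u v, Psi b (u + v) = Psi b u + Psi b v.
Hypothesis PsiM : forall b u v, Psi b (u * v) = Psi b u *m Psi b v.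
Hypothesis Psi_scalar : forall b a, Psi b (alg_scalar W a) = (alg_scalar R a)%:M.
Hypothesis Psi_x : forall b l, (l < m)%N -> Psi b (x l) = Mx m (Rx p m nu) l.
Hypothesis Psi_s : forall b a, (a.+1 < m)%N ->
  Psi b (s a) = Ms p m nu (Rx p m nu) (Rs p m nu) (RE p m nu) b a.
Hypothesis Psi_E : forall b w, good w -> Psi b (E w) = ME p m nu (RE p m nu) w.
Hypothesis Psi_pi : forall b, Psi b pi = Mpi m R.

Lemma vv_morita :
  morita_equivalent W
    (alg_restrict (@polyC k) (tensor_alg (KLR_plus_z m nu_p) (Atilde_z k))).
Proof.
have kl := vl_klr like.
have klR := R_klr_like m nu p0 p_not_root1.
have F1 := RE1 p m nu; have RI := @R_ind _ p m nu p0 p_not_root1.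
have pD := @end_homD _ p m nu p0 p_not_root1 _ _ _ _ kl.
have pM := @end_homM _ p m nu p0 p_not_root1 _ _ _ _ kl.
have pS := @end_hom_scalar _ p m nu p0 p_not_root1 _ _ _ _ kl.
have pX := @end_hom_x _ p m nu p0 p_not_root1 _ _ _ _ kl.
have ps := @end_hom_s _ p m nu p0 p_not_root1 _ _ _ _ kl.
have pE := @end_hom_e _ p m nu p0 p_not_root1 _ _ _ _ kl.
have zw := @klr_z_word _ p m nu p0 p_not_root1 (etrans (dv_plus_p p nu) nu_p).
have cc b := end_idem_ortho p0 p_not_root1 nu_theta nu_p like F1 pD pE b m0.
have tp := turn_phi p0 p_not_root1 nu_theta nu_p like F1 RI pD pM pS pX ps pE.
have tt := turn_turn p0 p_not_root1 nu_theta nu_p like F1 pD pM pX pE zw.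
have bt := between_all p0 p_not_root1 nu_theta nu_p like E1 W_ind F1 RI pD pM pS pX ps pE.
have inj b r := @Psi_phi_inj _ _ _ _ p0 p_not_root1 nu_theta nu_p _ _ _ _ klR F1 RI _ _ _ _ _
  pD pM pS pX ps pE true _ (PsiD true) (PsiM true) (Psi_scalar true) (@Psi_x true)
  (@Psi_s true) (@Psi_E true) b r.
have tinj' b r := @Psi_turn_inj _ _ _ _ p0 p_not_root1 nu_theta nu_p _ _ _ _ klR F1 RI _ _ _ _ _ _
  pD pM pS pX ps pE (~~ b) _ (PsiD (~~ b)) (PsiM (~~ b)) (Psi_scalar (~~ b)) (@Psi_x (~~ b))
  (@Psi_s (~~ b)) (@Psi_E (~~ b)) (Psi_pi (~~ b)) r.
have tinj b (r : R) : full_turn s pi m * end_hom p0 kl b r = 0 -> r = 0.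
  by case: b; [exact: (tinj' true) | exact: (tinj' false)].
have wf i : exists LT : W * W,
    LT.1 * (end_hom p0 kl true (1 : R) + end_hom p0 kl false (1 : R)) * LT.2 = E (nth 1 (val (i : Th))).
  have gi : good (nth 1 (val i)) by rewrite goodE tupf_nth; exact: valP.
  have [L [T LT]] := word_factor p0 p_not_root1 nu_theta nu_p like F1 pD pM pE gi.
  by exists (L, T).
have [LT LTE] := choice wf.
have full : \sum_(i : Th) (LT i).1 *
    (end_hom p0 kl true (1 : R) + end_hom p0 kl false (1 : R)) * (LT i).2 = 1.
  by rewrite -E1; apply: eq_bigr => i _; exact: LTE.
have res := two_ends_morita (@klr_z_central k p m _ (etrans (dv_plus_p p nu) nu_p)) pD pM pS cc tp tt
  inj tinj bt full.
exact: res.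
Qed.

End Assembly.

Theorem theorem2p45 (k : fieldType) (p q : k) (m : nat)
    (nu : {fsfun k -> nat with 0%N})
    (char_k : 2%N \notin [pchar k])
    (p_neq0 : p != 0) (q_neq0 : q != 0)
    (p_neq1 : p != 1) (p_neqN1 : p != -1)
    (p_not_pow_q : forall n : int, p != q ^ n)
    (q_not_pow_p : forall n : int, q != p ^ n)
    (I_1 : 1 \notin Iset p) (I_N1 : -1 \notin Iset p)
    (I_p : p \in Iset p) (I_q : q \notin Iset p)
    (p_not_root1 : forall n : nat, (0 < n)%N -> p ^+ n != 1)
    (nu_theta : in_theta_NI p nu)
    (nu_size : dv_size nu = m.*2)
    (nu_p : nu p = 2%N) :
  morita_equivalent (VV p m nu)
    (alg_restrict (@polyC k) (tensor_alg (KLR_plus_z m nu_p) (Atilde_z k))).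
Proof.
(* The letter p contributes nu_p = 2 to the size 2m of nu. *)
have m0 : (0 < m)%N.
  have pn : p \in finsupp nu by rewrite mem_finsupp nu_p.
  have := nu_size; rewrite /dv_size (big_fsetD1 p) //= nu_p; lia.
have like := W_vv_like m nu p_neq0 p_not_root1.
apply: (@vv_morita k p m nu p_neq0 p_not_root1 nu_theta nu_p m0 _ _ _ _ _ like (WE1 p m nu) _
  (@sign_action k p m nu)).
- exact: VV_ind.
- exact: sign_actionD.
- exact: sign_actionM.
- exact: sign_action_scalar.
- exact: sign_action_x.
- exact: sign_action_s.
- exact: sign_action_E.
- exact: sign_action_pi.
Qed.
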